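(* Let $A$ be a simple, separable, unital, tracially $\mathcal{Z}$-absorbing $C^*$-algebra and let $\alpha\in\mathrm{Aut}(A)$ be an automorphism with the generalized tracial Rokhlin property. If there is a positive integer $m$ such that $\alpha^m$ acts trivially on the tracial state space $T(A)$ (that is, $\tau\circ\alpha^m=\tau$ for all $\tau\in T(A)$), then $A\rtimes_\alpha\mathbb{Z}$ is also tracially $\mathcal{Z}$-absorbing.
   Context: Cuntz subequivalence: for positive elements $a,b$ of a $C^*$-algebra $B$, $a\precsim b$ means there is a sequence $(x_n)$ in $B$ with $\lim_n\|a-x_nbx_n^*\|=0$. A completely positive contractive (c.p.c.) map $\varphi:B\to C$ has order zero if $\varphi(a)\varphi(b)=0$ whenever $a,b\in B_+$ satisfy $ab=0$. A unital $C^*$-algebra $A$ is tracially $\mathcal{Z}$-absorbing if $A\not\cong\mathbb{C}$ and for every finite set $F\subset A$, every $\varepsilon>0$, every non-zero positive $a\in A$ and every positive integer $n$ there is a c.p.c. order zero map $\varphi:M_n\to A$ such that: (1) $1-\varphi(1)\precsim a$; (2) $\|[\varphi(x),y]\|<\varepsilon$ for every $x\in M_n$ with $\|x\|=1$ and every $y\in F$. An automorphism $\alpha$ of a simple unital $C^*$-algebra $A$ has the generalized tracial Rokhlin property if for every finite $F\subseteq A$, every $\varepsilon>0$, every positive integer $k$ and every non-zero positive $a\in A$ there exist pairwise orthogonal positive elements $e_1,\dots,e_k\in A$ of norm $1$ such that: (1) $1-\sum_{i=1}^ke_i\precsim a$; (2) $\|[e_i,y]\|<\varepsilon$ for all $i$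 and all $y\in F$; (3) $\|\alpha(e_i)-e_{i+1}\|<\varepsilon$ for all $1\le i\le k-1$. (It is not required that $\alpha(e_k)$ be close to $e_1$.) *)

(* Defs.v *)
From HB Require Import structures.
From mathcomp Require Import all_boot all_order all_algebra.
From mathcomp Require Import all_classical all_reals all_analysis.
From mathcomp Require Export complex.

Set Implicit Arguments.
Unset Strict Implicit.
Unset Printing Implicit Defensive.

Import Order.TTheory GRing.Theory Num.Theory.
Import numFieldNormedType.Exports.

Local Open Scope classical_set_scope.
Local Open Scope ring_scope.
Local Open Scope complex_scope.

HB.mixin Record PzRing_isStar T of GRing.PzRing T := {
  star : T -> T;
  starK : involutive star;
  starD : {morph star : x y / x + y};
  starM : forall x y, star (x * y) = star y * star x
}.

#[short(type="pzStarRingType")]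
HB.structure Definition PzStarRing := {T of GRing.PzRing T & PzRing_isStar T}.

(* Unital C*-algebras.  `NzRing` is part of algType: the zero algebra is excluded.
   The norm is R-valued and belongs to this structure: MathComp's norms cannot be
   combined with its (noncommutative) ring structures. *)
HB.mixin Record isCstarAlgebra (R : realType) A
    of PzStarRing A & GRing.Algebra R[i] A := {
  cnorm : A -> R;
  cnorm0_eq0 : forall x, cnorm x = 0 -> x = 0;
  cnormD : forall x y, cnorm (x + y) <= cnorm x + cnorm y;
  cnormZ : forall (c : R[i]) x,
    cnorm (c *: x) = ComplexField.Normc.normc c * cnorm x;
  cnormM : forall x y, cnorm (x * y) <= cnorm x * cnorm y;
  cnorm_complete : forall x : nat -> A,
    (forall eps : R, 0 < eps -> exists N : nat, forall m n : nat,
       (N <= m)%N -> (N <= n)%N -> cnorm (x m - x n) < eps) ->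
    exists l : A, cnorm (x n - l) @[n --> \oo] --> (0 : R);
  starZ : forall (c : R[i]) (x : A), star (c *: x) = conjc c *: star x;
  cnorm_star : forall x, cnorm (star x * x) = cnorm x ^+ 2
}.

#[short(type="cstarAlgType")]
HB.structure Definition CstarAlgebra (R : realType) :=
  {A of isCstarAlgebra R A & PzStarRing A & GRing.Algebra R[i] A}.

Section ComplexStar.
Variable R : realType.

Lemma conjc_involutive : involutive (@conjc R).
Proof. by case=> a b /=; rewrite opprK. Qed.

Lemma conjc_antimul (x y : R[i]) : conjc (x * y) = conjc y * conjc x.
Proof. by rewrite rmorphM mulrC. Qed.

HB.instance Definition _ := PzRing_isStar.Build R[i]
  conjc_involutive (rmorphD conjc) conjc_antimul.

End ComplexStar.

Section MatrixStar.
Variables (T : pzStarRingType) (n : nat).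

Definition mxstar (X : 'M[T]_n) : 'M[T]_n := \matrix_(i, j) star (X j i).

Lemma mxstarK : involutive mxstar.
Proof. by move=> X; apply/matrixP=> i j; rewrite !mxE starK. Qed.

Lemma mxstarD : {morph mxstar : X Y / X + Y}.
Proof. by move=> X Y; apply/matrixP=> i j; rewrite !mxE starD. Qed.

Lemma mxstarM (X Y : 'M[T]_n) : mxstar (X * Y) = mxstar Y * mxstar X.
Proof.
have star0 : star (0 : T) = 0.
  by apply: (addrI (star (0 : T))); rewrite -starD !addr0.
apply/matrixP=> i j; rewrite !mxE (big_morph star (@starD T) star0).
by apply: eq_bigr => k _; rewrite !mxE starM.
Qed.

HB.instance Definition _ :=
  PzRing_isStar.Build 'M[T]_n mxstarK mxstarD mxstarM.

End MatrixStar.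

Section OperatorNorm.
Variable R : realType.

Definition l2norm n (v : 'cV[R[i]]_n) : R :=
  Num.sqrt (\sum_i (ComplexField.Normc.normc (v i ord0)) ^+ 2).

(* The C*-norm of M_n(C); it is not the (entrywise maximum) norm `|X| that the
   library attaches to matrices. *)
Definition opnorm n (X : 'M[R[i]]_n) : R :=
  sup [set l2norm (X *m v) | v in [set v : 'cV[R[i]]_n | l2norm v <= 1]].

End OperatorNorm.

Section Positivity.

Definition positive (T : pzStarRingType) (a : T) : Prop :=
  exists x : T, a = star x * x.

(* map_mx phi is the amplification of phi to k x k matrices over B and C, whose
   involution is the conjugate transpose mxstar. *)
Definition completely_positive (B C : pzStarRingType) (phi : B -> C) : Prop :=
  forall (k : nat) (X : 'M[B]_k), positive X -> positive (map_mx phi X).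

Definition order_zero (B C : pzStarRingType) (phi : B -> C) : Prop :=
  forall a b : B, positive a -> positive b -> a * b = 0 -> phi a * phi b = 0.

End Positivity.

Section CstarNotions.
Variable R : realType.
Implicit Types A B D : cstarAlgType R.

(* Unital *-homomorphisms. *)
Definition star_hom A B (f : A -> B) : Prop :=
  [/\ linear f, GRing.monoid_morphism f & {morph f : x / star x}].

Definition star_automorphism A (alpha : A -> A) : Prop :=
  star_hom alpha /\ bijective alpha.

Definition isomorphic_to_C A : Prop :=
  exists f : A -> R[i],
    [/\ linear f, GRing.monoid_morphism f, {morph f : x / star x}
      & bijective f].

Definition simple_cstar A : Prop :=
  forall I : set A,
    (forall (x : nat -> A) (l : A), (forall n, I (x n)) ->
       cnorm (x n - l) @[n --> \oo] --> (0 : R) -> I l) ->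
    I 0 ->
    (forall x y, I x -> I y -> I (x + y)) ->
    (forall a x, I x -> I (a * x) /\ I (x * a)) ->
    I = [set 0] \/ I = setT.

Definition separable_cstar A : Prop :=
  exists S : set A, countable S /\
    forall (a : A) (eps : R), 0 < eps -> exists2 s, S s & cnorm (a - s) < eps.

Definition cuntz_le A (a b : A) : Prop :=
  exists x : nat -> A,
    cnorm (a - x n * b * star (x n)) @[n --> \oo] --> (0 : R).

Definition cpc_order_zero A n (phi : 'M[R[i]]_n -> A) : Prop :=
  [/\ linear phi, completely_positive phi,
      (forall X, cnorm (phi X) <= opnorm X) & order_zero phi].

Definition tracially_Z_absorbing A : Prop :=
  ~ isomorphic_to_C A /\
  forall (F : seq A) (eps : R) (a : A) (n : nat),
    0 < eps -> positive a -> a != 0 -> (0 < n)%N ->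
    exists phi : 'M[R[i]]_n -> A,
      [/\ cpc_order_zero phi,
          cuntz_le (1 - phi 1%:M) a
        & forall (X : 'M[R[i]]_n) (y : A), opnorm X = 1 -> y \in F ->
            cnorm (phi X * y - y * phi X) < eps].

Definition generalized_tracial_Rokhlin A (alpha : A -> A) : Prop :=
  forall (F : seq A) (eps : R) (k : nat) (a : A),
    0 < eps -> (0 < k)%N -> positive a -> a != 0 ->
    exists e : 'I_k -> A,
      [/\ (forall i, positive (e i) /\ cnorm (e i) = 1),
          (forall i j, i != j -> e i * e j = 0),
          cuntz_le (1 - \sum_i e i) a,
          (forall i y, y \in F -> cnorm (e i * y - y * e i) < eps)
        & forall i j : 'I_k, j = i.+1 :> nat ->
            cnorm (alpha (e i) - e j) < eps].

Definition tracial_state A (tau : A -> R[i]) : Prop :=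
  [/\ linear tau, (forall a, positive a -> 0 <= tau a), tau 1 = 1
    & forall a b, tau (a * b) = tau (b * a)].

Definition unitary A (u : A) : Prop := star u * u = 1 /\ u * star u = 1.

(* Covariant representations of (A, Z, alpha), n acting through u ^ n. *)
Definition covariant A B (alpha : A -> A) (iota : A -> B) (u : B) : Prop :=
  [/\ star_hom iota, unitary u
    & forall a, u * iota a * star u = iota (alpha a)].

(* B, with iota and u, is the full crossed product of A by alpha: the universal
   C*-algebra for covariant representations (equal to the reduced one, as Z is
   amenable). *)
Definition crossed_product A (alpha : A -> A) B (iota : A -> B) (u : B) : Prop :=
  covariant alpha iota u /\
  forall (D : cstarAlgType R) (pi : A -> D) (v : D), covariant alpha pi v ->
    exists! rho : B -> D,
      [/\ star_hom rho, (forall a, rho (iota a) = pi a) & rho u = v].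

End CstarNotions.

(* Main.v *)
Require Import Defs.
From HB Require Import structures.
From mathcomp Require Import all_boot all_order all_algebra.
From mathcomp Require Import all_classical all_reals all_analysis.
From mathcomp Require Import zify ring lra spectral.

Set Implicit Arguments.
Unset Strict Implicit.
Unset Printing Implicit Defensive.

Import Order.TTheory GRing.Theory Num.Theory.
Import numFieldNormedType.Exports.

Local Open Scope classical_set_scope.
Local Open Scope ring_scope.
Local Open Scope complex_scope.

(* Fix a positive b in A lying Cuntz-below the given element of the crossed product (a
   conditional expectation and the Rokhlin towers provide it), and split it into orthogonal
   pieces b_0, b_1, b_2.  Take a Rokhlin tower e_0, ..., e_(k-1) in A with remainder below b_0,
   and an order zero map from M_n (x) M_k into A, almost commuting with everything in sight
   and with remainder below many orthogonal pieces of b_2.  Conjugating it by u^p on the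
   floor e_p, with trapezoidal weights f_p vanishing at both ends of the tower, yields
   sum_p f_p e_p u^p phi(x (x) 1) u^(-p), which is asymptotically order zero and almost
   commutes with u because the weights vary slowly.  Its defect has three parts: the remainder
   of the tower, the remainders of the order zero maps, and the mass 1 - f_p lost on the ramps.
   The last is pushed below b_1: A is simple, so 1 = sum_s r_s b_1 r_s^*, and the additional
   factor M_k contains, for each pair (ramp floor, s), a column of its own in which to store a
   copy of that floor.

   Limits are taken in the algebra of bounded sequences modulo null sequences; order zero
   systems of matrix units lift from there up to a power of the image of the unit. *)

(** Since [alpha (e_k)] need not return to [e_1], the weights must vanish at both ends of the tower,
    and the tolerance dictates how slowly. The mass lost on the ramps has to be compared with an
    element fixed beforehand, and the order of choices makes this possible: the tolerance fixes the
    ramp length [l], simplicity fixes the number [M] of terms in [1 = sum_s r_s b_1 r_s^*], and only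
    then is the height [m + 1] chosen, with [m = 2 l M], so that the [2 l] ramp floors times [M]
    indices get a column each. A whole floor fits into one column because the diagonal units of
    [M_k] cut floor [p] into [k] pieces, and piece [q] is carried by [u^(q-p)] to floor [q], where a
    matrix unit sends it to the prescribed column: one floor out of [k] fills one column out of [k]
    on every floor. The relations are handled as exact identities in the sequence algebra; order
    zero relations, positivity and Cuntz comparison are then realized at each finite stage. *)

(* Equality in noncommutative rings by expansion into signed words. *)
Inductive nc_expr := NcVar of nat | Nc0 | Nc1 | NcAdd of nc_expr & nc_expr
  | NcOpp of nc_expr | NcMul of nc_expr & nc_expr.

Section NcRing.
Variable T : pzRingType.
Variable env : seq T.

Fixpoint nc_eval e : T :=
  match e with
  | NcVar i => nth 0 env i
  | Nc0 => 0
  | Nc1 => 1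
  | NcAdd a b => nc_eval a + nc_eval b
  | NcOpp a => - nc_eval a
  | NcMul a b => nc_eval a * nc_eval b
  end.

Fixpoint nc_words e : seq (bool * seq nat) :=
  match e with
  | NcVar i => [:: (false, [:: i])]
  | Nc0 => [::]
  | Nc1 => [:: (false, [::])]
  | NcAdd a b => nc_words a ++ nc_words b
  | NcOpp a => [seq (~~ w.1, w.2) | w <- nc_words a]
  | NcMul a b => [seq (w.1 (+) v.1, w.2 ++ v.2) | w <- nc_words a, v <- nc_words b]
  end.

Definition nc_word (w : bool * seq nat) : T :=
  (-1) ^+ w.1 * \prod_(i <- w.2) nth 0 env i.

Definition nc_sum s := \sum_(w <- s) nc_word w.

Lemma nc_wordsE e : nc_eval e = nc_sum (nc_words e).
Proof.
rewrite /nc_sum; elim: e => [i| | |a + b|a|a + b] /= => [| | |-> ->|->|-> ->].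
- by rewrite big_seq1 /nc_word expr0 mul1r big_seq1.
- by rewrite big_nil.
- by rewrite big_seq1 /nc_word expr0 mul1r big_nil.
- by rewrite big_cat.
- rewrite big_map -sumrN; apply: eq_bigr => w _.
  by rewrite /nc_word signrN mulNr.
- rewrite big_allpairs_dep /= mulr_suml.
  apply: eq_bigr => w _; rewrite mulr_sumr.
  apply: eq_bigr => v _; rewrite /nc_word big_cat signr_addb -!mulrA; congr (_ * _).
  by rewrite !mulrA; congr (_ * _); apply: commr_sign.
Qed.

Definition nc_cancel1 w (s : seq (bool * seq nat)) :=
  if (~~ w.1, w.2) \in s then rem (~~ w.1, w.2) s else w :: s.

Lemma nc_cancel1E w s : nc_sum (nc_cancel1 w s) = nc_word w + nc_sum s.
Proof.
rewrite /nc_cancel1 /nc_sum; case: ifP => [ws|_]; last by rewrite big_cons.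
rewrite [in RHS](big_rem _ ws) /= addrA.
have -> : nc_word (~~ w.1, w.2) = - nc_word w by rewrite /nc_word signrN mulNr.
by rewrite subrr add0r.
Qed.

Lemma nc_equal a b : nilp (foldr nc_cancel1 [::] (nc_words (NcAdd a (NcOpp b)))) ->
  nc_eval a = nc_eval b.
Proof.
move=> /nilP ab; apply/eqP; rewrite -subr_eq0 -/(nc_eval (NcAdd a (NcOpp b))) nc_wordsE.
suff <- : nc_sum (foldr nc_cancel1 [::] (nc_words (NcAdd a (NcOpp b)))) =
    nc_sum (nc_words (NcAdd a (NcOpp b))) by rewrite ab /nc_sum big_nil.
elim: (nc_words _) => //= w s IH.
by rewrite nc_cancel1E IH /nc_sum big_cons.
Qed.

End NcRing.

(** [match goal with _ => unify x y end] runs while the term is being built, so atoms are compared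
    up to unification. Powers, stars and scalar multiples count as atoms. *)
Ltac nc_find x l :=
  match l with
  | ?y :: _ => let _ := match goal with _ => unify x y end in constr:(O)
  | _ :: ?l' => let n := nc_find x l' in constr:(S n)
  end.

Ltac nc_mem x l :=
  match l with
  | ?y :: _ => let _ := match goal with _ => unify x y end in constr:(true)
  | _ :: ?l' => nc_mem x l'
  | _ => constr:(false)
  end.

Ltac nc_atoms l x :=
  match x with
  | @GRing.add _ ?a ?b => let l1 := nc_atoms l a in nc_atoms l1 b
  | @GRing.opp _ ?a => nc_atoms l a
  | @GRing.mul _ ?a ?b => let l1 := nc_atoms l a in nc_atoms l1 b
  | @GRing.zero _ => l
  | @GRing.one _ => l
  | _ => match nc_mem x l with true => l | false => constr:(x :: l) end
  end.

Ltac nc_quote l x :=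
  match x with
  | @GRing.add _ ?a ?b =>
      let p := nc_quote l a in let q := nc_quote l b in constr:(NcAdd p q)
  | @GRing.opp _ ?a => let p := nc_quote l a in constr:(NcOpp p)
  | @GRing.mul _ ?a ?b =>
      let p := nc_quote l a in let q := nc_quote l b in constr:(NcMul p q)
  | @GRing.zero _ => constr:(Nc0)
  | @GRing.one _ => constr:(Nc1)
  | _ => let n := nc_find x l in constr:(NcVar n)
  end.

Ltac ncring :=
  match goal with
  | |- @eq ?T ?a ?b =>
      let l0 := nc_atoms (@nil T) a in
      let l := nc_atoms l0 b in
      let p := nc_quote l a in
      let q := nc_quote l b in
      exact (@nc_equal _ l p q isT)
  end.

(** * C*-algebra preliminaries *)

Section RealNull.
Variable R : realType.
Implicit Types r s : nat -> R.

(** No absolute value: the sequences at hand are norms or bounds of norms, and comparison then needs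
    one inequality only. *)
Definition null r := forall e : R, 0 < e -> exists N : nat, forall n, (N <= n)%N -> r n < e.

Lemma null_le r s : null s -> (forall n, r n <= s n) -> null r.
Proof.
move=> s0 rs e e0; have [N sN] := s0 _ e0.
by exists N => n /sN; apply: le_lt_trans.
Qed.

Lemma nullD r s : null r -> null s -> null (fun n => r n + s n).
Proof.
move=> r0 s0 e e0; have e2 : 0 < e / 2 by lra.
have [N rN] := r0 _ e2; have [M sM] := s0 _ e2.
exists (maxn N M) => n; rewrite geq_max => /andP[/rN + /sM]; lra.
Qed.

Lemma nullMl (c : R) r : null r -> (forall n, 0 <= r n) -> null (fun n => c * r n).
Proof.
move=> r0 rge e e0.
have c0 : 0 < `|c| + 1 by have := normr_ge0 c; lra.
have [N rN] := r0 (e / (`|c| + 1)) (divr_gt0 e0 c0).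
exists N => n /rN; rewrite ltr_pdivlMr // => h.
apply: le_lt_trans h; rewrite mulrC; apply: ler_wpM2l => //.
by have := ler_norm c; lra.
Qed.

Lemma null0 : null (fun=> 0).
Proof. by move=> e e0; exists 0%N. Qed.

Lemma null_eq r s : r =1 s -> null r -> null s.
Proof. by move=> rs r0; apply: null_le r0 _ => n; rewrite rs. Qed.

Lemma null_sum (I : Type) (l : seq I) (r : I -> nat -> R) :
  (forall i, null (r i)) -> null (fun n => \sum_(i <- l) r i n).
Proof.
move=> r0; elim: l => [|i l IH]; first by apply: null_eq null0 => n; rewrite big_nil.
by apply: null_eq (nullD (r0 i) IH) => n; rewrite big_cons.
Qed.

Lemma null_inv : null (fun n => n.+1%:R^-1).
Proof.
move=> e e0; pose N := Num.bound e^-1.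
exists N => n Nn.
have h : e^-1 < N%:R by have := archi_boundP (ltW (x:=0) (y:=e^-1) _); rewrite invr_gt0 e0; apply.
rewrite -[e]invrK ltf_pV2 ?posrE ?invr_gt0 //.
by apply: lt_le_trans h _; rewrite ler_nat; apply: leq_trans Nn _.
Qed.

Lemma null_lt r (e : R) : null r -> 0 < e -> exists n, r n < e.
Proof. by move=> r0 /r0[N]; exists N; auto. Qed.

End RealNull.

Section StarRing.
Variable T : pzStarRingType.
Implicit Types (x y : T).

Lemma star0 : star (0 : T) = 0.
Proof. by apply: (addrI (star (0 : T))); rewrite -starD !addr0. Qed.

Lemma starN x : star (- x) = - star x.
Proof. by apply/eqP; rewrite -addr_eq0 -starD addNr star0. Qed.

Lemma starB x y : star (x - y) = star x - star y.
Proof. by rewrite starD starN. Qed.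

Lemma star1 : star (1 : T) = 1.
Proof. by rewrite -[LHS]mulr1 -[X in _ * X]starK -starM mulr1 starK. Qed.

Lemma star_sum I (r : seq I) (P : pred I) (F : I -> T) :
  star (\sum_(i <- r | P i) F i) = \sum_(i <- r | P i) star (F i).
Proof. exact: (big_morph star (@starD T) star0). Qed.

Lemma starX x n : star (x ^+ n) = star x ^+ n.
Proof. by elim: n => [|n IH]; rewrite ?expr0 ?star1 // exprS starM IH exprSr. Qed.

End StarRing.

Section Basics.
Variables (R : realType) (A : cstarAlgType R).
Implicit Types (x y z : A) (t : R) (u v : nat -> A).

Lemma starZr t x : star (t%:C *: x) = t%:C *: star x.
Proof. by rewrite starZ conjc_real. Qed.

Lemma star_alg t : star (t%:C%:A : A) = t%:C%:A.
Proof. by rewrite starZr star1. Qed.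

Lemma normcR t : ComplexField.Normc.normc t%:C = `|t|.
Proof. by rewrite /ComplexField.Normc.normc /= expr0n /= addr0 sqrtr_sqr. Qed.

Lemma cnormZr t x : cnorm (t%:C *: x) = `|t| * cnorm x.
Proof. by rewrite cnormZ normcR. Qed.

Lemma cnorm0 : cnorm (0 : A) = 0.
Proof. by rewrite -(scale0r (0 : A)) cnormZ ComplexField.Normc.normc0 mul0r. Qed.

Lemma cnormN x : cnorm (- x) = cnorm x.
Proof.
rewrite -scaleN1r cnormZ.
have -> : ComplexField.Normc.normc (-1 : R[i]) = 1; last by rewrite mul1r.
have -> : (-1 : R[i]) = (-1 : R)%:C by rewrite rmorphN rmorph1.
by rewrite normcR normrN1.
Qed.

Lemma cnorm_ge0 x : 0 <= cnorm x.
Proof. by have := cnormD x (- x); rewrite subrr cnorm0 cnormN; lra. Qed.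

Lemma cnormB x y : cnorm (x - y) <= cnorm x + cnorm y.
Proof. by rewrite -(cnormN y); exact: cnormD. Qed.

Lemma cnorm_distC x y : cnorm (x - y) = cnorm (y - x).
Proof. by rewrite -cnormN opprB. Qed.

Lemma cnorm_triangle y x z : cnorm (x - z) <= cnorm (x - y) + cnorm (y - z).
Proof. by rewrite -{1}(subrK y x) -addrA; exact: cnormD. Qed.

Lemma cnorm_le_dist x y : cnorm x <= cnorm y + cnorm (x - y).
Proof. by rewrite -{1}(subrK y x) addrC; exact: cnormD. Qed.

Lemma cnorm_eq0 x : (cnorm x == 0) = (x == 0).
Proof.
by apply/eqP/eqP => [/cnorm0_eq0 //|->]; exact: cnorm0.
Qed.

Lemma cnorm_gt0 x : (0 < cnorm x) = (x != 0).
Proof. by rewrite lt_neqAle cnorm_ge0 andbT eq_sym cnorm_eq0. Qed.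

Lemma cnorm_le0 x : cnorm x <= 0 -> x = 0.
Proof. by move=> x0; apply: cnorm0_eq0; apply/eqP; rewrite eq_le x0 cnorm_ge0. Qed.

Lemma cnorm_starE x : cnorm (star x) = cnorm x.
Proof.
suff H y : cnorm y <= cnorm (star y).
  by apply/eqP; rewrite eq_le H -{2}(starK x) H.
have [->|y0] := eqVneq y 0; first by rewrite star0.
have := cnormM (star y) y; rewrite cnorm_star expr2 ler_pM2r //.
by rewrite cnorm_gt0.
Qed.

Lemma cnorm1 : cnorm (1 : A) = 1.
Proof.
have := cnorm_star (1 : A); rewrite star1 mulr1 expr2 => /eqP.
rewrite -{1}[cnorm 1]mulr1 -subr_eq0 -mulrBr mulf_eq0 cnorm_eq0 oner_eq0 /=.
by rewrite subr_eq0 => /eqP.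
Qed.

Lemma cnorm_alg t : cnorm (t%:C%:A : A) = `|t|.
Proof. by rewrite cnormZr cnorm1 mulr1. Qed.

Lemma cnorm_sum I (r : seq I) (P : pred I) (F : I -> A) :
  cnorm (\sum_(i <- r | P i) F i) <= \sum_(i <- r | P i) cnorm (F i).
Proof.
elim/big_rec2: _ => [|i y1 y2 _ H]; first by rewrite cnorm0.
by apply: le_trans (cnormD _ _) _; rewrite lerD2l.
Qed.

Lemma cnormM_le x y (a b : R) : cnorm x <= a -> cnorm y <= b -> cnorm (x * y) <= a * b.
Proof.
by move=> xa yb; apply: le_trans (cnormM _ _) _; apply: ler_pM => //; exact: cnorm_ge0.
Qed.

Lemma cnormX x n : cnorm (x ^+ n) <= cnorm x ^+ n.
Proof.
elim: n => [|n IH]; first by rewrite !expr0 cnorm1.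
by rewrite !exprS; exact: cnormM_le.
Qed.

Lemma cnorm_sa_sqr x : star x = x -> cnorm (x * x) = cnorm x ^+ 2.
Proof. by move=> sx; rewrite -{1}sx cnorm_star. Qed.

Lemma star_mul_eq0 x : star x * x = 0 -> x = 0.
Proof.
move=> xx; apply: cnorm0_eq0; have := cnorm_star x; rewrite xx cnorm0.
by move/esym/eqP; rewrite sqrf_eq0 => /eqP.
Qed.

Definition cvgs u (l : A) := null (fun n => cnorm (u n - l)).

Lemma cvgsP u l : (cnorm (u n - l) @[n --> \oo] --> (0 : R)) <-> cvgs u l.
Proof.
split=> [/cvgrPdist_lt H e e0|H].
  have [N _ HN] := H _ e0; exists N => n Nn.
  by have := HN n Nn; rewrite /= sub0r normrN ger0_norm ?cnorm_ge0.
apply/cvgrPdist_lt => e e0; have [N HN] := H _ e0.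
by exists N => // n Nn /=; rewrite sub0r normrN ger0_norm ?cnorm_ge0 //; exact: HN.
Qed.

Lemma cvgs_cst x : cvgs (fun=> x) x.
Proof. by apply: null_eq (@null0 R) => n; rewrite subrr cnorm0. Qed.

Lemma cvgs_ext u v l : u =1 v -> cvgs u l -> cvgs v l.
Proof. by move=> uv ul; apply: null_eq ul => n; rewrite uv. Qed.

Lemma cvgs_uniq u l l' : cvgs u l -> cvgs u l' -> l = l'.
Proof.
move=> ul ul'; apply/eqP; rewrite -subr_eq0 -cnorm_eq0 -[_ == _]negbK.
apply/negP => h; have [] := @null_lt R _ (cnorm (l - l')) (nullD ul ul').
  by rewrite lt_neqAle eq_sym h cnorm_ge0.
move=> n; rewrite ltNge => /negP; apply.
by rewrite (cnorm_distC (u n) l); exact: cnorm_triangle.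
Qed.

Lemma cvgsD u v l m : cvgs u l -> cvgs v m -> cvgs (fun n => u n + v n) (l + m).
Proof.
move=> ul vm; apply: null_le (nullD ul vm) _ => n.
by rewrite opprD addrACA; exact: cnormD.
Qed.

Lemma cvgsMl u l x : cvgs u l -> cvgs (fun n => x * u n) (x * l).
Proof.
move=> ul; apply: null_le (nullMl (cnorm x) ul _) _ => n; first exact: cnorm_ge0.
by rewrite -mulrBr; exact: cnormM.
Qed.

Lemma cvgsMr u l x : cvgs u l -> cvgs (fun n => u n * x) (l * x).
Proof.
move=> ul; apply: null_le (nullMl (cnorm x) ul _) _ => n; first exact: cnorm_ge0.
by rewrite -mulrBl mulrC; exact: cnormM.
Qed.

Lemma cvgsZ u l (c : R[i]) : cvgs u l -> cvgs (fun n => c *: u n) (c *: l).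
Proof.
move=> /(cvgsMl c%:A); rewrite mulr_algl; apply: cvgs_ext => n.
by rewrite mulr_algl.
Qed.

Lemma cvgsN u l : cvgs u l -> cvgs (fun n => - u n) (- l).
Proof.
by move=> ul; apply: null_le ul _ => n; rewrite -opprD cnormN.
Qed.

Lemma cvgsB u v l m : cvgs u l -> cvgs v m -> cvgs (fun n => u n - v n) (l - m).
Proof. by move=> ul /cvgsN; exact: cvgsD. Qed.

Lemma cvgs_star u l : cvgs u l -> cvgs (fun n => star (u n)) (star l).
Proof. by move=> ul; apply: null_le ul _ => n; rewrite -starB cnorm_starE. Qed.

Lemma cvgs_norm_le u l (M : R) : cvgs u l -> (forall n, cnorm (u n) <= M) -> cnorm l <= M.
Proof.
move=> ul uM; rewrite leNgt; apply/negP => h.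
have [|n] := @null_lt R _ (cnorm l - M) ul; first by rewrite subr_gt0.
by have := cnorm_le_dist l (u n); have := uM n; rewrite cnorm_distC; lra.
Qed.

Lemma cvgs_bounded u l : cvgs u l -> exists2 M : R, 0 < M & forall n, cnorm (u n) <= M.
Proof.
move=> ul; have [N HN] := ul 1 ltr01.
exists (\sum_(i < N) cnorm (u i) + (cnorm l + 1)).
  apply: ltr_wpDl; first by apply: sumr_ge0 => i _; exact: cnorm_ge0.
  by have := cnorm_ge0 l; lra.
move=> n; case: (leqP N n) => [/HN|nN].
  have : 0 <= \sum_(i < N) cnorm (u i) by apply: sumr_ge0 => i _; exact: cnorm_ge0.
  by have := cnorm_le_dist (u n) l; lra.
rewrite (bigD1 (Ordinal nN)) //= -addrA lerDl addr_ge0 //.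
  by apply: sumr_ge0 => i _; exact: cnorm_ge0.
by have := cnorm_ge0 l; lra.
Qed.

Lemma cvgsM u v l m : cvgs u l -> cvgs v m -> cvgs (fun n => u n * v n) (l * m).
Proof.
move=> ul vm; have [M M0 uM] := cvgs_bounded ul.
apply: null_le (nullD (nullMl M vm _) (nullMl (cnorm m) ul _)) _; try by move=> n; exact: cnorm_ge0.
move=> n; have -> : u n * v n - l * m = u n * (v n - m) + (u n - l) * m.
  by rewrite mulrBr mulrBl addrA subrK.
apply: le_trans (cnormD _ _) _; apply: lerD; first by apply: cnormM_le.
by rewrite mulrC; apply: cnormM_le.
Qed.

Lemma cauchy_cvgs u (r : nat -> R) : null r ->
  (forall m n, (n <= m)%N -> cnorm (u m - u n) <= r n) -> exists l, cvgs u l.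
Proof.
move=> r0 ur; have [|l /cvgsP] := @cnorm_complete R A u; last by exists l.
move=> e e0; have [|N HN] := r0 (e / 2); first by lra.
exists N => m n Nm Nn; have := ur _ _ Nm; have := ur _ _ Nn; have := HN N (leqnn N).
by have := cnorm_triangle (u N) (u m) (u n); rewrite (cnorm_distC (u N)); lra.
Qed.

End Basics.

(** * Positive elements and their square roots *)

Notation sc t := (t%:C%:A).

Section Sqrt.
Variables (R : realType) (A : cstarAlgType R).
Implicit Types (x y z s a b : A) (t c : R).

(* [y = (x + y ^ 2) / 2] amounts to [(1 - y) ^ 2 = 1 - x]; the scalar iteration at
   [x = 1] dominates the one at any [x] of norm at most 1. *)
Fixpoint sqrt_iter x n : A :=
  if n is m.+1 then (2^-1)%:C *: (x + sqrt_iter x m * sqrt_iter x m) else 0.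

Fixpoint sqrt_iterR n : R :=
  if n is m.+1 then 2^-1 * (1 + sqrt_iterR m * sqrt_iterR m) else 0.

Lemma sqrt_iterR_itv n : 0 <= sqrt_iterR n <= 1.
Proof. by elim: n => [|n /andP[h0 h1]] /=; apply/andP; split; nra. Qed.

(** The gap [g] to the fixed point 1 obeys [g' = g - g ^ 2 / 2], hence decays like [2 / n]. *)
Lemma sqrt_iterR_gap n : 1 - sqrt_iterR n <= 2 * n.+1%:R^-1.
Proof.
suff: 1 - sqrt_iterR n <= 2 * n.+2%:R^-1.
  move=> /le_trans; apply; rewrite ler_pM2l //.
  by rewrite lef_pV2 ?posrE // ler_nat.
elim: n => [|n IH] /=; first by rewrite subr0 divff // pnatr_eq0.
have /andP[h0 h1] := sqrt_iterR_itv n.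
set d := sqrt_iterR n in IH h0 h1 *.
have N0 : 0 < n.+2%:R :> R by [].
set N : R := n.+2%:R in IH N0 *.
have -> : n.+3%:R = N + 1 :> R by rewrite /N -natr1.
have {}IH : (1 - d) * N <= 2 by rewrite -ler_pdivlMr.
have N2 : 2 <= N by rewrite /N ler_nat.
rewrite ler_pdivlMr; last by lra.
nra.
Qed.

Lemma sqrt_iter_norm x n : cnorm x <= 1 -> cnorm (sqrt_iter x n) <= sqrt_iterR n.
Proof.
move=> x1; elim: n => [|n IH] /=; first by rewrite cnorm0.
rewrite cnormZr ger0_norm; last by lra.
rewrite ler_pM2l; last by lra.
by apply: le_trans (cnormD _ _) _; apply: lerD => //; apply: cnormM_le.
Qed.

Lemma sqrt_iter_step x n : cnorm x <= 1 ->
  cnorm (sqrt_iter x n.+1 - sqrt_iter x n) <= sqrt_iterR n.+1 - sqrt_iterR n.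
Proof.
move=> x1; elim: n => [|n IH].
  rewrite /= mulr0 addr0 subr0 cnormZr ger0_norm; last by lra.
  by rewrite !mulr0 addr0 subr0 ler_pM2l; lra.
have ynorm m := sqrt_iter_norm m x1; have := ynorm n; have := ynorm n.+1.
have /andP[] := sqrt_iterR_itv n; have /andP[] := sqrt_iterR_itv n.+1.
have step a b : (2^-1)%:C *: (x + a * a) - (2^-1)%:C *: (x + b * b) =
    (2^-1)%:C *: (a * (a - b) + (a - b) * b) :> A.
  by rewrite -scalerBr mulrBr mulrBl addrA subrK opprD addrACA subrr add0r.
rewrite -[sqrt_iter x n.+2 - _]/((2^-1)%:C *: (x + sqrt_iter x n.+1 * sqrt_iter x n.+1)
   - (2^-1)%:C *: (x + sqrt_iter x n * sqrt_iter x n)) step.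
rewrite -[sqrt_iterR n.+2 - _]/(2^-1 * (1 + sqrt_iterR n.+1 * sqrt_iterR n.+1)
   - 2^-1 * (1 + sqrt_iterR n * sqrt_iterR n)).
move: (sqrt_iter x n.+1) (sqrt_iter x n) (sqrt_iterR n.+1) (sqrt_iterR n) IH => a b r s.
move=> dab r0 r1 s0 s1 ar bs.
rewrite cnormZr ger0_norm -?mulrBr ?ler_pM2l ?invr_ge0 ?invr_gt0 //.
apply: le_trans (cnormD _ _) _.
have h1 : cnorm (a * (a - b)) <= r * (r - s) by apply: cnormM_le.
have h2 : cnorm ((a - b) * b) <= (r - s) * s by apply: cnormM_le.
by apply: le_trans (lerD h1 h2) _; lra.
Qed.

Lemma sqrt_iter_cauchy x n k : cnorm x <= 1 ->
  cnorm (sqrt_iter x (k + n) - sqrt_iter x n) <= sqrt_iterR (k + n) - sqrt_iterR n.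
Proof.
move=> x1; elim: k => [|k IH]; first by rewrite !subrr cnorm0.
apply: le_trans (cnorm_triangle (sqrt_iter x (k + n)) _ _) _.
by have := sqrt_iter_step (k + n) x1; rewrite addSn; lra.
Qed.

Definition sqrt_lim x : A := xget 0 [set l | cvgs (sqrt_iter x) l].

Lemma sqrt_lim_cvg x : cnorm x <= 1 -> cvgs (sqrt_iter x) (sqrt_lim x).
Proof.
move=> x1; suff [l xl] : exists l, cvgs (sqrt_iter x) l.
  by rewrite /sqrt_lim; apply: (xgetPex 0); exists l.
apply: (@cauchy_cvgs R A _ (fun n => 2 * n.+1%:R^-1)).
  by apply: nullMl (@null_inv R) _ => n; rewrite invr_ge0.
move=> m n nm; rewrite -(subnK nm); apply: le_trans (sqrt_iter_cauchy _ _ x1) _.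
have /andP[_ h] := sqrt_iterR_itv (m - n + n).
by apply: le_trans (sqrt_iterR_gap n); lra.
Qed.

Lemma sqrt_lim_norm x : cnorm x <= 1 -> cnorm (sqrt_lim x) <= 1.
Proof.
move=> x1; apply: cvgs_norm_le (sqrt_lim_cvg x1) _ => n.
by apply: le_trans (sqrt_iter_norm n x1) _; have /andP[] := sqrt_iterR_itv n.
Qed.

Lemma cvgs_shift (u : nat -> A) l : cvgs u l -> cvgs (fun n => u n.+1) l.
Proof.
by move=> ul e /ul[N HN]; exists N => n Nn; apply: HN; apply: leq_trans Nn _.
Qed.

Lemma sqrt_lim_sqr x : cnorm x <= 1 -> (1 - sqrt_lim x) * (1 - sqrt_lim x) = 1 - x.
Proof.
move=> x1; have xl := sqrt_lim_cvg x1; set l := sqrt_lim x in xl *.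
have H : l = (2^-1)%:C *: (x + l * l).
  apply: cvgs_uniq (cvgs_shift xl) _; rewrite /=.
  by apply: cvgsZ; apply: cvgsD; [exact: cvgs_cst|exact: cvgsM].
have {}H : l + l = x + l * l.
  rewrite {1 2}H -scalerDl -rmorphD /=.
  have -> : 2^-1 + 2^-1 = 1 :> R by lra.
  by rewrite scale1r.
have -> : (1 - l) * (1 - l) = 1 - (l + l) + l * l by ncring.
by rewrite H; ncring.
Qed.

Lemma sqrt_lim_intertwine x z y : cnorm x <= 1 -> cnorm z <= 1 -> y * x = z * y ->
  y * sqrt_lim x = sqrt_lim z * y.
Proof.
move=> x1 z1 yx; apply: cvgs_uniq (cvgsMl y (sqrt_lim_cvg x1)) _.
apply: cvgs_ext (cvgsMr y (sqrt_lim_cvg z1)) => n.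
elim: n => [|n IH] /=; first by rewrite mulr0 mul0r.
by rewrite -scalerAl -scalerAr mulrDr mulrDl yx mulrA -IH -!mulrA IH.
Qed.

Lemma sqrt_lim_star x : cnorm x <= 1 -> star x = x -> star (sqrt_lim x) = sqrt_lim x.
Proof.
move=> x1 sx; apply: cvgs_uniq (cvgs_star (sqrt_lim_cvg x1)) _.
apply: cvgs_ext (sqrt_lim_cvg x1) => n.
by elim: n => [|n IH] /=; rewrite ?star0 // starZr starD starM -IH sx.
Qed.

(* Self-adjoint elements whose spectrum is nonnegative. *)
Definition psd x := star x = x /\ exists2 t, 0 <= t & cnorm (sc t - x) <= t.

Lemma psd_sa x : psd x -> star x = x. Proof. by case. Qed.

Lemma sc_add t c : sc (t + c) = sc t + sc c :> A.
Proof. by rewrite rmorphD scalerDl. Qed.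

Lemma scM t c : sc (t * c) = sc t * sc c :> A.
Proof. by rewrite rmorphM /= mulr_algl scalerA. Qed.

Lemma sc_comm t x : x * sc t = sc t * x.
Proof. by rewrite mulr_algl mulr_algr. Qed.

Lemma psd_wide x t c : t <= c -> cnorm (sc t - x) <= t -> cnorm (sc c - x) <= c.
Proof.
move=> tc xt; have -> : sc c - x = sc (c - t) + (sc t - x).
  by rewrite sc_add rmorphN scaleNr addrA subrK.
by apply: le_trans (cnormD _ _) _; rewrite cnorm_alg ger0_norm; lra.
Qed.

Lemma psdD x y : psd x -> psd y -> psd (x + y).
Proof.
move=> [sx [t t0 xt]] [sy [c c0 yc]]; split; first by rewrite starD sx sy.
exists (t + c); first by lra.
by rewrite sc_add opprD addrACA; apply: le_trans (cnormD _ _) _; lra.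
Qed.

Lemma psdZ x c : 0 <= c -> psd x -> psd (c%:C *: x).
Proof.
move=> c0 [sx [t t0 xt]]; split; first by rewrite starZr sx.
exists (c * t); first by apply: mulr_ge0.
by rewrite rmorphM -scalerA -scalerBr cnormZr ger0_norm // ler_wpM2l.
Qed.

Lemma psd_sc t : 0 <= t -> psd (sc t).
Proof. by move=> t0; split; [exact: star_alg|exists t; rewrite // subrr cnorm0]. Qed.

Lemma psd0 : psd 0.
Proof. by have := psd_sc (lexx 0); rewrite scale0r. Qed.

Lemma psd1 : psd 1.
Proof. by have := psd_sc ler01; rewrite scale1r. Qed.

Lemma psd_sum I (r : seq I) (P : pred I) (F : I -> A) :
  (forall i, P i -> psd (F i)) -> psd (\sum_(i <- r | P i) F i).
Proof. by move=> H; elim/big_rec: _ => [|i y Pi]; [exact: psd0|apply: psdD; exact: H]. Qed.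

Lemma psd_scB x t : star x = x -> cnorm x <= t -> psd (sc t - x).
Proof.
move=> sx xt; have t0 : 0 <= t := le_trans (cnorm_ge0 x) xt.
split; first by rewrite starB star_alg sx.
by exists t; rewrite // opprB addrCA subrr addr0.
Qed.

(** The scale [t] remains a parameter so that two elements can be treated at a common scale in
    [rootat_intertwine]; [csqrt_rootat] shows that the root does not depend on it. *)
Definition rootat t x : A := (Num.sqrt t)%:C *: (1 - sqrt_lim (1 - t^-1%:C *: x)).

Lemma rootat_dom t x : 0 < t -> cnorm (sc t - x) <= t -> cnorm (1 - t^-1%:C *: x) <= 1.
Proof.
move=> t0 xt; have -> : 1 - t^-1%:C *: x = t^-1%:C *: (sc t - x).
  by rewrite scalerBr scalerA -rmorphM mulVf ?gt_eqF // scale1r.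
have h : 0 <= t^-1 by rewrite invr_ge0 ltW.
by rewrite cnormZr ger0_norm // mulrC ler_pdivrMr // mul1r.
Qed.

Lemma rootat_sqr t x : 0 < t -> cnorm (sc t - x) <= t -> rootat t x * rootat t x = x.
Proof.
move=> t0 xt; rewrite /rootat -scalerAl -scalerAr scalerA -rmorphM -expr2.
rewrite sqr_sqrtr ?ltW // sqrt_lim_sqr; last exact: rootat_dom.
by rewrite opprB addrCA subrr addr0 scalerA -rmorphM divff ?gt_eqF // scale1r.
Qed.

Lemma rootat_psd t x : 0 < t -> cnorm (sc t - x) <= t -> star x = x -> psd (rootat t x).
Proof.
move=> t0 xt sx; have d := rootat_dom t0 xt.
have sl : star (sqrt_lim (1 - t^-1%:C *: x)) = sqrt_lim (1 - t^-1%:C *: x).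
  by apply: sqrt_lim_star => //; rewrite starB star1 starZr sx.
apply: psdZ; first exact: sqrtr_ge0.
by have := psd_scB sl (sqrt_lim_norm d); rewrite scale1r.
Qed.

Lemma rootat_intertwine t x z y : 0 < t -> cnorm (sc t - x) <= t -> cnorm (sc t - z) <= t ->
  y * x = z * y -> y * rootat t x = rootat t z * y.
Proof.
move=> t0 xt zt yx; rewrite /rootat -scalerAl -scalerAr mulrBr mulrBl mulr1 mul1r.
rewrite (sqrt_lim_intertwine (z := 1 - t^-1%:C *: z)) ?rootat_dom //.
by rewrite mulrBr mulrBl mulr1 mul1r -scalerAl -scalerAr yx.
Qed.

Lemma psd_root x : psd x ->
  exists s, [/\ psd s, s * s = x & forall y, y * x = x * y -> y * s = s * y].
Proof.
move=> [sx [t t0 xt]]; have xt' : cnorm (sc (t + 1) - x) <= t + 1.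
  by apply: psd_wide xt; lra.
have t1 : 0 < t + 1 by lra.
exists (rootat (t + 1) x); split; [exact: rootat_psd|exact: rootat_sqr|].
by move=> y yx; apply: rootat_intertwine.
Qed.

Definition ii : R[i] := Complex 0 1.

Lemma ii2 : ii * ii = -1.
Proof. by rewrite /ii; apply/eqP; rewrite eq_complex /=; apply/andP; split; apply/eqP; ring. Qed.

Lemma conj_ii : conjc ii = - ii.
Proof. by apply/eqP; rewrite eq_complex /= oppr0 !eqxx. Qed.

(* Commuting self-adjoint [a], [b] with [a ^ 2 + b ^ 2 = c] make [a + i b] a multiple
   of a unitary. *)
Lemma circle_norm a b c : star a = a -> star b = b -> a * b = b * a ->
  a * a + b * b = sc c -> 0 <= c -> cnorm a ^+ 2 <= c.
Proof.
move=> sa sb ab abc c0; pose w := a + ii *: b.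
have sw : star w = a - ii *: b by rewrite starD starZ conj_ii sa sb scaleNr.
have ww : star w * w = sc c.
  rewrite sw /w -abc; have : a * (ii *: b) = ii *: b * a by rewrite -scalerAl -scalerAr ab.
  have : ii *: b * (ii *: b) = - (b * b).
    by rewrite -scalerAl -scalerAr scalerA ii2 scaleN1r.
  move: (ii *: b) => e ee ae.
  have -> : (a - e) * (a + e) = a * a + (a * e - e * a) - e * e by ncring.
  by rewrite ae subrr addr0 ee opprK.
have nw : cnorm w ^+ 2 = c by rewrite -cnorm_star ww cnorm_alg ger0_norm.
have aw : (2%:R : R)%:C *: a = w + star w.
  by rewrite sw /w addrACA subrr addr0 rmorph_nat scaler_nat mulr2n.
have : cnorm a <= cnorm w.
  have := cnormD w (star w); rewrite -aw cnorm_starE cnormZr ger0_norm //; lra.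
by rewrite -nw; have := cnorm_ge0 a; nra.
Qed.

(** [t - y ^ 2] has a root [s], because its distance to [t] is [||y ^ 2|| <= t]. The circle
    [y ^ 2 + s ^ 2 = t] then bounds [s ^ 2 = t - y ^ 2] by [t], which is the estimate that [psd]
    asks for. *)
Lemma psd_sqr y : star y = y -> psd (y * y).
Proof.
move=> sy; pose t := cnorm y ^+ 2 + 1.
have t0 : 0 < t by rewrite /t; have := sqr_ge0 (cnorm y); lra.
have yyt : cnorm (y * y) <= t by rewrite cnorm_sa_sqr // /t; lra.
have syy : star (y * y) = y * y by rewrite starM sy.
have [sg [c c0 gc]] := psd_scB syy yyt.
have [|s [[ss _] sE sc]] := @psd_root (sc t - y * y); first by split=> //; exists c.
split=> //; exists t; first exact: ltW.
rewrite -sE cnorm_sa_sqr //; apply: (@circle_norm _ y) => //; last exact: ltW.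
  by rewrite sc // mulrBr mulrBl sc_comm mulrA.
by rewrite sE subrK.
Qed.

(** The roots of [a] and [c - a] commute, and their squares add up to [c]. *)
Lemma psd_norm a c : 0 <= c -> psd a -> psd (sc c - a) -> cnorm a <= c.
Proof.
move=> c0 pa pb; have [s [ps sE sc]] := psd_root pa.
have [r [pr rE rc]] := psd_root pb.
rewrite -sE cnorm_sa_sqr ?psd_sa //; apply: (@circle_norm _ r) => //; try exact: psd_sa.
  by apply: rc; rewrite mulrBr mulrBl sc_comm -sE mulrA.
by rewrite sE rE addrC subrK.
Qed.

Lemma psd_antisym a : psd a -> psd (- a) -> a = 0.
Proof.
move=> pa pb; apply: cnorm_le0; apply: psd_norm => //.
by rewrite scale0r add0r.
Qed.

Lemma psd_cnorm_dist a c : psd a -> cnorm a <= c -> cnorm (sc c - a) <= c.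
Proof.
move=> pa ac; apply: psd_norm.
- exact: le_trans (cnorm_ge0 a) ac.
- by apply: psd_scB => //; exact: psd_sa.
- by rewrite opprB addrCA subrr addr0.
Qed.

Lemma psd_lim (u : nat -> A) l : (forall n, psd (u n)) -> cvgs u l -> psd l.
Proof.
move=> pu ul; split.
  apply: cvgs_uniq (cvgs_star ul) _; apply: cvgs_ext ul => n.
  by rewrite psd_sa.
have [M M0 uM] := cvgs_bounded ul; exists M; first exact: ltW.
apply: cvgs_norm_le (cvgsB (cvgs_cst (sc M)) ul) _ => n.
exact: psd_cnorm_dist.
Qed.

Lemma psd_mul a b : psd a -> psd b -> a * b = b * a -> psd (a * b).
Proof.
move=> pa pb ab; have [s [ps sE sc]] := psd_root pa; have [r [pr rE rc]] := psd_root pb.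
have rs : r * s = s * r by apply: sc; apply/esym; apply: rc.
have -> : a * b = (s * r) * (s * r).
  by rewrite -sE -rE -!mulrA; congr (_ * _); rewrite !mulrA rs.
by apply: psd_sqr; rewrite starM !psd_sa.
Qed.

Lemma sa_mul_eq0 a b : star a = a -> star b = b -> a * b = b * a -> a * b * b = 0 -> a * b = 0.
Proof.
move=> sa sb ab abb; apply: star_mul_eq0; rewrite starM sa sb.
by rewrite -ab {2}ab mulrA abb mul0r.
Qed.

(** With [d = a - b], the relation [d (a + b) = 0] gives [d ^ 2 a = - d ^ 2 b], where [d ^ 2 a] and
    [d ^ 2 b] are both positive, so both vanish and [d ^ 3 = 0]. *)
Lemma psd_root_uniq a b : psd a -> psd b -> a * b = b * a -> a * a = b * b -> a = b.
Proof.
move=> pa pb ab aabb; have sa := psd_sa pa; have sb := psd_sa pb.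
pose d := a - b; have sd : star d = d by rewrite starB sa sb.
have dab : d * (a + b) = 0.
  by rewrite mulrDr !mulrBl ab aabb addrA subrK subrr.
have da : d * a = a * d by rewrite mulrBl mulrBr ab.
have db : d * b = b * d by rewrite mulrBl mulrBr ab.
have H : d * d * a = - (d * d * b).
  by apply/eqP; rewrite -addr_eq0 -mulrDr -mulrA dab mulr0.
have ddc (c : A) : d * c = c * d -> (d * d) * c = c * (d * d).
  by move=> dc; rewrite -mulrA dc mulrA dc mulrA.
have dda : d * d * a = 0.
  apply: psd_antisym; first by apply: psd_mul; [exact: psd_sqr|by []|exact: ddc].
  by rewrite H opprK; apply: psd_mul; [exact: psd_sqr|by []|exact: ddc].
have ddb : d * d * b = 0 by apply/eqP; rewrite -oppr_eq0 -H dda.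
have d3 : d * d * d = 0 by rewrite {3}/d mulrBr dda ddb subr0.
have d2 : d * d = 0 by apply: sa_mul_eq0.
by apply/eqP; rewrite -subr_eq0; apply/eqP; apply: star_mul_eq0; rewrite -/d sd.
Qed.

(** For use where the positivity of [s ^ 3] is visible and that of [s] is not. The root [r] of
    [s ^ 2] satisfies [r ^ 3 = s ^ 3] by uniqueness of roots, whence [(r - s) s = 0] and [r = s]. *)
Lemma psd_cube s : star s = s -> psd (s * s * s) -> psd s.
Proof.
move=> ss p3; have [r [pr rE rc]] := psd_root (psd_sqr ss).
have rs : r * s = s * r by apply/esym/rc; rewrite mulrA.
have sr := psd_sa pr.
have rss : r * (s * s) = s * s * r by rewrite mulrA rs -mulrA rs mulrA.
have r3 : r * r * r = s * s * s.
  apply: psd_root_uniq => //.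
  - by rewrite rE -rss; apply: psd_mul => //; exact: psd_sqr.
  - have h : GRing.comm r (s * s * s) by do 2!apply: commrM => //.
    have {}h := commr_sym h.
    by apply/esym; do 2!apply: commrM => //.
  - have -> : r * r * r * (r * r * r) = (r * r) * (r * r) * (r * r) by ncring.
    by rewrite rE; ncring.
pose d := r - s; have sd : star d = d by rewrite starB sr ss.
have ds : d * s = s * d by rewrite mulrBl mulrBr rs.
have dss : d * s * s = 0.
  have h : r * (s * s) = s * s * s by rewrite -r3 -rE mulrA.
  by rewrite -mulrA mulrBl h; ncring.
have ds0 : d * s = 0 by apply: sa_mul_eq0.
have dr0 : d * r = 0.
  by rewrite mulrBl rE -rs -mulrBl -[_ * s]opprK -mulNr opprB ds0 oppr0.
have d2 : star d * d = 0 by rewrite sd {2}/d mulrBr ds0 dr0 subrr.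
by move/star_mul_eq0/eqP: d2; rewrite subr_eq0 => /eqP <-.
Qed.

Definition csqrt x : A := xget 0 [set s | psd s /\ s * s = x].

Lemma csqrt_spec x : psd x -> psd (csqrt x) /\ csqrt x * csqrt x = x.
Proof.
move=> /psd_root[s [ps sE _]].
by rewrite /csqrt; apply: (@xgetPex _ 0 [set s | psd s /\ s * s = x]); exists s.
Qed.

Lemma csqrt_psd x : psd x -> psd (csqrt x). Proof. by case/csqrt_spec. Qed.

Lemma csqrt_sa x : psd x -> star (csqrt x) = csqrt x.
Proof. by move/csqrt_psd/psd_sa. Qed.

Lemma csqrtE x : psd x -> csqrt x * csqrt x = x. Proof. by case/csqrt_spec. Qed.

Lemma csqrt_rootat t x : psd x -> 0 < t -> cnorm (sc t - x) <= t -> csqrt x = rootat t x.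
Proof.
move=> px t0 xt; have [ps sE] := csqrt_spec px.
apply: psd_root_uniq => //; first exact: rootat_psd (psd_sa px).
  by apply: rootat_intertwine; rewrite // -{2 3}sE mulrA.
by rewrite sE rootat_sqr.
Qed.

Lemma csqrt_uniq s x : psd s -> s * s = x -> csqrt x = s.
Proof.
move=> ps sE; have px : psd x by rewrite -sE; apply: psd_sqr; exact: psd_sa.
have [_ [t t0 xt]] := px.
have t1 : 0 < t + 1 by lra.
have xt' : cnorm (sc (t + 1) - x) <= t + 1 by apply: psd_wide xt; lra.
apply: psd_root_uniq => //; [exact: csqrt_psd| |by rewrite csqrtE].
rewrite (csqrt_rootat px t1 xt'); apply/esym; apply: rootat_intertwine => //.
by rewrite -sE mulrA.
Qed.

Lemma csqrt_intertwine x z y : psd x -> psd z -> y * x = z * y ->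
  y * csqrt x = csqrt z * y.
Proof.
move=> px pz yx; have [_ [t t0 xt]] := px; have [_ [c c0 zc]] := pz.
have t1 : 0 < t + c + 1 by lra.
have xt' : cnorm (sc (t + c + 1) - x) <= t + c + 1 by apply: psd_wide xt; lra.
have zt' : cnorm (sc (t + c + 1) - z) <= t + c + 1 by apply: psd_wide zc; lra.
by rewrite (csqrt_rootat px t1 xt') (csqrt_rootat pz t1 zt'); apply: rootat_intertwine.
Qed.

Lemma csqrt_comm x y : psd x -> y * x = x * y -> y * csqrt x = csqrt x * y.
Proof. by move=> px; exact: csqrt_intertwine. Qed.

Definition cabs x := csqrt (x * x).

Definition pospart x : A := (2^-1)%:C *: (cabs x + x).

Lemma cabs_psd x : star x = x -> psd (cabs x).
Proof. by move=> sx; apply: csqrt_psd; exact: psd_sqr. Qed.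

Lemma cabsE x : star x = x -> cabs x * cabs x = x * x.
Proof. by move=> sx; apply: csqrtE; exact: psd_sqr. Qed.

Lemma cabsN x : cabs (- x) = cabs x. Proof. by rewrite /cabs mulrNN. Qed.

Lemma cabs_comm x : star x = x -> x * cabs x = cabs x * x.
Proof. by move=> sx; apply: csqrt_comm; [exact: psd_sqr|rewrite mulrA]. Qed.

(** For [s = |x| + x] one has [s ^ 2 = 2 |x| s], so [s ^ 3 = 2 |x| s ^ 2] is a product of commuting
    positive elements. *)
Lemma cabs_addl_psd x : star x = x -> psd (cabs x + x).
Proof.
move=> sx; have r2 := cabsE sx; have rx := cabs_comm sx; have pr := cabs_psd sx.
have sr := psd_sa pr; move: (cabs x) r2 rx pr sr => r r2 rx pr sr.
have s2 : (r + x) * (r + x) = 2%:R * (r * (r + x)).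
  have -> : (r + x) * (r + x) = r * r + r * x + (x * r) + x * x by ncring.
  by rewrite -r2 rx mulr2n; ncring.
apply: psd_cube; first by rewrite starD sr sx.
rewrite s2 -2!mulrA; have -> : 2%:R * (r * ((r + x) * (r + x))) =
  (2%:R : R)%:C *: (r * ((r + x) * (r + x))) by rewrite rmorph_nat scaler_nat mulr_natl.
apply: psdZ => //; apply: psd_mul => //.
  by apply: psd_sqr; rewrite starD sr sx.
have rrx : GRing.comm r (r + x) by apply: commrD => //; exact/esym.
exact: commrM.
Qed.

Lemma pospart_psd x : star x = x -> psd (pospart x).
Proof. by move=> sx; apply: psdZ; [lra|exact: cabs_addl_psd]. Qed.

Lemma scale_halves x : (2^-1)%:C *: x + (2^-1)%:C *: x = x.
Proof.
rewrite -scalerDl -rmorphD /=; have -> : 2^-1 + 2^-1 = 1 :> R by lra.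
by rewrite scale1r.
Qed.

Lemma pospartB x : pospart x - pospart (- x) = x.
Proof.
rewrite /pospart cabsN -scalerBr.
have -> : cabs x + x - (cabs x - x) = x + x by ncring.
by rewrite scalerDr scale_halves.
Qed.

Lemma pospart_orth x : star x = x -> pospart x * pospart (- x) = 0.
Proof.
move=> sx; rewrite /pospart cabsN -scalerAl -scalerAr.
have -> : (cabs x + x) * (cabs x - x) = cabs x * cabs x - x * x + (x * cabs x - cabs x * x) by ncring.
by rewrite cabsE // cabs_comm // !subrr addr0 !scaler0.
Qed.

Lemma pospart_intertwine x z y : star x = x -> star z = z -> y * x = z * y ->
  y * pospart x = pospart z * y.
Proof.
move=> sx sz yx; rewrite /pospart -scalerAl -scalerAr mulrDr mulrDl yx.
rewrite (csqrt_intertwine (z := z * z)) //; try exact: psd_sqr.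
by rewrite mulrA yx -mulrA yx mulrA.
Qed.

Lemma pospart_id x : psd x -> pospart x = x.
Proof.
move=> px; rewrite /pospart /cabs (csqrt_uniq px (erefl _)).
by rewrite scalerDr scale_halves.
Qed.

Lemma pospart_opp x : psd x -> pospart (- x) = 0.
Proof.
move=> px; rewrite /pospart cabsN /cabs (csqrt_uniq px (erefl _)).
by rewrite subrr scaler0.
Qed.

End Sqrt.

(** * Resolvents, the positivity of [x^* x] and the order on self-adjoint elements *)

Section Order.
Variables (R : realType) (A : cstarAlgType R).
Implicit Types (x y z s a b q : A) (t c : R).

Lemma null_geometric (rho M : R) : 0 <= rho < 1 -> 0 <= M -> null (fun n => M * rho ^+ n).
Proof.
move=> /andP[r0 r1] M0; apply: nullMl => [|n]; last exact: exprn_ge0.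
move=> e e0; have : `|rho| < 1 by rewrite ger0_norm.
move/cvg_expr/cvgrPdist_lt/(_ e e0) => [N _ HN]; exists N => n Nn.
by have := HN n Nn; rewrite /= sub0r normrN ger0_norm ?exprn_ge0.
Qed.

Lemma neumann x : cnorm x < 1 -> exists v, (1 - x) * v = 1.
Proof.
move=> x1; pose v := fix v n := if n is m.+1 then 1 + x * v m else 0 : A.
have r0 : 0 <= cnorm x := cnorm_ge0 x; set r := cnorm x in x1 r0 *.
have step n : cnorm (v n.+1 - v n) <= r ^+ n.
  elim: n => [|n IH]; first by rewrite /= mulr0 addr0 subr0 cnorm1 expr0.
  rewrite -[v n.+2]/(1 + x * v n.+1) -[v n.+1 in X in _ - X]/(1 + x * v n).
  have -> : 1 + x * v n.+1 - (1 + x * v n) = x * (v n.+1 - v n) by ncring.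
  by rewrite exprS; exact: cnormM_le.
have dist n k : (1 - r) * cnorm (v (k + n) - v n) <= r ^+ n * (1 - r ^+ k).
  elim: k => [|k IH]; first by rewrite !subrr cnorm0 !mulr0.
  have := cnorm_triangle (v (k + n)) (v (k + n).+1) (v n); have := step (k + n)%N.
  rewrite exprD exprS => h1 h2.
  have h3 : (1 - r) * (cnorm (v (k + n).+1 - v n)) <=
     (1 - r) * (r ^+ k * r ^+ n + cnorm (v (k + n) - v n)).
    by apply: ler_wpM2l; [lra|apply: le_trans h2 _; lra].
  by apply: le_trans h3 _; move: IH; move: (r ^+ k) (r ^+ n) => p q'; lra.
have [|m n nm|l vl] := @cauchy_cvgs R A v (fun n => (1 - r)^-1 * r ^+ n).
- by apply: null_geometric; [apply/andP|rewrite invr_ge0; lra].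
- rewrite -ler_pdivrMl ?invr_gt0 ?invrK; last by lra.
  rewrite -(subnK nm); apply: le_trans (dist _ _) _.
  rewrite -[leRHS]mulr1; apply: ler_wpM2l; first exact: exprn_ge0.
  by have := exprn_ge0 (m - n) r0; lra.
exists l; have H : l = 1 + x * l.
  apply: cvgs_uniq (cvgs_shift vl) _ => /=.
  by apply: cvgsD; [exact: cvgs_cst|exact: cvgsMl].
by rewrite mulrBl mul1r {1}H addrK.
Qed.

(** The resolvent [(c + q)^-1]. As [c] tends to 0, [q (c + q)^-1] acts as an approximate unit for
    [q]; this takes the place of a general functional calculus. *)
Definition cinv c q : A := xget 0 [set v | (sc c + q) * v = 1].

Lemma cinvE c q : 0 < c -> psd q -> (sc c + q) * cinv c q = 1.
Proof.
move=> c0 [sq [t t0 qt]]; suff [v vE] : exists v, (sc c + q) * v = 1.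
  by apply: (@xgetPex _ 0 [set v | (sc c + q) * v = 1]); exists v.
have K0 : 0 < c + t by lra.
have Ki0 : 0 < (c + t)^-1 by rewrite invr_gt0.
have [|v vE] := @neumann ((c + t)^-1%:C *: (sc t - q)).
  rewrite cnormZr (ger0_norm (ltW Ki0)) mulrC ltr_pdivrMr // mul1r.
  by apply: le_lt_trans qt _; lra.
exists ((c + t)^-1%:C *: v); rewrite -scalerAr scalerAl -[RHS]vE; congr (_ * _).
have -> : sc c + q = sc (c + t) - (sc t - q) by rewrite sc_add; ncring.
by rewrite scalerBr scalerA -rmorphM mulVf ?gt_eqF // scale1r.
Qed.

Lemma cinv_sa c q : 0 < c -> psd q -> star (cinv c q) = cinv c q.
Proof.
move=> c0 pq; have vE := cinvE c0 pq.
have := congr1 star vE; rewrite starM starD star_alg (psd_sa pq) star1.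
by move=> h; rewrite -[LHS]mulr1 -vE mulrA h mul1r.
Qed.

Lemma cinvV c q : 0 < c -> psd q -> cinv c q * (sc c + q) = 1.
Proof.
move=> c0 pq; have := congr1 star (cinvE c0 pq).
by rewrite starM starD star_alg (psd_sa pq) star1 cinv_sa.
Qed.

Lemma cinv_intertwine c q q' y : 0 < c -> psd q -> psd q' -> y * q = q' * y ->
  y * cinv c q = cinv c q' * y.
Proof.
move=> c0 pq pq' yq; have h : (sc c + q') * y = y * (sc c + q).
  by rewrite mulrDl mulrDr sc_comm yq.
by rewrite -[LHS]mul1r -(cinvV c0 pq') -mulrA [X in _ * X]mulrA h -[y * _ * _]mulrA cinvE // mulr1.
Qed.

Lemma cinv_comm c q y : 0 < c -> psd q -> y * q = q * y -> y * cinv c q = cinv c q * y.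
Proof. by move=> c0 pq; exact: cinv_intertwine. Qed.

Lemma cinv_commq c q : 0 < c -> psd q -> q * cinv c q = cinv c q * q.
Proof. by move=> c0 pq; exact: cinv_comm. Qed.

Lemma cinv_psd c q : 0 < c -> psd q -> psd (cinv c q).
Proof.
move=> c0 pq; have sv := cinv_sa c0 pq; have vq := cinv_commq c0 pq.
have := cinvE c0 pq; set v := cinv c q in sv vq * => vE.
have -> : v = c%:C *: (v * v) + q * (v * v).
  by rewrite -mulr_algl -mulrDl mulrA vE mul1r.
apply: psdD; first by apply: psdZ; [exact: ltW|exact: psd_sqr].
by apply: psd_mul => //; [exact: psd_sqr|apply: commrM].
Qed.

Lemma cinv_1sub c q : 0 < c -> psd q -> 1 - c%:C *: cinv c q = q * cinv c q.
Proof.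
move=> c0 pq; rewrite -(cinvE c0 pq) mulrDl mulr_algl.
by rewrite addrC addKr.
Qed.

Lemma cinv_norm c q : 0 < c -> psd q -> cnorm (cinv c q) <= c^-1.
Proof.
move=> c0 pq; apply: psd_norm; first by rewrite invr_ge0 ltW.
  exact: cinv_psd.
have -> : sc c^-1 - cinv c q = c^-1%:C *: (q * cinv c q).
  rewrite -cinv_1sub // scalerBr scalerA -rmorphM mulVf ?gt_eqF //.
  by rewrite scale1r.
apply: psdZ; first by rewrite invr_ge0 ltW.
by apply: psd_mul; rewrite // ?cinv_commq //; exact: cinv_psd.
Qed.

Lemma mul_cinv_psd1 c q : 0 < c -> psd q -> psd (1 - q * cinv c q).
Proof.
move=> c0 pq; rewrite -cinv_1sub // opprB addrCA subrr addr0.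
by apply: psdZ; [exact: ltW|exact: cinv_psd].
Qed.

Lemma mul_cinv_psd c q : 0 < c -> psd q -> psd (q * cinv c q).
Proof. by move=> c0 pq; apply: psd_mul; rewrite // ?cinv_commq //; exact: cinv_psd. Qed.

Lemma mulrn_sc x n : x *+ n = (n%:R : R)%:C *: x.
Proof. by rewrite rmorph_nat scaler_nat. Qed.

Lemma cnormMn x n : cnorm (x *+ n) = n%:R * cnorm x.
Proof. by rewrite mulrn_sc cnormZr ger0_norm. Qed.

Lemma psdMn x n : psd x -> psd (x *+ n).
Proof. by move=> px; rewrite mulrn_sc; exact: psdZ. Qed.

Lemma psdX x n : psd x -> psd (x ^+ n).
Proof.
move=> px; elim: n => [|n IH]; first by rewrite expr0; exact: psd1.
by rewrite exprS; apply: psd_mul => //; rewrite -exprS -exprSr.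
Qed.

(** The powers [(1 - a) ^ i] decrease, so [n a (1 - a) ^ n] is at most the telescoping sum of the
    [a (1 - a) ^ i], which is [1 - (1 - a) ^ n]. *)
Lemma mul_expr_1sub_norm a n : psd a -> psd (1 - a) -> n%:R * cnorm (a * (1 - a) ^+ n) <= 1.
Proof.
move=> pa pb; have ab : a * (1 - a) = (1 - a) * a by ncring.
have abn k : a * (1 - a) ^+ k = (1 - a) ^+ k * a by apply: commrX.
have pbn k : psd ((1 - a) ^+ k) by exact: psdX.
rewrite -cnormMn; apply: psd_norm => //.
  by apply: psdMn; apply: psd_mul.
have -> : sc (1 : R) - (a * (1 - a) ^+ n) *+ n =
    (1 - (1 - a) ^+ n - (a * (1 - a) ^+ n) *+ n) + (1 - a) ^+ n.
  by rewrite scale1r; ncring.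
apply: psdD => //; elim: n => [|n IH]; first by rewrite subrr subr0; exact: psd0.
have -> : 1 - (1 - a) ^+ n.+1 - (a * (1 - a) ^+ n.+1) *+ n.+1 =
    1 - (1 - a) ^+ n - (a * (1 - a) ^+ n) *+ n + (a * a * (1 - a) ^+ n) *+ n.+1.
  rewrite exprS; set c := (1 - a) ^+ n.
  have -> : a * ((1 - a) * c) = a * c - a * a * c by ncring.
  by rewrite mulrnBl [in LHS](mulrS (a * c)); ncring.
apply: psdD => //; apply: psdMn; apply: psd_mul => //.
  by apply: psd_sqr; exact: psd_sa.
by apply: commr_sym; apply: commrM; exact: commr_sym.
Qed.

(* If [-y^*y >= 0] then [yy^* = 2 (b ^ 2 + c ^ 2) - y^*y >= 0] for [y = b + i c];
   with [m = -y^*y] and [p = yy^*], [y m = (1 + p)^-n (y m (1 - m) ^ n)], whose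
   norm is [O (1 / n)]. *)
Lemma psd_opp_star_mul y : psd (- (star y * y)) -> y = 0.
Proof.
wlog y1 : y / cnorm y <= 1.
  move=> H pm; have c0 : 0 < (cnorm y + 1)^-1 by rewrite invr_gt0; have := cnorm_ge0 y; lra.
  have : (cnorm y + 1)^-1%:C *: y = 0.
    apply: H; last first.
      rewrite starZr -scalerAl -scalerAr -!scalerN.
      by do 2![apply: psdZ; first exact: ltW].
    have y0 : cnorm y + 1 != 0 by rewrite gt_eqF //; have := cnorm_ge0 y; lra.
    rewrite cnormZr (ger0_norm (ltW c0)) -[leRHS](mulVf y0).
    by apply: ler_wpM2l; [exact: ltW|lra].
  by move/(congr1 (@cnorm R A)); rewrite cnorm0 cnormZr => /eqP; rewrite mulf_eq0 normr_eq0 gt_eqF //= cnorm_eq0 => /eqP.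
set m := - (star y * y) => pm.
have m1 : psd (1 - m).
  have := @psd_scB _ _ m 1 (psd_sa pm); rewrite scale1r; apply.
  by rewrite /m cnormN cnorm_star; have := cnorm_ge0 y; nra.
pose p := y * star y.
have pp : psd p.
  pose b := y + star y; pose c := ii R *: (y - star y).
  have sb : star b = b by rewrite starD starK addrC.
  have sc' : star c = c by rewrite starZ starB starK conj_ii scaleNr -scalerN opprB.
  have -> : p = (2^-1)%:C *: (b * b + c * c) + m.
    have -> : c * c = - ((y - star y) * (y - star y)).
      by rewrite -scalerAl -scalerAr scalerA ii2 scaleN1r.
    have -> : b * b - (y - star y) * (y - star y) =
        (star y * y + p) + (star y * y + p) by rewrite /p /b; ncring.
    by rewrite scalerDr scale_halves /m; ncring.
  by apply: psdD => //; apply: psdZ; [lra|apply: psdD; exact: psd_sqr].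
have py : p * y = - (y * m) by rewrite /p /m mulrN opprK mulrA.
have I0 : 0 < (1 : R) by [].
have vE := cinvV I0 pp; have vn := cinv_norm I0 pp; rewrite invr1 in vn.
set v := cinv 1 p in vE vn.
have ymv z : y * z = v * (y * ((1 - m) * z)).
  have -> : y * ((1 - m) * z) = (1 + p) * (y * z).
    have -> : (1 + p) * (y * z) = y * z + p * y * z by ncring.
    by rewrite py; ncring.
  by move: vE; rewrite scale1r mulrA => ->; rewrite mul1r.
have ymn n : cnorm (y * m) <= cnorm (y * (m * (1 - m) ^+ n)).
  elim: n => [|n IH]; first by rewrite mulr1.
  apply: le_trans IH _; rewrite ymv; rewrite -[leRHS]mul1r.
  apply: cnormM_le => //; rewrite exprS.
  suff -> : (1 - m) * (m * (1 - m) ^+ n) = m * ((1 - m) * (1 - m) ^+ n) by [].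
  by ncring.
have ym0 : y * m = 0.
  apply: cnorm_le0; rewrite leNgt; apply/negP => h.
  have [n] := @null_lt R _ _ (@null_inv R) h.
  apply/negP; rewrite -leNgt; apply: le_trans (ymn n.+1) _.
  have := mul_expr_1sub_norm n.+1 pm m1; rewrite mulrC -ler_pdivlMr // mul1r => h1.
  rewrite -[leRHS]mul1r; exact: cnormM_le.
have mm : m * m = 0 by rewrite {1}/m mulNr -mulrA ym0 mulr0 oppr0.
have m0 : m = 0 by apply: star_mul_eq0; rewrite psd_sa.
by apply: star_mul_eq0; apply/eqP; rewrite -oppr_eq0 -/m m0.
Qed.

(** If [n] is the negative part of [x^* x], then [(x n)^* (x n) = - n ^ 3], so [x n = 0] by
    [psd_opp_star_mul], and then [n ^ 2 = 0]. *)
Lemma psd_star_mul x : psd (star x * x).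
Proof.
set a := star x * x; have sa : star a = a by rewrite /a starM starK.
have pn := pospart_psd (x := - a); have {pn} : psd (pospart (- a)) by apply: pn; rewrite starN sa.
move=> pn; have sn := psd_sa pn.
have an : a * pospart (- a) = - (pospart (- a) * pospart (- a)).
  by rewrite -{1}(pospartB a) mulrBl pospart_orth // add0r.
have : x * pospart (- a) = 0.
  apply: psd_opp_star_mul; rewrite starM sn -mulrA (mulrA (star x)) -/a an mulrN opprK.
  by rewrite mulrA -expr2 -exprSr; exact: psdX.
move=> xn; have : pospart (- a) = 0.
  have n3 : pospart (- a) * (pospart (- a)) = 0.
    by apply/eqP; rewrite -oppr_eq0 -an /a -mulrA xn mulr0.
  by apply: star_mul_eq0; rewrite sn.
by move=> n0; rewrite -(pospartB a) n0 subr0; exact: pospart_psd.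
Qed.

Lemma positiveP x : positive x <-> psd x.
Proof.
split=> [[y ->]|px]; first exact: psd_star_mul.
by exists (csqrt x); rewrite csqrt_sa // csqrtE.
Qed.

Lemma psd_mul_star x : psd (x * star x).
Proof. by rewrite -{1}(starK x); exact: psd_star_mul. Qed.

Lemma psd_conj z a : psd a -> psd (z * a * star z).
Proof.
move=> pa; rewrite -(csqrtE pa) mulrA -mulrA.
by have := psd_mul_star (z * csqrt a); rewrite starM csqrt_sa.
Qed.

Lemma psd_conj_star z a : psd a -> psd (star z * a * z).
Proof. by move=> pa; have := psd_conj (star z) pa; rewrite starK. Qed.

Lemma psd_conj_sa z a : star z = z -> psd a -> psd (z * a * z).
Proof. by move=> sz pa; have := psd_conj z pa; rewrite sz. Qed.

Lemma psd_trans b a z : psd (b - a) -> psd (z - b) -> psd (z - a).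
Proof. by move=> ab bz; have := psdD bz ab; rewrite addrA subrK. Qed.

Lemma psd_cnorm_le a b : psd a -> psd (b - a) -> cnorm a <= cnorm b.
Proof.
move=> pa ab; have pb : psd b by rewrite -(subrK a b); exact: psdD.
apply: psd_norm => //; first exact: cnorm_ge0.
by apply: psd_trans ab _; apply: psd_scB => //; exact: psd_sa.
Qed.

Lemma sa_cnorm_le a t : 0 <= t -> star a = a -> psd (sc t - a) -> psd (sc t + a) ->
  cnorm a <= t.
Proof.
move=> t0 sa p1 p2; have : psd (sc (t ^+ 2) - a * a).
  have -> : sc (t ^+ 2) - a * a = (sc t - a) * (sc t + a) :> A.
    rewrite expr2 scM; have -> : (sc t - a) * (sc t + a) =
      sc t * sc t + (sc t * a - a * sc t) - a * a by ncring.
    by rewrite sc_comm subrr addr0.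
  apply: psd_mul => //.
  have -> : (sc t - a) * (sc t + a) = (sc t + a) * (sc t - a) + (sc t * a - a * sc t) * 1
     + (sc t * a - a * sc t) by ncring.
  by rewrite sc_comm subrr mul0r !addr0.
move=> p; have : cnorm (a * a) <= t ^+ 2.
  by apply: psd_norm => //; [exact: sqr_ge0|exact: psd_sqr].
by rewrite cnorm_sa_sqr // ler_pXn2r // nnegrE // cnorm_ge0.
Qed.

Lemma cnorm_sqr_le x t : 0 <= t -> psd (sc (t ^+ 2) - star x * x) -> cnorm x <= t.
Proof.
move=> t0 p; have : cnorm (star x * x) <= t ^+ 2.
  by apply: psd_norm => //; [exact: sqr_ge0|exact: psd_star_mul].
by rewrite cnorm_star ler_pXn2r // nnegrE // cnorm_ge0.
Qed.

Lemma star_mul_scB x t : cnorm x <= t -> psd (sc (t ^+ 2) - star x * x).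
Proof.
move=> xt; apply: psd_scB; first by rewrite starM starK.
by rewrite cnorm_star ler_pXn2r // nnegrE ?(le_trans _ xt) // cnorm_ge0.
Qed.

End Order.

(** * Operator monotonicity of the square root, cut-downs by positive parts *)

Section RootMonotone.
Variables (R : realType) (A : cstarAlgType R).
Implicit Types (x y z s a b q r : A) (t c : R).

Lemma cnorm_saX a k : star a = a -> cnorm (a ^+ (2 ^ k)) = cnorm a ^+ (2 ^ k).
Proof.
move=> sa; elim: k => [|k IH]; first by rewrite !expr1.
by rewrite expnSr !exprM -IH expr2 cnorm_sa_sqr // starX sa.
Qed.

(** Takes the place of the spectral radius formula: the norm of a self-adjoint element is
    multiplicative along the exponents [2 ^ k], and by Bernoulli its powers are unbounded once it
    exceeds 1. *)
Lemma cnorm_sa_le1 a (K : R) : star a = a -> (forall n, cnorm (a ^+ n.+1) <= K) -> cnorm a <= 1.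
Proof.
move=> sa aK; rewrite leNgt; apply/negP => h.
have K0 : 0 <= K := le_trans (cnorm_ge0 _) (aK 0%N).
pose n := Num.bound (K / (cnorm a - 1)).
have d0 : 0 < cnorm a - 1 by lra.
have : K / (cnorm a - 1) < n%:R by apply: archi_boundP; apply: divr_ge0 => //; lra.
rewrite ltr_pdivrMr // => hn.
have e2 : (n <= 2 ^ n)%N by apply: ltnW; exact: ltn_expl.
have := aK (2 ^ n).-1; rewrite prednK ?expn_gt0 // cnorm_saX // => h2.
have bern m : 1 + m%:R * (cnorm a - 1) <= cnorm a ^+ m.
  elim: m => [|m IHm]; first by rewrite mul0r addr0 expr0.
  rewrite exprS -natr1; move: IHm; set p := cnorm a ^+ m; set N := m%:R.
  have N0 : 0 <= N by [].
  move: (cnorm a) d0 => v d0 H.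
  have h3 : 0 <= v * (p - (1 + N * (v - 1))) by apply: mulr_ge0; lra.
  have h4 : 0 <= N * (v - 1) * (v - 1) by rewrite !mulr_ge0 //; lra.
  by nra.
have := bern (2 ^ n)%N; have : n%:R <= (2 ^ n)%:R :> R by rewrite ler_nat.
nra.
Qed.

(** Let [s = t + q], which is invertible. The hypothesis makes [r s^-1] a contraction. It is not
    self-adjoint, but [T = s^-1/2 r s^-1/2] is, and the powers of [T] are [w (r v) ^ n r w], hence
    bounded; so [||T|| <= 1], that is [r <= s]. *)
Lemma root_monotone r q t : psd r -> psd q -> 0 < t ->
  psd ((sc t + q) * (sc t + q) - r * r) -> psd (sc t + q - r).
Proof.
move=> pr pq t0 p; have vE := cinvE t0 pq; have vV := cinvV t0 pq.
have pv := cinv_psd t0 pq; set v := cinv t q in vE vV pv *; set s := sc t + q in p vE vV *.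
have sv := psd_sa pv; have ss : star s = s by rewrite starD star_alg psd_sa.
have sr := psd_sa pr.
have rv1 : cnorm (r * v) <= 1.
  apply: cnorm_sqr_le => //; rewrite expr1n scale1r starM sr sv.
  have -> : 1 - v * r * (r * v) = v * (s * s - r * r) * v.
    have -> : v * (s * s - r * r) * v = (v * s) * (s * v) - v * r * (r * v) by ncring.
    by rewrite vE vV mulr1.
  exact: psd_conj_sa.
have sw := csqrt_sa pv; have wE := csqrtE pv; set w := csqrt v in sw wE *.
pose T := w * r * w; have sT : star T = T by rewrite !starM sw sr mulrA.
have TE n : T ^+ n.+1 = w * (r * v) ^+ n * r * w.
  elim: n => [|n IH]; first by rewrite expr1 expr0 mulr1.
  rewrite exprSr IH exprSr /T -wE; ncring.
have T1 : cnorm T <= 1.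
  apply: (@cnorm_sa_le1 _ (cnorm w * 1 * cnorm r * cnorm w)) => // n.
  rewrite TE; do 2!apply: cnormM_le => //; apply: cnormM_le => //.
  by apply: le_trans (cnormX _ _) _; apply: exprn_ile1 => //; exact: cnorm_ge0.
have := psd_scB sT T1; rewrite scale1r => /(psd_conj (s * w)).
rewrite starM ss sw.
suff -> : s * w * (1 - T) * (w * s) = s - r by [].
have -> : s * w * (1 - T) * (w * s) = s * (w * w) * s - (s * (w * w)) * r * ((w * w) * s).
  by rewrite /T; ncring.
by rewrite wE vE vV; ncring.
Qed.

(** From [r ^ 2 <= q ^ 2 + t ^ 2 <= (q + t) ^ 2] and monotonicity of the root, and the same with [r]
    and [q] exchanged. *)
Lemma root_dist r q t : psd r -> psd q -> 0 < t -> cnorm (r * r - q * q) <= t ^+ 2 ->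
  cnorm (r - q) <= t.
Proof.
suff H a b : psd a -> psd b -> 0 < t -> cnorm (a * a - b * b) <= t ^+ 2 -> psd (sc t + b - a).
  move=> pr pq t0 rq; apply: sa_cnorm_le; first exact: ltW.
  - by rewrite starB !psd_sa.
  - by rewrite opprB addrA; apply: H.
  - by rewrite addrA; apply: H => //; rewrite cnorm_distC.
move=> pa pb t0 ab; apply: root_monotone => //.
have -> : (sc t + b) * (sc t + b) - a * a =
   (sc (t ^+ 2) - (a * a - b * b)) + (sc t * b + sc t * b).
  have -> : sc (t ^+ 2) = sc t * sc t :> A by rewrite expr2 scM.
  have -> : sc t * b + sc t * b = sc t * b + b * sc t by rewrite -sc_comm.
  by ncring.
apply: psdD; first by apply: psd_scB => //; rewrite starB !starM !psd_sa.
by rewrite mulr_algl; apply: psdD; apply: psdZ => //; exact: ltW.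
Qed.

Lemma pospart_ge x : star x = x -> psd (pospart x - x).
Proof.
move=> sx; rewrite -{2}(pospartB x) opprB addrCA subrr addr0.
by apply: pospart_psd; rewrite starN sx.
Qed.

Lemma pospart_sa x : star x = x -> star (pospart x) = pospart x.
Proof. by move=> sx; apply: psd_sa; exact: pospart_psd. Qed.

Lemma pospart_comm x y : star x = x -> y * x = x * y -> y * pospart x = pospart x * y.
Proof. by move=> sx; exact: pospart_intertwine. Qed.

Lemma pospart_mul x : star x = x -> x * pospart x = pospart x * pospart x.
Proof.
move=> sx; rewrite -{1}(pospartB x) mulrBl.
have -> : pospart (- x) * pospart x = 0; last by rewrite subr0.
by have := pospart_orth (x := - x); rewrite opprK; apply; rewrite starN sx.
Qed.

Lemma sa_subsc x t : star x = x -> star (x - sc t) = x - sc t.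
Proof. by move=> sx; rewrite starB star_alg sx. Qed.

Lemma pospart_subsc_neq0 b t : psd b -> 0 <= t -> t < cnorm b -> pospart (b - sc t) != 0.
Proof.
move=> pb t0 tb; apply/eqP => h.
have := pospart_ge (sa_subsc t (psd_sa pb)); rewrite h sub0r opprB => p.
by have := psd_norm t0 pb p; rewrite leNgt tb.
Qed.

(* Both parts of [b - t] lie in [[0, b]] and [[0, t]], respectively. *)
Lemma negpart_norm b t : psd b -> 0 <= t -> cnorm (pospart (sc t - b)) <= t.
Proof.
move=> pb t0; have sx : star (sc t - b) = sc t - b by rewrite starB star_alg psd_sa.
have pp := pospart_psd sx; set n := pospart _ in pp *; have sn := psd_sa pp.
have bn : b * n = n * b.
  by apply: pospart_comm => //; rewrite mulrBl mulrBr sc_comm.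
have p : psd (t%:C *: n - n * n).
  rewrite /n -(pospart_mul sx) -/n mulrBl mulr_algl opprB addrCA subrr addr0.
  exact: psd_mul.
have : cnorm (n * n) <= t * cnorm n.
  rewrite -[t in leRHS]ger0_norm // -cnormZr; apply: psd_cnorm_le => //.
  exact: psd_sqr.
rewrite cnorm_sa_sqr // expr2; have [->|n0] := eqVneq n 0; first by rewrite cnorm0.
by rewrite ler_pM2r // cnorm_gt0.
Qed.

Lemma pospart_subsc_dist b t : psd b -> 0 <= t -> cnorm (pospart (b - sc t) - b) <= t.
Proof.
move=> pb t0; have h := pospartB (b - sc t); rewrite opprB in h.
have sx : star (sc t - b) = sc t - b by rewrite starB star_alg psd_sa.
have -> : pospart (b - sc t) - b = - (sc t - pospart (sc t - b)).
  by rewrite -[X in _ - X](subrK (sc t)) -{2}h; ncring.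
rewrite cnormN; apply: psd_cnorm_dist; first exact: pospart_psd.
exact: negpart_norm.
Qed.

Lemma pospart_le_norm x t : star x = x -> 0 <= t -> psd (sc t - x) -> cnorm (pospart x) <= t.
Proof.
move=> sx t0 xt; have pp := pospart_psd sx; set n := pospart _ in pp *; have sn := psd_sa pp.
have p : psd (t%:C *: n - n * n).
  rewrite -(pospart_mul sx) -/n -mulr_algl -mulrBl; apply: psd_mul => //.
  by apply: pospart_comm => //; rewrite mulrBl mulrBr sc_comm.
have : cnorm (n * n) <= t * cnorm n.
  rewrite -[t in leRHS]ger0_norm // -cnormZr; apply: psd_cnorm_le => //.
  exact: psd_sqr.
rewrite cnorm_sa_sqr // expr2; have [->|n0] := eqVneq n 0; first by rewrite cnorm0.
by rewrite ler_pM2r // cnorm_gt0.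
Qed.

Lemma pospart_uniq (p n : A) : psd p -> psd n -> p * n = 0 -> pospart (p - n) = p.
Proof.
move=> pp pn pn0; have sp := psd_sa pp; have sn := psd_sa pn.
have np0 : n * p = 0 by rewrite -sp -sn -starM pn0 star0.
rewrite /pospart /cabs (@csqrt_uniq _ _ (p + n)).
- have -> : p + n + (p - n) = p + p by ncring.
  by rewrite scalerDr scale_halves.
- exact: psdD.
- have -> : (p + n) * (p + n) = p * p + n * n + (p * n + n * p) by ncring.
  have -> : (p - n) * (p - n) = p * p + n * n - (p * n + n * p) by ncring.
  by rewrite pn0 np0 !addr0 subr0.
Qed.

End RootMonotone.

(** * Polar decomposition below a given modulus *)

Section Polar.
Variables (R : realType) (A : cstarAlgType R).
Implicit Types (x y z s a b q r X c W : A) (t : R).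

Lemma cnorm_psd_conj c r (k : A) : star r = r -> star k = k -> star c = c -> psd (r * r - c * c) ->
  cnorm (k * c) <= cnorm (k * r).
Proof.
move=> sr sk sc' p; rewrite -(@ler_pXn2r _ 2) ?nnegrE ?cnorm_ge0 //.
rewrite -(cnorm_starE (k * c)) -(cnorm_starE (k * r)) -!cnorm_star !starK !starM sr sk sc'.
apply: psd_cnorm_le.
  have -> : k * c * (c * k) = k * (c * c) * k by ncring.
  by apply: psd_conj_sa => //; exact: psd_sqr.
have -> : k * r * (r * k) - k * c * (c * k) = k * (r * r - c * c) * k by ncring.
exact: psd_conj_sa.
Qed.

(* With [X = v r] the polar decomposition, [W = v c]; [v] itself need not lie in [A]. *)
Lemma polar_lift X c : psd c -> psd (star X * X - c * c) ->
  exists W, [/\ star W * W = c * c, (forall z, z * X = 0 -> z * W = 0) &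
    forall t, 0 < t -> cnorm (star X * X - c * c) <= t ^+ 2 -> cnorm (W - X) <= t].
Proof.
move=> pc p; have pw := psd_star_mul X; have rE := csqrtE pw; have pr := csqrt_psd pw.
set r := csqrt _ in rE pr *; have sr := psd_sa pr; have sc' := psd_sa pc.
rewrite -rE in p *.
pose e n : R := n.+1%:R^-1; have e0 n : 0 < e n by rewrite invr_gt0.
pose g n := cinv (e n) r; have sg n : star (g n) = g n by apply: cinv_sa.
have rg n : r * g n = g n * r by apply: cinv_commq.
have rg1 n : 1 - r * g n = (e n)%:C *: g n by rewrite -cinv_1sub // opprB addrCA subrr addr0.
have nrg n : cnorm (r * g n) <= 1.
  apply: psd_norm => //; first exact: mul_cinv_psd.
  by rewrite scale1r; exact: mul_cinv_psd1.
have XN y : cnorm (X * y) = cnorm (r * y).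
  apply/eqP; rewrite -(@eqrXn2 _ 2) ?cnorm_ge0 // -!cnorm_star !starM sr.
  by rewrite mulrA -(mulrA _ (star X)) -rE !mulrA.
(* [X * g n] alone need not converge in norm; the factor [c], with [c ^ 2 <= r ^ 2], makes the
   product a Cauchy sequence. *)
pose w n := X * g n * c.
have wdist m n : (n <= m)%N -> cnorm (w m - w n) <= 2 * e n.
  move=> nm; pose k := g m - g n.
  have sk : star k = k by rewrite starB !sg.
  have rk : r * k = k * r by rewrite /k mulrBl mulrBr !rg.
  have -> : w m - w n = X * (k * c) by rewrite /w /k; ncring.
  rewrite XN mulrA; have := @cnorm_psd_conj c r (r * k) sr; rewrite starM sr sk -rk.
  move=> /(_ (erefl _) sc' p) h; apply: le_trans h _.
  have -> : r * k * r = - ((e m)%:C *: (r * g m)) + (e n)%:C *: (r * g n).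
    have h j : r * g j * r = r - (e j)%:C *: (r * g j).
      have rgE : r * g j = 1 - (e j)%:C *: g j by rewrite -rg1; ncring.
      by rewrite -mulrA -rg [in LHS]rgE mulrBr mulr1 -scalerAr.
    rewrite /k mulrBr mulrBl !h; ncring.
  apply: le_trans (cnormD _ _) _; rewrite cnormN !cnormZr.
  have emn : e m <= e n by rewrite /e lef_pV2 ?posrE // ler_nat.
  rewrite !ger0_norm ?(ltW (e0 _)) //; have := nrg m; have := nrg n.
  by have := e0 m; have := e0 n; nra.
have [|l wl] := @cauchy_cvgs R A w (fun n => 2 * e n) _ wdist.
  by apply: nullMl (@null_inv R) _ => n; rewrite ltW.
have gr1 n : cnorm (c * g n) <= 1.
  rewrite -cnorm_starE starM sg sc'.
  by apply: le_trans (cnorm_psd_conj sr (sg n) sc' p) _; rewrite -rg.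
have rgc : cvgs (fun n => star (w n) * w n) (c * c).
  apply: null_le (nullMl (2 * cnorm c) (@null_inv R) _) _; first by move=> n; rewrite ltW // e0.
  move=> n; rewrite cnorm_distC !starM sg sc'.
  have -> : c * (g n * star X) * (X * g n * c) = c * (g n * (star X * X) * g n) * c by ncring.
  have -> : c * c - c * (g n * (star X * X) * g n) * c =
     c * (1 - r * g n) * ((1 + r * g n) * c).
    have -> : g n * (star X * X) * g n = (r * g n) * (r * g n) by rewrite -rE {1}rg; ncring.
    by ncring.
  rewrite rg1 -scalerAr -scalerAl cnormZr ger0_norm ?(ltW (e0 _)) // mulrC -/(e n).
  apply: ler_wpM2r; first exact: ltW.
  rewrite -[2 * _]mul1r; apply: cnormM_le => //; apply: cnormM_le => //.
  by apply: le_trans (cnormD _ _) _; rewrite cnorm1; have := nrg n; lra.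
exists l; split.
- exact: cvgs_uniq (cvgsM (cvgs_star wl) wl) rgc.
- move=> z zX; apply: cvgs_uniq (cvgsMl z wl) _.
  by apply: cvgs_ext (cvgs_cst 0) => n; rewrite /w !mulrA zX !mul0r.
move=> t t0 ct; have rc : cnorm (c - r) <= t by rewrite cnorm_distC; exact: root_dist.
have Xl : cvgs (fun n => X * g n * r) X.
  apply: null_le (nullMl 1 (@null_inv R) _) _; first by move=> n; rewrite ltW // e0.
  move=> n; rewrite cnorm_distC -mulrA -rg; have -> : X - X * (r * g n) = X * (1 - r * g n) by ncring.
  rewrite XN rg1 -scalerAr cnormZr ger0_norm ?(ltW (e0 _)) // mulrC -/(e n).
  by apply: ler_wpM2r; first exact: ltW.
apply: cvgs_norm_le (cvgsB wl Xl) _ => n; rewrite -[t]mul1r.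
have -> : w n - X * g n * r = X * g n * (c - r) by rewrite /w; ncring.
by apply: cnormM_le => //; rewrite XN.
Qed.

End Polar.

Section OrthSum.
Variables (R : realType) (A : cstarAlgType R) (I : finType) (e : I -> A).
Hypothesis pe : forall i, psd (e i).
Hypothesis e1 : forall i, cnorm (e i) <= 1.
Hypothesis ee : forall i j, i != j -> e i * e j = 0.

Lemma orth_psd_1sub_sum : psd (1 - \sum_i e i).
Proof.
have H (s : seq I) : uniq s -> psd (1 - \sum_(i <- s) e i).
  elim: s => [|i s IH] /=; first by rewrite big_nil subr0 => _; exact: psd1.
  case/andP=> is_ /IH ps; rewrite big_cons; set S := \sum_(j <- s) _ in ps *.
  have eS : e i * S = 0.
    rewrite mulr_sumr big_seq big1 // => j js; apply: ee.
    by apply: contraNneq is_ => ->.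
  have Se : S * e i = 0.
    rewrite mulr_suml big_seq big1 // => j js; apply: ee.
    by apply: contraNneq is_ => <-.
  have -> : 1 - (e i + S) = (1 - e i) * (1 - S).
    have -> : (1 - e i) * (1 - S) = 1 - (e i + S) + e i * S by ncring.
    by rewrite eS addr0.
  apply: psd_mul => //.
    by have := psd_scB (psd_sa (pe i)) (e1 i); rewrite scale1r.
  have -> : (1 - e i) * (1 - S) = 1 - e i - S + e i * S by ncring.
  have -> : (1 - S) * (1 - e i) = 1 - e i - S + S * e i by ncring.
  by rewrite eS Se.
exact: H (index_enum_uniq I).
Qed.

(** Blocks over orthogonal elements do not add up in norm. This keeps the commutator of the weighted
    tower with [u] independent of the height of the tower. *)
Lemma orth_sandwich_norm (Y : I -> A) (M : R) : 0 <= M -> (forall i, cnorm (Y i) <= M) ->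
  cnorm (\sum_i e i * Y i * e i) <= M.
Proof.
move=> M0 YM; apply: cnorm_sqr_le => //; rewrite star_sum.
have se i : star (e i) = e i := psd_sa (pe i).
pose T i := e i * Y i * e i.
have -> : (\sum_i star (e i * Y i * e i)) * (\sum_i T i) = \sum_i star (T i) * T i.
  rewrite mulr_suml; apply: eq_bigr => i _; rewrite mulr_sumr (bigD1 i) //= big1 ?addr0 // => j ji.
  rewrite !starM se /T !mulrA -(mulrA _ (e i) (e j)) ee ?mulr0 ?mul0r //.
  by rewrite eq_sym.
have e2 i : psd (e i - e i * e i).
  have -> : e i - e i * e i = e i * (1 - e i) by ncring.
  apply: psd_mul => //; last by ncring.
  by have := psd_scB (psd_sa (pe i)) (e1 i); rewrite scale1r.
apply: (@psd_trans _ _ ((M ^+ 2)%:C *: \sum_i e i)).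
  rewrite scaler_sumr -sumrB; apply: psd_sum => i _.
  apply: (@psd_trans _ _ ((M ^+ 2)%:C *: (e i * e i))); last first.
    by rewrite -scalerBr; apply: psdZ => //; exact: sqr_ge0.
  have YY : psd (sc (M ^+ 2) - star (e i * Y i) * (e i * Y i)).
    by apply: star_mul_scB; rewrite -[M]mul1r; exact: cnormM_le.
  have := psd_conj_sa (se i) YY; rewrite /T !starM se.
  have -> : e i * (sc (M ^+ 2) - star (Y i) * e i * (e i * Y i)) * e i =
     e i * sc (M ^+ 2) * e i - e i * (star (Y i) * e i) * (e i * Y i * e i) by ncring.
  by rewrite sc_comm -[sc _ * e i * e i]mulrA mulr_algl.
rewrite -scalerBr; apply: psdZ; first exact: sqr_ge0.
exact: orth_psd_1sub_sum.
Qed.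

End OrthSum.

Global Opaque csqrt cabs pospart cinv.

(** * Cuntz comparison *)

Section StarHom.
Variables (R : realType) (A B : cstarAlgType R) (f : A -> B).
Hypothesis hf : star_hom f.
Implicit Types (x y : A).

Lemma shD x y : f (x + y) = f x + f y.
Proof. by case: hf => lf _ _; have := lf 1 x y; rewrite !scale1r. Qed.

Lemma sh0 : f 0 = 0.
Proof. by apply: (addrI (f 0)); rewrite -shD !addr0. Qed.

Lemma shZ (c : R[i]) x : f (c *: x) = c *: f x.
Proof. by case: hf => lf _ _; have := lf c x 0; rewrite sh0 !addr0. Qed.

Lemma shN x : f (- x) = - f x.
Proof. by rewrite -scaleN1r shZ scaleN1r. Qed.

Lemma shB x y : f (x - y) = f x - f y.
Proof. by rewrite shD shN. Qed.

Lemma sh1 : f 1 = 1. Proof. by case: hf => _ [[]]. Qed.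

Lemma shM x y : f (x * y) = f x * f y. Proof. by case: hf => _ [] //. Qed.

Lemma sh_star x : f (star x) = star (f x). Proof. by case: hf => _ _ ->. Qed.

Lemma sh_sc (t : R) : f (sc t) = sc t.
Proof. by rewrite shZ sh1. Qed.

Lemma shX x n : f (x ^+ n) = f x ^+ n.
Proof. by elim: n => [|n IH]; rewrite ?expr0 ?sh1 // !exprS shM IH. Qed.

Lemma sh_sum I (r : seq I) (P : pred I) (F : I -> A) :
  f (\sum_(i <- r | P i) F i) = \sum_(i <- r | P i) f (F i).
Proof. exact: (big_morph f shD sh0). Qed.

Lemma sh_psd x : psd x -> psd (f x).
Proof. by move=> /positiveP[y ->]; apply/positiveP; exists (f y); rewrite shM sh_star. Qed.

Lemma sh_norm x : cnorm (f x) <= cnorm x.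
Proof.
apply: cnorm_sqr_le; first exact: cnorm_ge0.
by rewrite -sh_star -shM -sh_sc -shB; apply: sh_psd; exact: star_mul_scB.
Qed.

Lemma sh_cvgs (u : nat -> A) l : cvgs u l -> cvgs (fun n => f (u n)) (f l).
Proof. by move=> ul; apply: null_le ul _ => n; rewrite -shB; exact: sh_norm. Qed.

Lemma sh_pospart x : star x = x -> f (pospart x) = pospart (f x).
Proof.
move=> sx; rewrite -{2}(pospartB x) shB pospart_uniq //.
- by apply: sh_psd; exact: pospart_psd.
- by apply: sh_psd; apply: pospart_psd; rewrite starN sx.
- by rewrite -shM pospart_orth // sh0.
Qed.

Hypothesis inj_f : injective f.

Lemma sh_isometry x : cnorm (f x) = cnorm x.
Proof.
suff H y : psd y -> cnorm y <= cnorm (f y).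
  have H2 := H (star x * x) (psd_star_mul x).
  rewrite shM sh_star !cnorm_star ler_pXn2r ?nnegrE ?cnorm_ge0 // in H2.
  by apply/eqP; rewrite eq_le sh_norm.
move=> py; rewrite leNgt; apply/negP => /(pospart_subsc_neq0 py (cnorm_ge0 _)).
have sy : star (y - sc (cnorm (f y))) = y - sc (cnorm (f y)) by apply: sa_subsc; exact: psd_sa.
rewrite -(inj_eq inj_f) sh0 sh_pospart // shB sh_sc -opprB pospart_opp ?eqxx //.
by apply: psd_scB => //; apply: psd_sa; exact: sh_psd.
Qed.

Lemma sh_psd_inj x : psd (f x) -> psd x.
Proof.
move=> [sf [t t0 ft]]; split; first by apply: inj_f; rewrite sh_star.
by exists t => //; rewrite -sh_isometry shB sh_sc.
Qed.

End StarHom.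

Section Cuntz.
Variables (R : realType) (A : cstarAlgType R).
Implicit Types (x y z a b q : A) (t e : R).

Lemma nullP (r : nat -> R) : (forall n, 0 <= r n) ->
  (r n @[n --> \oo] --> (0 : R)) <-> null r.
Proof.
move=> r0; split=> [/cvgrPdist_lt H e e0|H].
  have [N _ HN] := H _ e0; exists N => n Nn.
  by have := HN n Nn; rewrite /= sub0r normrN ger0_norm.
apply/cvgrPdist_lt => e e0; have [N HN] := H _ e0.
by exists N => // n Nn /=; rewrite sub0r normrN ger0_norm //; exact: HN.
Qed.

Lemma cuntzP a b : cuntz_le a b <->
  forall e, 0 < e -> exists x, cnorm (a - x * b * star x) <= e.
Proof.
split=> [[x /nullP xl] e e0|H].
  have [n xn] := null_lt (xl (fun n => cnorm_ge0 _)) e0.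
  by exists (x n); exact: ltW.
have {H} /choice[x Hx] : forall n : nat, exists x, cnorm (a - x * b * star x) <= n.+1%:R^-1.
  by move=> n; apply: H; rewrite invr_gt0.
exists x; apply/nullP => [n|]; first exact: cnorm_ge0.
exact: null_le (@null_inv R) Hx.
Qed.

Lemma cuntz_conj z b : cuntz_le (z * b * star z) b.
Proof. by apply/cuntzP => e e0; exists z; rewrite subrr cnorm0 ltW. Qed.

Lemma cuntz_conj_sa z b : star z = z -> cuntz_le (z * b * z) b.
Proof. by move=> sz; have := cuntz_conj z b; rewrite sz. Qed.

Lemma cuntz_conj_star z b : cuntz_le (star z * b * z) b.
Proof. by have := cuntz_conj (star z) b; rewrite starK. Qed.

Lemma cuntz_refl b : cuntz_le b b.
Proof. by have := cuntz_conj 1 b; rewrite star1 mulr1 mul1r. Qed.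

Lemma mul_divD1_le (n e : R) : 0 <= e -> n * (e / (n ^+ 2 + 1)) * n <= e.
Proof.
move=> e0; have s0 := sqr_ge0 n; have s1 : 0 < n ^+ 2 + 1 by lra.
have -> : n * (e / (n ^+ 2 + 1)) * n = e * (n ^+ 2 / (n ^+ 2 + 1)) by field; lra.
by apply: ler_piMr => //; rewrite ler_pdivrMr // mul1r; lra.
Qed.

Lemma cuntz_trans b a q : cuntz_le a b -> cuntz_le b q -> cuntz_le a q.
Proof.
move=> /cuntzP ab /cuntzP bq; apply/cuntzP => e e0.
have [|x Hx] := ab (e / 2); first by lra.
have d0 : 0 < cnorm x ^+ 2 + 1 by have := sqr_ge0 (cnorm x); lra.
have [|y Hy] := bq (e / 2 / (cnorm x ^+ 2 + 1)); first by apply: divr_gt0 => //; lra.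
exists (x * y); rewrite starM.
have -> : a - x * y * q * (star y * star x) =
   (a - x * b * star x) + x * (b - y * q * star y) * star x by ncring.
apply: le_trans (cnormD _ _) _.
have : cnorm (x * (b - y * q * star y) * star x) <= cnorm x * (e / 2 / (cnorm x ^+ 2 + 1)) * cnorm x.
  by apply: cnormM_le; [exact: cnormM_le|rewrite cnorm_starE].
have e2 : 0 <= e / 2 by lra.
have := mul_divD1_le (cnorm x) e2; lra.
Qed.

Lemma cuntz_closed a b : (forall e, 0 < e -> exists2 a', cnorm (a - a') <= e & cuntz_le a' b) ->
  cuntz_le a b.
Proof.
move=> H; apply/cuntzP => e e0; have [|a' aa' /cuntzP a'b] := H (e / 2); first by lra.
have [|x Hx] := a'b (e / 2); first by lra.
by exists x; have := cnorm_triangle a' a (x * b * star x); lra.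
Qed.

Lemma cuntz_mul_comm a q : psd q -> q * a = a * q -> cuntz_le (q * a) a.
Proof.
move=> pq qa; have := cuntz_conj_sa (z := csqrt q) a (csqrt_sa pq).
have h : a * csqrt q = csqrt q * a by apply: csqrt_comm.
by rewrite -mulrA h mulrA csqrtE.
Qed.

Lemma cinv_cut_dist b e : 0 < e -> psd b ->
  cnorm (b - b * (b * cinv e b) * (b * cinv e b)) <= 2 * e.
Proof.
move=> e0 pb; set p := b * cinv e b.
have p1 : cnorm p <= 1.
  apply: psd_norm => //; first exact: mul_cinv_psd.
  by rewrite scale1r; exact: mul_cinv_psd1.
have -> : b - b * p * p = b * (1 - p) * (1 + p) by ncring.
rewrite /p -cinv_1sub // opprB addrCA subrr addr0 cinv_1sub // -/p -scalerAr -/p -scalerAl.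
rewrite cnormZr ger0_norm ?(ltW e0) // mulrC ler_pM2r //.
rewrite -[2]mul1r; apply: cnormM_le => //.
by apply: le_trans (cnormD _ _) _; rewrite cnorm1; lra.
Qed.

(** With [p = b (e + b)^-1], the element [b] is close to [b p ^ 2], and [b p ^ 2 = z b ^ 2 z^*] for
    [z = b^1/2 (e + b)^-1]. *)
Lemma cuntz_sqr b : psd b -> cuntz_le b (b * b).
Proof.
move=> pb; apply: cuntz_closed => e e0; have e2 : 0 < e / 2 by lra.
exists (b * (b * cinv (e / 2) b) * (b * cinv (e / 2) b)).
  by have := cinv_cut_dist e2 pb; have -> : 2 * (e / 2) = e by lra.
have vb := cinv_commq e2 pb; have sv := cinv_sa e2 pb; set v := cinv _ _ in vb sv *.
have sb := csqrt_sa pb; have bE := csqrtE pb; set d := csqrt b in sb bE.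
have db : d * b = b * d by rewrite -bE mulrA.
have dv : d * v = v * d by apply: cinv_comm.
have := cuntz_conj (d * v) (b * b); rewrite starM sv sb.
suff -> : d * v * (b * b) * (v * d) = b * (b * v) * (b * v) by [].
have -> : d * v * (b * b) * (v * d) = d * (v * b) * (b * v) * d by ncring.
rewrite -vb; have -> : d * (b * v) * (b * v) * d = (d * b) * v * b * (v * d) by ncring.
rewrite -dv db; have -> : b * d * v * b * (d * v) = b * (d * v) * (b * d) * v by ncring.
rewrite dv -db; have -> : b * (v * d) * (d * b) * v = b * v * (d * d) * (b * v) by ncring.
by rewrite bE -[b * v * b]mulrA -vb.
Qed.

(** With [r = a^1/2] and [v = (e + b)^-1], [a] is close to [r (b v) r]: the error is [e r v r], and
    [||r v r|| = ||v^1/2 a v^1/2||] is at most [||b v|| <= 1]. *)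
Lemma cuntz_mono a b : psd a -> psd (b - a) -> cuntz_le a b.
Proof.
move=> pa ab; have pb : psd b by rewrite -(subrK a b); exact: psdD.
apply: cuntz_closed => e e0; have sa := csqrt_sa pa; have aE := csqrtE pa.
have pv := cinv_psd e0 pb; set v := cinv e b in pv *; have sv := psd_sa pv.
have sd := csqrt_sa pv; have dE := csqrtE pv; set d := csqrt v in sd dE *.
set r := csqrt a in sa aE *.
have vb : b * v = v * b by apply: cinv_commq.
have db : b * d = d * b by apply: csqrt_comm.
exists (r * d * b * (d * r)); last first.
  by have := cuntz_conj (r * d) b; rewrite starM sd sa.
have -> : r * d * b * (d * r) = r * (b * v) * r.
  by rewrite -(mulrA r d b) -db -dE; ncring.
have -> : a - r * (b * v) * r = r * (1 - b * v) * r by rewrite -aE; ncring.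
rewrite -cinv_1sub // opprB addrCA subrr addr0 -scalerAr -scalerAl.
rewrite cnormZr ger0_norm ?(ltW e0) // -[leRHS]mulr1 ler_pM2l // -/v.
have -> : r * v * r = star (d * r) * (d * r) by rewrite starM sd sa -dE; ncring.
rewrite cnorm_star -cnorm_starE -cnorm_star starM sd sa starM sd sa.
have -> : d * r * (r * d) = d * a * d by rewrite -aE; ncring.
apply: psd_norm => //; first exact: psd_conj_sa.
apply: (@psd_trans _ _ (d * b * d)).
  have -> : d * b * d - d * a * d = d * (b - a) * d by ncring.
  exact: psd_conj_sa.
by rewrite scale1r -db -mulrA dE; exact: mul_cinv_psd1.
Qed.

(** Rordam's lemma. For [c = (x - t)_+], the inequality [x - t <= b] gives [c ^ 2 = c^1/2 (x - t)
    c^1/2 <= c^1/2 b c^1/2]. *)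
Lemma cuntz_cut x b t : star x = x -> psd b -> cnorm (x - b) <= t ->
  cuntz_le (pospart (x - sc t)) b.
Proof.
move=> sx pb xb; have sy : star (x - sc t) = x - sc t by rewrite starB star_alg sx.
have pc := pospart_psd sy; have yc := pospart_mul sy.
set y := x - sc t in sy yc pc *; set c := pospart y in pc yc *.
have sd := csqrt_sa pc; have dE := csqrtE pc.
have yd : y * csqrt c = csqrt c * y.
  by apply: csqrt_comm => //; apply: pospart_comm.
set d := csqrt c in sd dE yd.
apply: cuntz_trans (cuntz_sqr pc) _; apply: cuntz_trans (cuntz_conj_sa b sd).
apply: cuntz_mono; first by apply: psd_sqr; exact: psd_sa.
have -> : d * b * d - c * c = d * (b - y) * d.
  have h : d * y * d = y * c by rewrite -yd -mulrA dE.
  by rewrite -yc -h; ncring.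
apply: psd_conj_sa => //; have -> : b - y = sc t - (x - b) by rewrite /y; ncring.
by apply: psd_scB => //; rewrite starB sx psd_sa.
Qed.

(** Witnesses of the form [z b] and [w b'] have vanishing cross terms. A resolvent brings an
    arbitrary witness [x] to this form: [x q x^*] is close to [z q ^ 3 z^*] with
    [z = x (d + q)^-1]. *)
Lemma cuntz_add a b a' b' : psd b -> psd b' -> b * b' = 0 ->
  cuntz_le a b -> cuntz_le a' b' -> cuntz_le (a + a') (b + b').
Proof.
move=> pb pb' bb' ab ab'; have sb := psd_sa pb; have sb' := psd_sa pb'.
have b'b : b' * b = 0 by rewrite -sb -sb' -starM bb' star0.
suff H c q e : 0 < e -> psd q -> cuntz_le c q -> exists z, cnorm (c - z * q * q * q * star z) <= e.
  apply/cuntzP => e e0; have e2 : 0 < e / 2 by lra.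
  have [z Hz] := H _ _ _ e2 pb ab; have [w Hw] := H _ _ _ e2 pb' ab'.
  exists (z * b + w * b'); rewrite starD !starM sb sb'.
  have -> : (z * b + w * b') * (b + b') * (b * star z + b' * star w) =
     z * b * b * b * star z + w * b' * b' * b' * star w +
     (z * (b * b') * (b * star z + b' * star w) + w * (b' * b) * (b * star z + b' * star w)
      + z * b * (b * b') * star w + w * b' * (b' * b) * star z) by ncring.
  rewrite bb' b'b !(mulr0, mul0r) !addr0 opprD addrACA.
  by apply: le_trans (cnormD _ _) _; lra.
move=> e0 pq /cuntzP cq; have [|x Hx] := cq (e / 2); first by lra.
have d0 : 0 < e / 4 / (cnorm x ^+ 2 + 1).
  by apply: divr_gt0; [lra|have := sqr_ge0 (cnorm x); lra].
set d := e / 4 / _ in d0; have := cinv_cut_dist d0 pq.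
have vq := cinv_commq d0 pq; have sv := cinv_sa d0 pq; set v := cinv _ _ in vq sv *.
move=> Hv; exists (x * v); rewrite starM sv.
have -> : x * v * q * q * q * (v * star x) = x * (q * (q * v) * (q * v)) * star x.
  have -> : x * v * q * q * q * (v * star x) = x * (v * q) * q * (q * v) * star x by ncring.
  rewrite -vq; have -> : x * (q * v) * q * (q * v) * star x = x * q * (v * q) * (q * v) * star x.
    by ncring.
  by rewrite -vq; ncring.
have -> : c - x * (q * (q * v) * (q * v)) * star x = (c - x * q * star x) +
   x * (q - q * (q * v) * (q * v)) * star x by ncring.
apply: le_trans (cnormD _ _) _.
have : cnorm (x * (q - q * (q * v) * (q * v)) * star x) <= cnorm x * (2 * d) * cnorm x.
  by apply: cnormM_le; [exact: cnormM_le|rewrite cnorm_starE].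
have e2 : 0 <= e / 2 by lra.
have := mul_divD1_le (cnorm x) e2.
have -> : 2 * d = e / 2 / (cnorm x ^+ 2 + 1).
  by rewrite /d; field; have := sqr_ge0 (cnorm x); lra.
lra.
Qed.

Lemma cuntz_sum (I : finType) (F b : I -> A) : (forall i, psd (b i)) ->
  (forall i j, i != j -> b i * b j = 0) -> (forall i, cuntz_le (F i) (b i)) ->
  cuntz_le (\sum_i F i) (\sum_i b i).
Proof.
move=> pb bb Fb; have H (s : seq I) : uniq s ->
    cuntz_le (\sum_(i <- s) F i) (\sum_(i <- s) b i).
  elim: s => [|i s IH] /=; first by rewrite !big_nil => _; exact: cuntz_refl.
  case/andP=> is_ /IH h; rewrite !big_cons; apply: cuntz_add => //.
    by apply: psd_sum.
  rewrite mulr_sumr big_seq big1 // => j js; apply: bb.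
  by apply: contraNneq is_ => ->.
exact: H (index_enum_uniq I).
Qed.

End Cuntz.

Lemma sh_cuntz (R : realType) (A B : cstarAlgType R) (f : A -> B) (hf : star_hom f) a b :
  cuntz_le a b -> cuntz_le (f a) (f b).
Proof.
move=> /cuntzP ab; apply/cuntzP => e /ab[x Hx]; exists (f x).
by rewrite -sh_star // -!shM // -shB //; apply: le_trans (sh_norm hf _) Hx.
Qed.

(** * Consequences of simplicity *)

Section Simple.
Variables (R : realType) (A : cstarAlgType R).
Hypothesis A_simple : simple_cstar A.
Implicit Types (x y z a b q : A) (t e : R).

Definition span2 b : set A := [set l | forall e : R, 0 < e ->
  exists s : seq (A * A), cnorm (l - \sum_(p <- s) p.1 * b * p.2) <= e].

Lemma simple_approx1 b : b != 0 -> span2 b 1.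
Proof.
move=> b0; have [||||H|->] := @A_simple (span2 b) => //.
- move=> x l xI /cvgsP xl e e0; have e2 : 0 < e / 2 by lra.
  have [n xn] := null_lt xl e2; have [s Hs] := xI n _ e2; exists s.
  have := cnorm_triangle (x n) l (\sum_(p <- s) p.1 * b * p.2).
  by move: xn; rewrite (cnorm_distC (x n) l); lra.
- by move=> e e0; exists [::]; rewrite big_nil subr0 cnorm0 ltW.
- move=> x y Ix Iy e e0; have e2 : 0 < e / 2 by lra.
  have [s Hs] := Ix _ e2; have [r Hr] := Iy _ e2; exists (s ++ r).
  by rewrite big_cat opprD addrACA; apply: le_trans (cnormD _ _) _; lra.
- move=> a x Ix; have a1 : 0 < cnorm a + 1 by have := cnorm_ge0 a; lra.
  suff Ha e : 0 < e -> exists2 s : seq (A * A), cnorm (x - \sum_(p <- s) p.1 * b * p.2) <= e / (cnorm a + 1)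
     & cnorm a * (e / (cnorm a + 1)) <= e.
    split=> e e0; have [s Hs Hae] := Ha e e0.
      exists [seq (a * p.1, p.2) | p <- s]; rewrite big_map.
      have -> : \sum_(p <- s) a * p.1 * b * p.2 = a * \sum_(p <- s) p.1 * b * p.2.
        by rewrite mulr_sumr; apply: eq_bigr => p _; rewrite !mulrA.
      rewrite -mulrBr; apply: le_trans Hae; exact: cnormM_le.
    exists [seq (p.1, p.2 * a) | p <- s]; rewrite big_map.
    have -> : \sum_(p <- s) p.1 * b * (p.2 * a) = (\sum_(p <- s) p.1 * b * p.2) * a.
      by rewrite mulr_suml; apply: eq_bigr => p _; rewrite !mulrA.
    rewrite -mulrBl; apply: le_trans Hae; rewrite mulrC; exact: cnormM_le.
  move=> e0; have [s Hs] := Ix _ (divr_gt0 e0 a1); exists s => //.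
  by rewrite mulrA ler_pdivrMr // mulrC ler_pM2l //; lra.
have bI : span2 b b.
  by move=> e e0; exists [:: (1, 1)]; rewrite big_seq1 mul1r mulr1 subrr cnorm0 ltW.
by move: bI; rewrite H /= => b00; rewrite b00 eqxx in b0.
Qed.

(* [x b y + (x b y)^* <= x b x^* + y^* b y] for [b >= 0]. *)
Lemma simple_full b : psd b -> b != 0 -> exists N (r : 'I_N -> A),
  \sum_i r i * b * star (r i) = 1.
Proof.
move=> pb b0; have [|s Hs] := simple_approx1 b0 (e := 1 / 2); first by lra.
pose T := \sum_(p <- s) p.1 * b * p.2; rewrite -/T in Hs.
pose g p := p.1 * b * star p.1 + star p.2 * b * p.2 : A.
pose H := \sum_(p <- s) g p.
have p1 : psd (H - (T + star T)).
  rewrite /H /T star_sum -big_split -sumrB /=; apply: psd_sum => p _.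
  rewrite /g !starM (psd_sa pb); have := psd_conj (p.1 - star p.2) pb.
  rewrite starB starK.
  suff -> : (p.1 - star p.2) * b * (star p.1 - p.2) = p.1 * b * star p.1 + star p.2 * b * p.2 -
    (p.1 * b * p.2 + star p.2 * (b * star p.1)) by [].
  by ncring.
have p2 : psd (T + star T - 1).
  have sc2 : sc 1 = 1 :> A by rewrite scale1r.
  have -> : T + star T - 1 = sc 1 - ((1 - T) + star (1 - T)).
    by rewrite sc2 starB star1; ncring.
  apply: psd_scB; first by rewrite starD starK addrC.
  by apply: le_trans (cnormD _ _) _; rewrite cnorm_starE; lra.
have p3 := psd_trans p2 p1; have HE : H = sc 1 + (H - 1) by rewrite scale1r; ncring.
have I0 : 0 < (1 : R) by [].
have pv := cinv_psd I0 p3; have vE := cinvE I0 p3; rewrite -HE in vE.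
have vV := cinvV I0 p3; rewrite -HE in vV.
set v := cinv 1 (H - 1) in pv vE vV.
have sw := csqrt_sa pv; have wE := csqrtE pv; set w := csqrt v in sw wE.
have wH : H * w = w * H by apply: csqrt_comm => //; rewrite vE vV.
pose l := [seq p.1 | p <- s] ++ [seq star p.2 | p <- s].
exists (size l), (fun i => w * nth 0 l i).
have -> : \sum_(i < size l) w * nth 0 l i * b * star (w * nth 0 l i) =
  w * (\sum_(i < size l) nth 0 l i * b * star (nth 0 l i)) * w.
  rewrite mulr_sumr mulr_suml; apply: eq_bigr => i _; rewrite starM sw; ncring.
rewrite -(big_mkord xpredT (fun i => nth 0 l i * b * star (nth 0 l i))).
rewrite -(big_nth 0 xpredT (fun x => x * b * star x)) big_cat !big_map /= -big_split /=.
have -> : \sum_(i <- s) (i.1 * b * star i.1 + star i.2 * b * star (star i.2)) = H.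
  by apply: eq_bigr => p _; rewrite starK.
by rewrite -wH -mulrA wE.
Qed.

(** Simplicity provides [t = b x q != 0]. Then [t^* t] is a conjugate of [b ^ 2], while
    [(t^* t) ^ 2] is a conjugate of [t t^*], itself a conjugate of [q ^ 2]; so [(t^* t) ^ 2] lies
    below both. *)
Lemma simple_common_lower b q : psd b -> psd q -> b != 0 -> q != 0 ->
  exists d, [/\ psd d, d != 0, cuntz_le d b & cuntz_le d q].
Proof.
move=> pb pq b0 q0.
have [x bxq] : exists x, b * x * q != 0.
  apply/not_existsP => H; have [N [r rE]] := simple_full pq q0.
  move/eqP: b0; apply; rewrite -[b]mulr1 -rE mulr_sumr big1 // => i _.
  by rewrite !mulrA; have /negP := H (r i); rewrite negbK => /eqP ->; rewrite mul0r.
pose t := b * x * q; have t0 : t != 0 by [].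
pose c := star t * t; have pc : psd c := psd_star_mul t.
have c0 : c != 0 by apply: contra t0 => /eqP /star_mul_eq0 ->.
have pcc : psd (c * c) by apply: psd_sqr; exact: psd_sa.
exists (c * c); split => //.
- apply: contra c0 => /eqP; rewrite -{1}(psd_sa pc) => /star_mul_eq0 -> //.
- apply: cuntz_trans (cuntz_mul_comm pc (erefl _)) _.
  apply: cuntz_trans (cuntz_mul_comm pb (erefl _)).
  have -> : c = star (x * q) * (b * b) * (x * q).
    by rewrite /c /t !starM (psd_sa pb); ncring.
  exact: cuntz_conj_star.
- have -> : c * c = star t * (t * star t) * t by rewrite /c; ncring.
  apply: cuntz_trans (cuntz_conj_star _ _) _.
  apply: cuntz_trans (cuntz_mul_comm pq (erefl _)).
  have -> : t * star t = (b * x) * (q * q) * star (b * x).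
    by rewrite /t !starM (psd_sa pq); ncring.
  exact: cuntz_conj.
Qed.

Lemma simple_common_lower_fin (I : finType) (b : I -> A) (q : A) : psd q -> q != 0 ->
  (forall i, psd (b i)) -> (forall i, b i != 0) ->
  exists d, [/\ psd d, d != 0 & forall i, cuntz_le d (b i)].
Proof.
move=> pq q0 pb b0.
suff [d [pd d0 H]] : exists d, [/\ psd d, d != 0 & forall i, i \in enum I -> cuntz_le d (b i)].
  by exists d; split=> // i; apply: H; rewrite mem_enum.
elim: (enum I) => [|i s [d [pd d0 H]]]; first by exists q.
have [d' [pd' d'0 d'd d'b]] := simple_common_lower pd (pb i) d0 (b0 i).
exists d'; split=> // j; rewrite inE => /orP[/eqP -> //|/H].
exact: cuntz_trans.
Qed.

End Simple.

(** * The operator norm on matrices *)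

Section OpNorm.
Variable R : realType.
Local Notation nrm := (@ComplexField.Normc.normc R).
Implicit Types (z : R[i]).

Lemma nrm_sqr z : (nrm z ^+ 2)%:C = conjc z * z.
Proof.
case: z => a b; rewrite /ComplexField.Normc.normc sqr_sqrtr ?addr_ge0 ?sqr_ge0 //.
by apply/eqP; rewrite eq_complex /=; apply/andP; split; apply/eqP; ring.
Qed.

Lemma nrm_ge0 z : 0 <= nrm z.
Proof. by case: z => a b; exact: sqrtr_ge0. Qed.

Lemma nrmD z z' : nrm (z + z') <= nrm z + nrm z'.
Proof. exact: (@le_normcD R z z'). Qed.

Lemma nrmM z z' : nrm (z * z') = nrm z * nrm z'.
Proof. exact: ComplexField.Normc.normcM. Qed.

Lemma nrm_sum I (r : seq I) (P : pred I) (F : I -> R[i]) :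
  nrm (\sum_(i <- r | P i) F i) <= \sum_(i <- r | P i) nrm (F i).
Proof.
elim/big_rec2: _ => [|i y1 y2 _ H]; first by rewrite ComplexField.Normc.normc0.
by apply: le_trans (nrmD _ _) _; rewrite lerD2l.
Qed.

Section VecNorm.
Variable n : nat.
Implicit Types (v w : 'cV[R[i]]_n) (X Z P : 'M[R[i]]_n).

Lemma l2norm_ge0 v : 0 <= l2norm v. Proof. exact: sqrtr_ge0. Qed.

Lemma l2norm_sqr v : l2norm v ^+ 2 = \sum_i nrm (v i ord0) ^+ 2.
Proof. by rewrite sqr_sqrtr //; apply: sumr_ge0 => i _; exact: sqr_ge0. Qed.

Lemma l2norm_sqrC v : (l2norm v ^+ 2)%:C = \sum_i conjc (v i ord0) * v i ord0.
Proof. by rewrite l2norm_sqr rmorph_sum; apply: eq_bigr => i _; exact: nrm_sqr. Qed.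

Lemma nrm_le_l2norm v i : nrm (v i ord0) <= l2norm v.
Proof.
rewrite -(@ler_pXn2r _ 2) ?nnegrE ?nrm_ge0 ?l2norm_ge0 // l2norm_sqr (bigD1 i) //=.
by rewrite lerDl; apply: sumr_ge0 => j _; exact: sqr_ge0.
Qed.

Lemma l2norm_le_sum v : l2norm v <= \sum_i nrm (v i ord0).
Proof.
have s0 (r : seq 'I_n) : 0 <= \sum_(i <- r) nrm (v i ord0).
  by apply: sumr_ge0 => i _; exact: nrm_ge0.
rewrite -(@ler_pXn2r _ 2) ?nnegrE ?l2norm_ge0 // l2norm_sqr.
elim: (index_enum _) => [|i r IH]; first by rewrite !big_nil expr0n.
rewrite !big_cons; have x0 := nrm_ge0 (v i ord0); have a0 := s0 r.
set a := \sum_(j <- r) nrm _ in IH a0 *; set x := nrm (v i ord0) in x0 *.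
have : 0 <= x * a by exact: mulr_ge0.
by rewrite sqrrD mulr2n; lra.
Qed.

Lemma l2norm_mulmx_ub X : has_ubound [set l2norm (X *m v) | v in [set v : 'cV[R[i]]_n | l2norm v <= 1]].
Proof.
exists (\sum_i \sum_j nrm (X i j)) => _ [v /= v1 <-].
apply: le_trans (l2norm_le_sum _) _; apply: ler_sum => i _; rewrite mxE.
apply: le_trans (nrm_sum _ _ _) _; apply: ler_sum => j _; rewrite nrmM.
rewrite ler_piMr ?nrm_ge0 //; exact: le_trans (nrm_le_l2norm v j) v1.
Qed.

Lemma opnorm_ub X v : l2norm v <= 1 -> l2norm (X *m v) <= opnorm X.
Proof. by move=> v1; apply: (ub_le_sup (l2norm_mulmx_ub X)); exists v. Qed.

Lemma l2norm0 : l2norm (0 : 'cV[R[i]]_n) = 0.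
Proof.
rewrite /l2norm big1 ?sqrtr0 // => i _.
by rewrite mxE ComplexField.Normc.normc0 expr0n.
Qed.

Lemma opnorm_ge0 X : 0 <= opnorm X.
Proof. by apply: le_trans (l2norm_ge0 (X *m 0)) (opnorm_ub _ _); rewrite l2norm0. Qed.

Lemma opnorm_le X M : (forall v, l2norm v <= 1 -> l2norm (X *m v) <= M) -> opnorm X <= M.
Proof.
move=> H; apply: ge_sup => [|_ [v /= v1 <-]]; last exact: H.
by exists (l2norm (X *m 0)), 0 => //=; rewrite l2norm0.
Qed.

Lemma opnorm1 : opnorm (1%:M : 'M[R[i]]_n) <= 1.
Proof. by apply: opnorm_le => v v1; rewrite mul1mx. Qed.

Lemma l2norm_delta j : l2norm (delta_mx j ord0 : 'cV[R[i]]_n) = 1.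
Proof.
rewrite /l2norm (bigD1 j) //= big1 => [|i ij]; rewrite mxE ?eqxx.
  by rewrite ComplexField.Normc.normc1 expr1n addr0 sqrtr1.
by rewrite (negPf ij) ComplexField.Normc.normc0 expr0n.
Qed.

Lemma nrm_le_opnorm X i j : nrm (X i j) <= opnorm X.
Proof.
apply: le_trans (opnorm_ub X (v := delta_mx j ord0) _); last by rewrite l2norm_delta.
by rewrite -colE; apply: le_trans (nrm_le_l2norm _ i); rewrite mxE.
Qed.

Lemma opnorm_delta i j : opnorm (delta_mx i j : 'M[R[i]]_n) = 1.
Proof.
apply/eqP; rewrite eq_le; apply/andP; split; last first.
  have := nrm_le_opnorm (delta_mx i j) i j.
  by rewrite mxE !eqxx ComplexField.Normc.normc1.
apply: opnorm_le => v v1; apply: le_trans v1; apply: le_trans (nrm_le_l2norm v j).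
rewrite /l2norm (bigD1 i) //= big1 => [|k ki]; rewrite !mxE.
  rewrite (bigD1 j) //= big1 => [|l lj]; rewrite !mxE !eqxx ?(negPf lj) ?mul0r //.
  by rewrite mul1r addr0 addr0 sqrtr_sqr ger0_norm ?nrm_ge0.
rewrite big1 => [|l _]; first by rewrite ComplexField.Normc.normc0 expr0n.
by rewrite mxE (negPf ki) mul0r.
Qed.

(** The inequality [X^* X <= ||X|| ^ 2] as an equation to which a linear map can be applied. The
    eigenvalues of the difference are its values at unit eigenvectors, hence nonnegative, and [Z] is
    a root of it obtained by diagonalization. *)
Lemma opnorm_defect X : exists Z,
  mxstar X *m X + mxstar Z *m Z = ((opnorm X ^+ 2)%:C)%:M.
Proof.
set t := opnorm X; pose H : 'M[R[i]]_n := ((t ^+ 2)%:C)%:M - mxstar X *m X.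
have starE (M : 'M[R[i]]_n) : mxstar M = (M ^t*)%sesqui.
  by apply/matrixP => i j; rewrite !mxE.
have Hs : (H ^t*)%sesqui = H.
  rewrite -starE -[mxstar H]/(star H) starB; congr (_ - _); last by rewrite -[LHS]/(mxstar _) mxstarM mxstarK.
  apply/matrixP => i j; rewrite !mxE eq_sym; case: eqP => _; last exact: star0.
  by rewrite !mulr1n -[LHS]/(conjc _) conjc_real.
have /orthomx_spectralP HE : H \is normalmx by apply/normalmxP; rewrite Hs.
set P := spectralmx H in HE; set D := spectral_diag H in HE.
have uP : P \is unitarymx := spectral_unitarymx H.
have PP := unitarymxP uP; rewrite invmx_unitary // in HE.
pose w j : 'cV[R[i]]_n := col j (P ^t*)%sesqui.
have w1 j : l2norm (w j) = 1.
  apply/eqP; rewrite -(@eqrXn2 _ 2) ?l2norm_ge0 // expr1n -(inj_eq (@complexI R)) l2norm_sqrC rmorph1.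
  have := congr1 (fun M : 'M[R[i]]_n => M j j) PP; rewrite !mxE eqxx => /= h.
  by apply/eqP; apply: etrans h; apply: eq_bigr => i _; rewrite !mxE /= conjcK mulrC.
pose d j := t ^+ 2 - l2norm (X *m w j) ^+ 2.
have d0 j : 0 <= d j.
  rewrite subr_ge0 ler_pXn2r ?nnegrE ?l2norm_ge0 ?opnorm_ge0 //.
  by apply: opnorm_ub; rewrite w1.
have DE j : D ord0 j = (d j)%:C.
  have : (P *m H *m (P ^t*)%sesqui) j j = D ord0 j.
    by rewrite HE !mulmxA PP mul1mx -mulmxA PP mulmx1 mxE eqxx.
  move=> <-; rewrite /H mulmxBr mulmxBl mxE /d rmorphB; congr (_ + _).
    by rewrite -scalemx1 -scalemxAr mulmx1 -scalemxAl PP !mxE eqxx mulr1.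
  rewrite [RHS]/= l2norm_sqrC mxE; congr (- _).
  rewrite -starE; have -> : P *m (mxstar X *m X) *m mxstar P = mxstar (X *m mxstar P) *m (X *m mxstar P).
    by rewrite [mxstar (X *m mxstar P)](mxstarM X (mxstar P)) mxstarK -mulmxE !mulmxA.
  rewrite mxE; apply: eq_bigr => i _; rewrite /w -starE.
  have -> : (X *m col j (mxstar P)) i ord0 = (X *m mxstar P) i j.
    by rewrite !mxE; apply: eq_bigr => k _; rewrite !mxE.
  by rewrite mxE.
exists (diag_mx (\row_j (Num.sqrt (d j))%:C) *m P).
have -> : mxstar X *m X = ((t ^+ 2)%:C)%:M - H by rewrite /H opprB addrCA subrr addr0.
rewrite -[RHS](subrK H); congr (_ + _); rewrite HE.
rewrite -starE [mxstar (diag_mx _ *m P)](mxstarM (diag_mx _) P) -mulmxE !mulmxA; congr (_ *m _).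
rewrite -mulmxA; congr (_ *m _); apply/matrixP => i j; rewrite mxE (bigD1 j) //= big1 => [|k kj].
  rewrite !mxE eqxx DE addr0 eq_sym; case: eqP => [<-|_]; last by rewrite star0 mul0r.
  by rewrite !mulr1n -[star _]/(conjc _) conjc_real -rmorphM -expr2 sqr_sqrtr.
by rewrite !mxE (negPf kj) mulr0.
Qed.

End VecNorm.
End OpNorm.

(** * Order zero maps as systems of matrix units *)

Section OrderZeroSystem.
Variables (T : pzStarRingType) (I : finType).

(* The images of matrix units under an order zero map with values in [T]. *)
Record oz (f : I -> I -> T) : Prop := Oz {
  oz_star : forall i j, star (f i j) = f j i;
  oz_orth : forall i j k l, j != k -> f i j * f k l = 0;
  oz_mul : forall i j l, f i j * f j l = f i l * f l l
}.

Variable f : I -> I -> T.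
Hypothesis hf : oz f.

(** The image of the unit. It commutes with the system, and [ozM], where it appears as a factor,
    replaces the relation between genuine matrix units. *)
Definition oz1 := \sum_i f i i.

Lemma oz1_mul i j : oz1 * f i j = f i j * f j j.
Proof.
rewrite /oz1 mulr_suml (bigD1 i) //= big1 ?addr0 => [|k ki]; last exact: oz_orth.
exact: oz_mul.
Qed.

Lemma oz1_comm i j : f i j * oz1 = oz1 * f i j.
Proof.
rewrite oz1_mul /oz1 mulr_sumr (bigD1 j) //= big1 ?addr0 // => k kj.
by apply: oz_orth; rewrite // eq_sym.
Qed.

Lemma ozM i j k l : f i j * f k l = if j == k then oz1 * f i l else 0.
Proof.
case: eqP => [<-|/eqP]; last exact: oz_orth.
by rewrite oz1_mul; exact: oz_mul.
Qed.

Lemma oz1_sa : star oz1 = oz1.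
Proof. by rewrite star_sum; apply: eq_bigr => i _; rewrite oz_star. Qed.

End OrderZeroSystem.

Section OrderZeroMaps.
Variables (R : realType) (A : cstarAlgType R).

Lemma psd_sum_eq0 (I : finType) (F : I -> A) :
  (forall i, psd (F i)) -> \sum_i F i = 0 -> forall i, F i = 0.
Proof.
move=> pF F0 i; apply: psd_antisym => //.
have -> : - F i = \sum_(j | j != i) F j; last exact: psd_sum.
apply/eqP; rewrite eq_sym -addr_eq0 addrC; apply/eqP; rewrite -[RHS]F0.
by rewrite [RHS](bigD1 i).
Qed.

(** A sum of positive elements vanishes only term by term. Orthogonality of the diagonal entries
    therefore passes first to [Y l i * F k k] and then to [Y l i * (Y m k)^*], the middle factor of
    every product [F i j * F k l]. *)
Lemma gram_orth (n : nat) (Y : 'M[A]_n) (F : 'I_n -> 'I_n -> A) :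
  (forall i j, F i j = \sum_l star (Y l i) * Y l j) ->
  (forall i k, i != k -> F i i * F k k = 0) ->
  forall i j k l, j != k -> F i j * F k l = 0.
Proof.
move=> FE F0; have step1 l i k : i != k -> Y l i * F k k = 0.
  move=> ik; apply: star_mul_eq0.
  apply: (psd_sum_eq0 (F := fun l => star (Y l i * F k k) * (Y l i * F k k))) => [m|].
    exact: psd_star_mul.
  transitivity (star (F k k) * F i i * F k k); last by rewrite -mulrA F0 // mulr0.
  by rewrite (FE i i) mulr_sumr mulr_suml; apply: eq_bigr => m _; rewrite starM !mulrA.
have step2 l i m k : i != k -> Y l i * star (Y m k) = 0.
  move=> ik; apply: (can_inj (@starK A)); rewrite star0 starM starK.
  apply: star_mul_eq0; move: m.
  apply: (psd_sum_eq0 (F := fun m => star (Y m k * star (Y l i)) * (Y m k * star (Y l i)))) => [m|].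
    exact: psd_star_mul.
  transitivity (Y l i * F k k * star (Y l i)); last by rewrite step1 // mul0r.
  rewrite (FE k k) mulr_sumr mulr_suml; apply: eq_bigr => m _; rewrite starM starK; ncring.
move=> i j k l jk; rewrite !FE mulr_suml big1 // => a _; rewrite mulr_sumr big1 // => b _.
by rewrite mulrA -(mulrA _ (Y a j)) step2 // mulr0 mul0r.
Qed.

Variables (n : nat) (phi : 'M[R[i]]_n -> A).
Hypothesis hphi : cpc_order_zero phi.
Definition unit_image i j := phi (delta_mx i j).
Local Notation F := unit_image.

Lemma cpcD X Y : phi (X + Y) = phi X + phi Y.
Proof. by case: hphi => lf _ _ _; have := lf 1 X Y; rewrite !scale1r. Qed.

Lemma cpc0 : phi 0 = 0.
Proof. by apply: (addrI (phi 0)); rewrite -cpcD !addr0. Qed.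

Lemma cpcZ c X : phi (c *: X) = c *: phi X.
Proof. by case: hphi => lf _ _ _; have := lf c X 0; rewrite cpc0 !addr0. Qed.

Lemma cpcN X : phi (- X) = - phi X.
Proof. by rewrite -scaleN1r cpcZ scaleN1r. Qed.

Lemma cpc_sum I (r : seq I) (P : pred I) (G : I -> 'M[R[i]]_n) :
  phi (\sum_(i <- r | P i) G i) = \sum_(i <- r | P i) phi (G i).
Proof. exact: (big_morph phi cpcD cpc0). Qed.

Lemma cpc1 : phi 1%:M = \sum_i F i i.
Proof. by rewrite [1%:M]matrix_sum_delta cpc_sum; apply: eq_bigr => i _;
  rewrite cpc_sum (bigD1 i) //= mxE eqxx scale1r big1 ?addr0 // => j ji;
  rewrite mxE eq_sym (negPf ji) scale0r cpc0. Qed.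

Lemma star_delta (i j : 'I_n) : star (delta_mx i j : 'M[R[i]]_n) = delta_mx j i.
Proof.
apply/matrixP => a b; rewrite !mxE andbC; case: (_ && _); last exact: star0.
by rewrite -[LHS]/(conjc _) conjc1.
Qed.

Lemma mul_delta (i j k l : 'I_n) :
  (delta_mx i j : 'M[R[i]]_n) * delta_mx k l = if j == k then delta_mx i l else 0.
Proof. by rewrite -mulmxE mul_delta_mx_cond; case: eqP. Qed.

(** The Choi matrix: complete positivity is applied to the positive matrix with entries [e_ij]. *)
Lemma cpc_gram : exists Y : 'M[A]_n, forall i j, F i j = \sum_l star (Y l i) * Y l j.
Proof.
case: (posnP n) => [n0|n0].
  exists 0 => i; have h : (0 < n)%N := leq_ltn_trans (leq0n i) (ltn_ord i).
  by exfalso; rewrite n0 in h.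
pose i0 := Ordinal n0; case: hphi => _ cp _ _.
pose X : 'M['M[R[i]]_n]_n := \matrix_(i, j) delta_mx i j.
have [|Y HY] := cp n X.
  exists (\matrix_(k, j) if k == i0 then delta_mx i0 j else 0).
  apply/matrixP => i j; rewrite !mxE (bigD1 i0) //= big1 => [|k ki]; rewrite !mxE.
    by rewrite eqxx star_delta mul_delta eqxx addr0.
  by rewrite (negPf ki) mulr0.
exists Y => i j; have := congr1 (fun M : 'M[A]_n => M i j) HY.
by rewrite !mxE => h; rewrite [LHS]h; apply: eq_bigr => l _; rewrite mxE.
Qed.

Lemma cpc_psd i : psd (F i i).
Proof. by have [Y YE] := cpc_gram; rewrite YE; apply: psd_sum => l _; exact: psd_star_mul. Qed.

Lemma cpc_star i j : star (F i j) = F j i.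
Proof.
have [Y YE] := cpc_gram; rewrite !YE star_sum; apply: eq_bigr => l _.
by rewrite starM starK.
Qed.

Lemma cpc_orth i j k l : j != k -> F i j * F k l = 0.
Proof.
have [Y YE] := cpc_gram; apply: (gram_orth YE) => a b ab.
case: hphi => _ _ _ oz; apply: oz; last by rewrite mul_delta (negPf ab).
  by exists (delta_mx a a); rewrite star_delta mul_delta eqxx.
by exists (delta_mx b b); rewrite star_delta mul_delta eqxx.
Qed.

(* Orthogonality of the all-ones vector to [e_i - e_j]. *)
Lemma cpc_mul a j i : F a j * F j i = F a i * F i i.
Proof.
have [->//|ij] := eqVneq j i.
pose J : 'M[R[i]]_n := \sum_a \sum_b delta_mx a b.
pose W : 'M[R[i]]_n := delta_mx i i + delta_mx j j - delta_mx i j - delta_mx j i.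
have pJ : positive J.
  exists (\sum_b delta_mx i b); rewrite star_sum mulr_suml; apply: eq_bigr => c _.
  by rewrite mulr_sumr; apply: eq_bigr => b _; rewrite star_delta mul_delta eqxx.
have pW : positive W.
  exists (delta_mx i i - delta_mx i j); rewrite starB !star_delta.
  by rewrite mulrBl !mulrBr !mul_delta !eqxx /W; ncring.
have JW : J * W = 0.
  rewrite mulr_suml big1 // => c _; rewrite mulr_suml.
  have -> : \sum_b delta_mx c b * W = \sum_b ((if b == i then delta_mx c i - delta_mx c j else 0)
     + (if b == j then delta_mx c j - delta_mx c i else 0)).
    apply: eq_bigr => b _; rewrite !mulrBr mulrDr !mul_delta.
    by case: (b == i); case: (b == j); ncring.
  by rewrite big_split /= -!big_mkcond !big_pred1_eq; ncring.
case: hphi => _ _ _ /(_ _ _ pJ pW JW) H.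
have WE : phi W = F i i + F j j - F i j - F j i by rewrite !(cpcD, cpcN).
pose U c := F c i * F i i - F c j * F j i.
pose V c := F c j * F j j - F c i * F i j.
have ji : i != j by rewrite eq_sym.
have UV : \sum_c U c + \sum_c V c = 0.
  rewrite -big_split -[RHS]H cpc_sum mulr_suml; apply: eq_bigr => c _ /=.
  rewrite cpc_sum mulr_suml (bigD1 i) //= (bigD1 j) //= big1 => [|b /andP[bi bj]].
    rewrite WE !mulrBr !mulrDr [F c i * F j j]cpc_orth // [F c i * F j i]cpc_orth //.
    by rewrite [F c j * F i i]cpc_orth // [F c j * F i j]cpc_orth // /U /V; ncring.
  by rewrite WE !mulrBr mulrDr !cpc_orth // !subr0 addr0.
have sU c : star (U c) = F i i * F i c - F i j * F j c.
  by rewrite starB !starM !cpc_star.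
have sV c : star (V c) = F j j * F j c - F j i * F i c.
  by rewrite starB !starM !cpc_star.
have US : \sum_c U c = 0.
  apply: (can_inj (@starK A)); rewrite star0; apply: star_mul_eq0; rewrite starK.
  have -> : star (\sum_c U c) = - star (\sum_c V c).
    by rewrite -starN; congr star; apply/eqP; rewrite -addr_eq0 UV.
  rewrite mulrN star_sum mulr_sumr big1 ?oppr0 // => c _; rewrite mulr_suml big1 // => b _.
  rewrite sV /U.
  have -> : (F b i * F i i - F b j * F j i) * (F j j * F j c - F j i * F i c) =
    F b i * (F i i * F j j) * F j c - F b i * (F i i * F j i) * F i c -
    F b j * (F j i * F j j) * F j c + F b j * (F j i * F j i) * F i c by ncring.
  by rewrite !cpc_orth // !(mulr0, mul0r) !subr0 addr0.
have UU c : U c = 0.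
  apply: star_mul_eq0; transitivity (star (U c) * \sum_b U b); last by rewrite US mulr0.
  rewrite mulr_sumr (bigD1 c) //= big1 ?addr0 // => b bc.
  have cb : c != b by rewrite eq_sym.
  rewrite sU /U.
  have -> : (F i i * F i c - F i j * F j c) * (F b i * F i i - F b j * F j i) =
    F i i * (F i c * F b i) * F i i - F i i * (F i c * F b j) * F j i -
    F i j * (F j c * F b i) * F i i + F i j * (F j c * F b j) * F j i by ncring.
  by rewrite !cpc_orth // !(mulr0, mul0r) !subr0 addr0.
by have /eqP := UU a; rewrite subr_eq0 => /eqP ->.
Qed.

Lemma cpc_oz : oz F.
Proof. by split; [exact: cpc_star|exact: cpc_orth|exact: cpc_mul]. Qed.

Lemma cpc_norm i j : cnorm (F i j) <= 1.
Proof.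
have h : cnorm (F j j) <= 1.
  case: hphi => _ _ H _; apply: le_trans (le_trans (H 1%:M) (opnorm1 _ _)).
  apply: psd_cnorm_le; first exact: cpc_psd.
  rewrite cpc1 (bigD1 j) //= addrC addrK; apply: psd_sum => k _; exact: cpc_psd.
rewrite -(@ler_pXn2r _ 2) ?nnegrE ?cnorm_ge0 // expr1n -cnorm_star cpc_star cpc_mul.
by rewrite -[1]mulr1; exact: cnormM_le.
Qed.

End OrderZeroMaps.

(** * From systems of matrix units back to order zero maps *)

Section OrderZeroConverse.
Variables (R : realType) (A : cstarAlgType R) (n : nat) (g : 'I_n -> 'I_n -> A) (rho : A).
Hypothesis hg : oz g.
Hypothesis rho_sa : star rho = rho.
Hypothesis rho_comm : forall i j, g i j * rho = rho * g i j.
Local Notation H := (oz1 g).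
Hypothesis rhoH : cnorm (rho * H) <= 1.

Definition oz_lin (X : 'M[R[i]]_n) : A := \sum_i \sum_j X i j *: g i j.

(** The factor [H] makes complete positivity visible, as [H L(X^* Y) = L(X)^* L(Y)] for
    [L = oz_lin]; [rho] rescales. Without [rho] the matrix units go to [oz1 g * g i j], the elements
    that are followed from here on. *)
Definition oz_map (X : 'M[R[i]]_n) : A := rho * rho * H * oz_lin X.

Lemma oz_lin_linear : linear oz_lin.
Proof.
move=> c X Y; rewrite /oz_lin scaler_sumr -big_split; apply: eq_bigr => i _ /=.
rewrite scaler_sumr -big_split; apply: eq_bigr => j _ /=.
by rewrite !mxE scalerDl scalerA.
Qed.

Lemma oz_linD X Y : oz_lin (X + Y) = oz_lin X + oz_lin Y.
Proof. by have := oz_lin_linear 1 X Y; rewrite !scale1r. Qed.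

Lemma oz_lin0 : oz_lin 0 = 0.
Proof. by apply: (addrI (oz_lin 0)); rewrite -oz_linD !addr0. Qed.

Lemma oz_lin_star X : star (oz_lin X) = oz_lin (star X).
Proof.
rewrite /oz_lin star_sum exchange_big; apply: eq_bigr => i _; rewrite star_sum.
by apply: eq_bigr => j _; rewrite starZ (oz_star hg) mxE.
Qed.

Lemma oz_linM X Y : oz_lin X * oz_lin Y = H * oz_lin (X * Y).
Proof.
rewrite {1 3}/oz_lin mulr_suml mulr_sumr; apply: eq_bigr => i _.
rewrite mulr_suml mulr_sumr.
transitivity (\sum_j \sum_l (X i j * Y j l) *: (H * g i l)).
  apply: eq_bigr => j _; rewrite mulr_sumr (bigD1 j) //= [X in _ + X]big1 ?addr0 => [|k kj].
    by rewrite mulr_sumr; apply: eq_bigr => l _; rewrite -scalerAl -scalerAr scalerA ozM // eqxx.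
  rewrite mulr_sumr big1 // => l _; rewrite -scalerAl -scalerAr ozM // eq_sym (negPf kj).
  by rewrite !scaler0.
rewrite exchange_big; apply: eq_bigr => l _ /=.
by rewrite mxE -scalerAr scaler_suml.
Qed.

Lemma oz_lin_comm x : (forall i j, g i j * x = x * g i j) -> forall X, oz_lin X * x = x * oz_lin X.
Proof.
move=> gx X; rewrite /oz_lin mulr_suml mulr_sumr; apply: eq_bigr => i _.
rewrite mulr_suml mulr_sumr; apply: eq_bigr => j _.
by rewrite -scalerAl -scalerAr gx.
Qed.

Lemma oz_lin1 : oz_lin 1%:M = H.
Proof.
apply: eq_bigr => i _; rewrite (bigD1 i) //= mxE eqxx scale1r big1 ?addr0 // => j ji.
by rewrite mxE eq_sym (negPf ji) scale0r.
Qed.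

Lemma rho_H : rho * H = H * rho.
Proof. by rewrite mulr_sumr mulr_suml; apply: eq_bigr => i _; rewrite rho_comm. Qed.

Lemma oz_map1 : oz_map 1%:M = (rho * H) * (rho * H).
Proof. by rewrite /oz_map oz_lin1 [in RHS]rho_H -rho_H; rewrite [in RHS]mulrA -[rho * H * rho]mulrA -rho_H; ncring. Qed.

Lemma oz_map_delta i j : oz_map (delta_mx i j) = rho * rho * H * g i j.
Proof.
congr (_ * _); rewrite /oz_lin (bigD1 i) //= [X in _ + X]big1 => [|k ki].
  rewrite (bigD1 j) //= big1 => [|l lj]; rewrite !mxE !eqxx ?(negPf lj) ?scale0r //.
  by rewrite scale1r !addr0.
by rewrite big1 // => l _; rewrite mxE (negPf ki) scale0r.
Qed.

Lemma oz_map_star X Y : oz_map (star X * Y) = star (rho * oz_lin X) * (rho * oz_lin Y).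
Proof.
have hr := oz_lin_comm rho_comm.
rewrite starM oz_lin_star rho_sa /oz_map -!mulrA -oz_linM !mulrA.
by rewrite -[rho * rho * oz_lin _]mulrA -hr mulrA -hr.
Qed.

Lemma oz_map_cpc : cpc_order_zero oz_map.
Proof.
have hr := oz_lin_comm rho_comm; have hH := oz_lin_comm (oz1_comm hg).
split.
- by move=> c X Y; rewrite /oz_map oz_lin_linear mulrDr scalerAr.
- move=> k X [Z ->]; exists (map_mx (fun M => rho * oz_lin M) Z).
  apply/matrixP => i j; rewrite !mxE.
  have -> : oz_map (\sum_l star Z i l * Z l j) = \sum_l oz_map (star Z i l * Z l j).
    apply: (big_morph oz_map) => [x y|]; rewrite /oz_map ?oz_lin0 ?mulr0 //.
    by rewrite oz_linD mulrDr.
  by apply: eq_bigr => l _; rewrite !mxE oz_map_star.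
(* With [y = rho H] and [phi = oz_map]: [phi(1) = y ^ 2] and [phi(M)^* phi(M) = y phi(M^* M) y].
   Hence [t ^ 2 - phi(X)^* phi(X) = t ^ 2 (1 - y ^ 4) + phi(Z)^* phi(Z)], which is positive. *)
- move=> X; have [Z XZ] := opnorm_defect X; apply: cnorm_sqr_le; first exact: opnorm_ge0.
  set t := opnorm X in XZ *; pose y := rho * H.
  have sH := oz1_sa hg; have sy : star y = y by rewrite starM sH rho_sa -rho_H.
  have yl M : oz_lin M * y = y * oz_lin M.
    apply: oz_lin_comm => i j.
    by rewrite /y mulrA rho_comm -mulrA (oz1_comm hg) // mulrA.
  have ry : rho * y = y * rho by rewrite /y -mulrA -rho_H.
  have yE M : oz_map M = y * (rho * oz_lin M).
    by rewrite /oz_map mulrA -ry /y mulrA.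
  have key M : star (oz_map M) * oz_map M = y * oz_map (star M * M) * y.
    rewrite oz_map_star yE [star (y * _)]starM sy.
    have -> : star (rho * oz_lin M) * y = y * star (rho * oz_lin M).
      by rewrite starM rho_sa oz_lin_star -mulrA ry mulrA yl mulrA.
    have -> : y * (rho * oz_lin M) = rho * oz_lin M * y.
      by rewrite -[RHS]mulrA yl [RHS]mulrA ry mulrA.
    by ncring.
  have sumE : oz_map (star X * X) + oz_map (star Z * Z) = sc (t ^+ 2) * (y * y).
    rewrite /oz_map -mulrDr -oz_linD.
    have -> : star X * X + star Z * Z = ((t ^+ 2)%:C)%:M by exact: XZ.
    rewrite -/(oz_map _); have -> : ((t ^+ 2)%:C)%:M = (t ^+ 2)%:C *: (1%:M : 'M[R[i]]_n).
      by rewrite scalemx1.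
    have -> : oz_map ((t ^+ 2)%:C *: 1%:M) = (t ^+ 2)%:C *: oz_map 1%:M.
      rewrite /oz_map; have := oz_lin_linear (t ^+ 2)%:C 1%:M 0.
      by rewrite oz_lin0 !addr0 => ->; rewrite scalerAr.
    by rewrite oz_map1 mulr_algl.
  have y2 : psd (1 - (y * y) * (y * y)).
    have syy : star (y * y) = y * y by rewrite starM sy.
    have := @star_mul_scB _ _ (y * y) 1; rewrite syy expr1n scale1r; apply.
    by rewrite -[1]mulr1; exact: cnormM_le.
  rewrite key; have -> : oz_map (star X * X) = sc (t ^+ 2) * (y * y) - oz_map (star Z * Z).
    by rewrite -sumE; ncring.
  have -> : sc (t ^+ 2) - y * (sc (t ^+ 2) * (y * y) - oz_map (star Z * Z)) * y =
     sc (t ^+ 2) - (y * sc (t ^+ 2)) * (y * y * y) + y * oz_map (star Z * Z) * y by ncring.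
  rewrite -key sc_comm; apply: psdD; last exact: psd_star_mul.
  have -> : sc (t ^+ 2) - sc (t ^+ 2) * y * (y * y * y) = sc (t ^+ 2) * (1 - y * y * (y * y)).
    by ncring.
  by rewrite mulr_algl; apply: psdZ => //; exact: sqr_ge0.
- move=> a b _ _ ab; rewrite /oz_map -!mulrA [oz_lin a * _]mulrA hr -!mulrA.
  have -> : oz_lin a * (rho * (H * oz_lin b)) = rho * H * (oz_lin a * oz_lin b).
    by rewrite mulrA hr -!mulrA; congr (_ * _); rewrite !mulrA hH.
  by rewrite oz_linM ab oz_lin0 !mulr0.
Qed.

End OrderZeroConverse.

(** * Bounded sequences modulo null sequences *)

Section AsymptoticAlgebra.
Variables (R : realType) (A : cstarAlgType R).
Implicit Types (x y z : nat -> A).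

Definition abnd x := exists M : R, forall n, cnorm (x n) <= M.

Definition aclose x y := null (fun n => cnorm (x n - y n)).

Lemma bndD x y : abnd x -> abnd y -> abnd (fun n => x n + y n).
Proof.
move=> [M xM] [N yN]; exists (M + N) => n.
by apply: le_trans (cnormD _ _) _; apply: lerD.
Qed.

Lemma bndN x : abnd x -> abnd (fun n => - x n).
Proof. by move=> [M xM]; exists M => n; rewrite cnormN. Qed.

Lemma bndM x y : abnd x -> abnd y -> abnd (fun n => x n * y n).
Proof. by move=> [M xM] [N yN]; exists (M * N) => n; exact: cnormM_le. Qed.

Lemma bnd_cst (a : A) : abnd (fun=> a).
Proof. by exists (cnorm a). Qed.

Lemma bnd_star x : abnd x -> abnd (fun n => star (x n)).
Proof. by move=> [M xM]; exists M => n; rewrite cnorm_starE. Qed.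

Lemma bndZ (c : R[i]) x : abnd x -> abnd (fun n => c *: x n).
Proof.
move=> [M xM]; exists (ComplexField.Normc.normc c * M) => n.
by rewrite cnormZ ler_wpM2l ?nrm_ge0.
Qed.

Lemma bndX x k : abnd x -> abnd (fun n => x n ^+ k).
Proof.
move=> [M xM]; exists (M ^+ k) => n; apply: le_trans (cnormX _ _) _.
by rewrite lerXn2r // nnegrE ?cnorm_ge0 // (le_trans (cnorm_ge0 _) (xM 0%N)).
Qed.

Lemma bnd_sum I (r : seq I) (P : pred I) (F : I -> nat -> A) :
  (forall i, P i -> abnd (F i)) -> abnd (fun n => \sum_(i <- r | P i) F i n).
Proof.
move=> bF; elim: r => [|i r IH].
  by exists 0 => n; rewrite big_nil cnorm0.
case Pi: (P i); last first.
  by have [M HM] := IH; exists M => n; rewrite big_cons Pi; exact: HM.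
have [M HM] := bndD (bF _ Pi) IH; exists M => n.
by rewrite big_cons Pi; exact: HM.
Qed.

Lemma bnd_le1 x : (forall n, cnorm (x n) <= 1) -> abnd x.
Proof. by exists 1. Qed.

Lemma aclose_refl x : aclose x x.
Proof. by apply: null_eq (@null0 R) => n; rewrite subrr cnorm0. Qed.

Lemma aclose_sym x y : aclose x y -> aclose y x.
Proof. by apply: null_eq => n; rewrite cnorm_distC. Qed.

Lemma aclose_trans y x z : aclose x y -> aclose y z -> aclose x z.
Proof. by move=> xy yz; apply: null_le (nullD xy yz) _ => n; exact: cnorm_triangle. Qed.

Lemma acloseD x y x' y' : aclose x x' -> aclose y y' ->
  aclose (fun n => x n + y n) (fun n => x' n + y' n).
Proof.
move=> xx yy; apply: null_le (nullD xx yy) _ => n.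
by rewrite opprD addrACA; exact: cnormD.
Qed.

Lemma acloseM x y x' y' : abnd x -> abnd y' -> aclose x x' -> aclose y y' ->
  aclose (fun n => x n * y n) (fun n => x' n * y' n).
Proof.
move=> [M xM] [N yN] xx yy.
apply: null_le (nullD (nullMl M yy _) (nullMl N xx _)) _; try by move=> n; exact: cnorm_ge0.
move=> n; have -> : x n * y n - x' n * y' n = x n * (y n - y' n) + (x n - x' n) * y' n by ncring.
apply: le_trans (cnormD _ _) _; apply: lerD; first exact: cnormM_le.
by rewrite mulrC; exact: cnormM_le.
Qed.

Lemma bnd_close x y : abnd x -> aclose x y -> abnd y.
Proof.
move=> [M xM] xy; have yx : cvgs (fun n => y n - x n) 0.
  by apply: null_eq (aclose_sym xy) => n; rewrite subr0.
have [N _ HN] := cvgs_bounded yx; exists (M + N) => n.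
by apply: le_trans (cnorm_le_dist _ (x n)) _; apply: lerD.
Qed.

Definition rep x : nat -> A := xget (fun=> 0) [set y | aclose x y].

Lemma rep_close x : aclose x (rep x).
Proof. by apply: (@xgetPex _ _ [set y | aclose x y]); exists x; exact: aclose_refl. Qed.

Lemma rep_eq x y : aclose x y -> rep x = rep y.
Proof.
move=> xy; rewrite /rep; congr (xget _ _); apply/seteqP; split=> z /=.
  by apply: aclose_trans; exact: aclose_sym.
exact: aclose_trans.
Qed.

(* Bounded sequences modulo null sequences, through chosen representatives. *)
Record asymp := Asymp { aseq : nat -> A; aseq_rep : rep aseq = aseq; aseq_bnd : abnd aseq }.

HB.instance Definition _ := gen_eqMixin asymp.
HB.instance Definition _ := gen_choiceMixin asymp.

Lemma asymp_eq (p q : asymp) : aclose (aseq p) (aseq q) -> p = q.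
Proof.
case: p q => [x rx bx] [y ry by_] /= xy; have xyE : x = y by rewrite -rx -ry; exact: rep_eq.
by case: _ / xyE ry by_ => ry by_; congr Asymp; exact: Prop_irrelevance.
Qed.

Lemma rep_rep x : rep (rep x) = rep x.
Proof. by apply: rep_eq; apply: aclose_sym; exact: rep_close. Qed.

Lemma rep_bnd x : abnd x -> abnd (rep x).
Proof. by move=> bx; apply: bnd_close bx (rep_close x). Qed.

Definition cls x : asymp :=
  match pselect (abnd x) with
  | left bx => Asymp (rep_rep x) (rep_bnd bx)
  | right _ => Asymp (rep_rep (fun=> 0)) (rep_bnd (bnd_cst 0))
  end.

Lemma cls_close x : abnd x -> aclose (aseq (cls x)) x.
Proof. by rewrite /cls; case: pselect => // bx _; apply: aclose_sym; exact: rep_close. Qed.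

Lemma cls_eq x y : abnd x -> abnd y -> aclose x y -> cls x = cls y.
Proof.
move=> bx by_ xy; apply: asymp_eq; apply: aclose_trans (cls_close bx) _.
by apply: aclose_trans xy (aclose_sym (cls_close by_)).
Qed.

Lemma cls_inj x y : abnd x -> abnd y -> cls x = cls y -> aclose x y.
Proof.
move=> bx by_ xy; apply: aclose_trans (aclose_sym (cls_close bx)) _.
by rewrite xy; exact: cls_close.
Qed.

Lemma cls_surj p : exists2 x, abnd x & p = cls x.
Proof.
exists (aseq p); first exact: aseq_bnd.
by apply: asymp_eq; apply: aclose_sym; apply: cls_close; exact: aseq_bnd.
Qed.

Definition asymp_add p q := cls (fun n => aseq p n + aseq q n).
Definition asymp_opp p := cls (fun n => - aseq p n).
Definition asymp_mul p q := cls (fun n => aseq p n * aseq q n).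
Definition asymp_star p := cls (fun n => star (aseq p n)).

Lemma asymp_addE x y : abnd x -> abnd y -> asymp_add (cls x) (cls y) = cls (fun n => x n + y n).
Proof.
move=> bx by_; apply: cls_eq; [apply: bndD; exact: aseq_bnd|exact: bndD|].
by apply: acloseD; exact: cls_close.
Qed.

Lemma asymp_oppE x : abnd x -> asymp_opp (cls x) = cls (fun n => - x n).
Proof.
move=> bx; apply: cls_eq; [apply: bndN; exact: aseq_bnd|exact: bndN|].
by apply: null_eq (cls_close bx) => n; rewrite -opprD cnormN.
Qed.

Lemma asymp_mulE x y : abnd x -> abnd y -> asymp_mul (cls x) (cls y) = cls (fun n => x n * y n).
Proof.
move=> bx by_; apply: cls_eq; [apply: bndM; exact: aseq_bnd|exact: bndM|].
by apply: acloseM; [exact: aseq_bnd|by []|exact: cls_close|exact: cls_close].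
Qed.

Lemma asymp_starE x : abnd x -> asymp_star (cls x) = cls (fun n => star (x n)).
Proof.
move=> bx; apply: cls_eq; [apply: bnd_star; exact: aseq_bnd|exact: bnd_star|].
by apply: null_eq (cls_close bx) => n; rewrite -starB cnorm_starE.
Qed.

Local Ltac reps := repeat match goal with p : asymp |- _ =>
  let x := fresh "x" in let bx := fresh "bx" in case: (cls_surj p) => x bx ->; clear p end.

Local Ltac clsE := rewrite ?(asymp_addE, asymp_mulE, asymp_oppE, asymp_starE);
  try (congr cls; apply: funext => n); do ?[exact: bnd_cst|apply: bndD|apply: bndM|apply: bndN|apply: bnd_star|by []].

Lemma asymp_addA : associative asymp_add.
Proof. move=> p q r; reps; clsE; exact: addrA. Qed.
Lemma asymp_addC : commutative asymp_add.
Proof. move=> p q; reps; clsE; exact: addrC. Qed.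
Lemma asymp_add0 : left_id (cls (fun=> 0)) asymp_add.
Proof. move=> p; reps; clsE; exact: add0r. Qed.
Lemma asymp_addN : left_inverse (cls (fun=> 0)) asymp_opp asymp_add.
Proof. move=> p; reps; clsE; exact: addNr. Qed.

HB.instance Definition _ := GRing.isZmodule.Build asymp
  asymp_addA asymp_addC asymp_add0 asymp_addN.

Lemma asymp_mulA : associative asymp_mul.
Proof. move=> p q r; reps; clsE; exact: mulrA. Qed.
Lemma asymp_mul1l : left_id (cls (fun=> 1)) asymp_mul.
Proof. move=> p; reps; clsE; exact: mul1r. Qed.
Lemma asymp_mulr1 : right_id (cls (fun=> 1)) asymp_mul.
Proof. move=> p; reps; clsE; exact: mulr1. Qed.
Lemma asymp_mulDl : left_distributive asymp_mul asymp_add.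
Proof. move=> p q r; reps; clsE; exact: mulrDl. Qed.
Lemma asymp_mulDr : right_distributive asymp_mul asymp_add.
Proof. move=> p q r; reps; clsE; exact: mulrDr. Qed.

HB.instance Definition _ := GRing.Zmodule_isPzRing.Build asymp
  asymp_mulA asymp_mul1l asymp_mulr1 asymp_mulDl asymp_mulDr.

Lemma asymp_starK : involutive asymp_star.
Proof. move=> p; reps; clsE; exact: starK. Qed.
Lemma asymp_starD : {morph asymp_star : p q / p + q}.
Proof.
move=> p q; rewrite -![(_ + _)%R]/(asymp_add _ _); reps; clsE; exact: starD.
Qed.
Lemma asymp_starM (p q : asymp) : asymp_star (p * q) = asymp_star q * asymp_star p.
Proof.
rewrite -![(_ * _)%R]/(asymp_mul _ _); reps; clsE; exact: starM.
Qed.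

HB.instance Definition _ := PzRing_isStar.Build asymp asymp_starK asymp_starD asymp_starM.

Lemma clsD x y : abnd x -> abnd y -> cls (fun n => x n + y n) = cls x + cls y.
Proof. by move=> bx by_; rewrite -asymp_addE. Qed.

Lemma clsN x : abnd x -> cls (fun n => - x n) = - cls x.
Proof. by move=> bx; rewrite -asymp_oppE. Qed.

Lemma clsB x y : abnd x -> abnd y -> cls (fun n => x n - y n) = cls x - cls y.
Proof. by move=> bx by_; rewrite clsD ?clsN //; exact: bndN. Qed.

Lemma clsM x y : abnd x -> abnd y -> cls (fun n => x n * y n) = cls x * cls y.
Proof. by move=> bx by_; rewrite -asymp_mulE. Qed.

Lemma cls_star x : abnd x -> cls (fun n => star (x n)) = star (cls x).
Proof. by move=> bx; rewrite -asymp_starE. Qed.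

Lemma clsX x k : abnd x -> cls (fun n => x n ^+ k) = cls x ^+ k.
Proof.
move=> bx; elim: k => [|k IH]; first by [].
rewrite exprS -IH -clsM //; last exact: bndX.
by congr cls; apply: funext => n; rewrite exprS.
Qed.

Lemma cls_sum I (r : seq I) (F : I -> nat -> A) :
  (forall i, abnd (F i)) -> cls (fun n => \sum_(i <- r) F i n) = \sum_(i <- r) cls (F i).
Proof.
move=> bF; elim: r => [|i r IH].
  by rewrite big_nil; congr cls; apply: funext => n; rewrite big_nil.
rewrite big_cons -IH -clsD //; last exact: bnd_sum.
by congr cls; apply: funext => n; rewrite big_cons.
Qed.

(** The bridge between identities in [asymp A] and estimates along sequences; [asymp A] is used as a
    star ring only and carries no norm. *)
Lemma cls_eqP x y : abnd x -> abnd y -> (cls x = cls y <-> aclose x y).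
Proof. by move=> bx by_; split; [exact: cls_inj|exact: cls_eq]. Qed.

Definition acst (a : A) := cls (fun=> a).

Lemma acstD a b : acst (a + b) = acst a + acst b.
Proof. by rewrite /acst -clsD //; exact: bnd_cst. Qed.
Lemma acstN a : acst (- a) = - acst a.
Proof. by rewrite /acst -clsN //; exact: bnd_cst. Qed.
Lemma acstB a b : acst (a - b) = acst a - acst b.
Proof. by rewrite acstD acstN. Qed.
Lemma acstM a b : acst (a * b) = acst a * acst b.
Proof. by rewrite /acst -clsM //; exact: bnd_cst. Qed.
Lemma acst1 : acst 1 = 1. Proof. by []. Qed.
Lemma acst0 : acst 0 = 0. Proof. by []. Qed.
Lemma acst_star a : acst (star a) = star (acst a).
Proof. by rewrite /acst -cls_star //; exact: bnd_cst. Qed.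
Lemma acstX a k : acst (a ^+ k) = acst a ^+ k.
Proof. by rewrite /acst -clsX //; exact: bnd_cst. Qed.
Lemma acst_sum I (r : seq I) (P : pred I) (F : I -> A) :
  acst (\sum_(i <- r | P i) F i) = \sum_(i <- r | P i) acst (F i).
Proof. exact: (big_morph acst acstD acst0). Qed.

Lemma acst_sc_comm (t : R) (p : asymp) : p * acst (sc t) = acst (sc t) * p.
Proof.
have [x bx ->] := cls_surj p; rewrite /acst -!clsM //; try exact: bnd_cst.
by congr cls; apply: funext => n; exact: sc_comm.
Qed.

Lemma cls_commute x a : abnd x ->
  null (fun n => cnorm (x n * a - a * x n)) -> cls x * acst a = acst a * cls x.
Proof.
move=> bx xa; rewrite /acst -!clsM //; try exact: bnd_cst.
by apply: cls_eq => //; apply: bndM => //; exact: bnd_cst.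
Qed.

Lemma cls_null x : abnd x -> cls x = 0 -> null (fun n => cnorm (x n)).
Proof.
move=> bx /(cls_inj bx (bnd_cst 0)); apply: null_eq => n; by rewrite subr0.
Qed.

End AsymptoticAlgebra.

(** * Lifting order zero systems from the sequence algebra *)

Section Lift.
Variables (R : realType) (A : cstarAlgType R).

(** [G] is the function of [a] that falls linearly from 1 at 0 to 0 at [t], so that [1 - G] is
    [min (a / t, 1)]. *)
Lemma low_cut (a : A) (t : R) : psd a -> 0 < t ->
  let G := t^-1%:C *: pospart (sc t - a) in
  [/\ psd G, psd (1 - G) & psd (t^-1%:C *: a - (1 - G))].
Proof.
move=> pa t0 G; have sx : star (sc t - a) = sc t - a by rewrite starB star_alg psd_sa.
have t1 : 0 <= t^-1 by rewrite invr_ge0 ltW.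
have tt : 1 = t^-1%:C *: sc t :> A.
  by rewrite scalerA -rmorphM mulVf ?gt_eqF // scale1r.
split; first by apply: psdZ => //; exact: pospart_psd.
  rewrite tt -scalerBr; apply: psdZ => //; apply: psd_scB; first exact: pospart_sa.
  by apply: negpart_norm => //; exact: ltW.
rewrite tt -scalerBr -scalerBr; apply: psdZ => //.
have -> : a - (sc t - pospart (sc t - a)) = pospart (sc t - a) - (sc t - a) by ncring.
exact: pospart_ge.
Qed.

(** For [q = 1 - G] one has [q ^ 2 <= q <= v v^* / t], whence [||q w|| ^ 2 <= ||v^* w|| ^ 2 / t]. So
    a vector almost orthogonal to [v] hardly changes when cut by [G]. *)
Lemma low_cut_norm (v w : A) (t : R) : 0 < t -> cnorm (star v * w) <= t ->
  cnorm ((1 - t^-1%:C *: pospart (sc t - v * star v)) * w) ^+ 2 <= cnorm (star v * w).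
Proof.
move=> t0 vw; have [pG p1G p2] := low_cut (psd_mul_star v) t0.
set G := _ *: _ in pG p1G p2 *; set q := 1 - G in p1G p2 *.
have sq := psd_sa p1G.
have h1 : cnorm (star (q * w) * (q * w)) <= cnorm (star w * q * w).
  apply: psd_cnorm_le; first exact: psd_star_mul.
  have -> : star w * q * w - star (q * w) * (q * w) = star w * (q * (1 - q)) * w.
    by rewrite starM sq; ncring.
  apply: psd_conj_star; apply: psd_mul => //; last by ncring.
  by rewrite /q opprB addrCA subrr addr0.
have h2 : cnorm (star w * q * w) <= cnorm (star w * (t^-1%:C *: (v * star v)) * w).
  apply: psd_cnorm_le; first exact: psd_conj_star.
  have -> : star w * (t^-1%:C *: (v * star v)) * w - star w * q * w =
    star w * (t^-1%:C *: (v * star v) - q) * w by ncring.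
  exact: psd_conj_star.
have h3 : cnorm (star w * (t^-1%:C *: (v * star v)) * w) = t^-1 * cnorm (star v * w) ^+ 2.
  rewrite -scalerAr -scalerAl cnormZr ger0_norm ?invr_ge0 ?ltW // -cnorm_star.
  by rewrite starM starK; congr (_ * cnorm _); ncring.
rewrite -cnorm_star; apply: le_trans h1 (le_trans h2 _); rewrite h3 expr2 mulrA.
apply: ler_piMl; first exact: cnorm_ge0.
by rewrite mulrC ler_pdivrMr // mul1r.
Qed.

Lemma scaler_mid (k : R[i]) (x y z w : A) : x * y * (k *: z * w) = k *: (x * (y * z) * w).
Proof. by rewrite -scalerAl -scalerAr !mulrA. Qed.

Lemma collect_root (T : pzRingType) (a p b D q : T) : D * D = q -> D * q = q * D ->
  a * p * D * (q * q) * (D * (p * b)) = a * (p * q * q * q * p) * b.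
Proof.
move=> DD Dq.
have -> : a * p * D * (q * q) * (D * (p * b)) = a * p * (D * q) * q * D * p * b by ncring.
rewrite Dq; have -> : a * p * (q * D) * q * D * p * b = a * p * q * (D * q) * D * p * b by ncring.
rewrite Dq; have -> : a * p * q * (q * D) * D * p * b = a * p * q * q * (D * D) * p * b by ncring.
by rewrite DD; ncring.
Qed.

Lemma collect_powers (T : pzRingType) (p : T) :
  p ^+ 2 * p ^+ 6 * p ^+ 6 * p ^+ 6 * p ^+ 2 = p ^+ 22.
Proof. by rewrite -!exprD. Qed.

Lemma null_sqr (r : nat -> R) : (forall n, 0 <= r n) -> null (fun n => r n ^+ 2) -> null r.
Proof.
move=> r0 H e e0; have [N HN] := H (e ^+ 2) (exprn_gt0 2 e0).
exists N => n /HN; rewrite ltr_pXn2r // nnegrE //; exact: ltW.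
Qed.

(** The first vector is multiplied by [(v_0^* v_0 - d)_+] and the others by a function of
    [v_0 v_0^*] supported below [d]; moved across [v_0], these two functions have product 0, which
    is exact orthogonality. As [d] tends to 0 the first cut tends to [v_0^* v_0] and not to 1, hence
    the form of the classes. The last clause lets the induction carry the orthogonality to [v_0]
    through the later cuts. *)
Lemma orthogonalize k (v : nat -> nat -> A) : (forall j, abnd (v j)) ->
  (forall i j, (i < k)%N -> (j < k)%N -> i != j -> star (cls (v i)) * cls (v j) = 0) ->
  exists x : nat -> nat -> A, [/\ forall j, abnd (x j),
    forall i j N, (i < k)%N -> (j < k)%N -> i != j -> star (x i N) * x j N = 0,
    forall j, (j < k)%N -> cls (x j) = cls (v j) * (star (cls (v j)) * cls (v j)) &
    forall N z, (forall j, (j < k)%N -> z * v j N = 0) -> forall j, (j < k)%N -> z * x j N = 0].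
Proof.
elim: k v => [|k IH] v bv vv.
  by exists v; split.
pose d N : R := \sum_(j < k) cnorm (star (v 0%N N) * v j.+1 N) + N.+1%:R^-1.
have N0 N : 0 < N.+1%:R^-1 :> R by rewrite invr_gt0.
have d0 N : 0 < d N.
  by apply: ltr_wpDl => //; apply: sumr_ge0 => j _; exact: cnorm_ge0.
have dn : null d.
  apply: nullD (@null_inv R); apply: null_sum => j; apply: cls_null.
    by apply: bndM => //; exact: bnd_star.
  rewrite clsM ?cls_star //; last exact: bnd_star.
  by apply: vv => //; exact: ltn_ord.
have dv j N : (j < k)%N -> cnorm (star (v 0%N N) * v j.+1 N) <= d N.
  move=> jk; rewrite /d (bigD1 (Ordinal jk)) //= -addrA lerDl addr_ge0 ?(ltW (N0 N)) //.
  by apply: sumr_ge0 => i _; exact: cnorm_ge0.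
pose G N := (d N)^-1%:C *: pospart (sc (d N) - v 0%N N * star (v 0%N N)).
have sD N : star (sc (d N) - v 0%N N * star (v 0%N N)) = sc (d N) - v 0%N N * star (v 0%N N).
  by rewrite starB star_alg starM starK.
have G1 N : cnorm (G N) <= 1.
  have [pG p1G _] := low_cut (psd_mul_star (v 0%N N)) (d0 N).
  by apply: psd_norm => //; rewrite scale1r.
pose v' j N := G N * v j.+1 N.
have bv' j : abnd (v' j) by apply: bndM => //; exact: bnd_le1.
have v'E j : (j < k)%N -> cls (v' j) = cls (v j.+1).
  move=> jk; apply: cls_eq => //; apply: null_sqr => [N|]; first exact: cnorm_ge0.
  apply: null_le dn _ => N; apply: le_trans (dv j N jk).
  rewrite cnorm_distC; have -> : v j.+1 N - v' j N = (1 - G N) * v j.+1 N by rewrite /v'; ncring.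
  exact: low_cut_norm (d0 N) (dv j N jk).
have [|x [bx xx xE xz]] := IH v' bv'.
  by move=> i j ik jk ij; rewrite !v'E //; apply: vv.
pose b N := star (v 0%N N) * v 0%N N; have pb N : psd (b N) := psd_star_mul _.
have sb N : star (b N - sc (d N)) = b N - sc (d N) by apply: sa_subsc; exact: psd_sa.
pose c N := pospart (b N - sc (d N)); have sc' N : star (c N) = c N by exact: pospart_sa.
have zx N j : (j < k)%N -> star (v 0%N N * c N) * x j N = 0.
  move=> jk; apply: (xz N) => // i ik; rewrite starM sc' /v' /G scaler_mid.
  rewrite (pospart_intertwine (z := sc (d N) - b N)) //.
  - have -> : sc (d N) - b N = - (b N - sc (d N)) by ncring.
    by rewrite mulrA pospart_orth // !mul0r scaler0.
  - by rewrite starB star_alg psd_sa.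
  - by rewrite mulrBr mulrBl sc_comm /b mulrA.
have bc : abnd c.
  apply: (@bnd_close _ _ b); first by apply: bndM => //; exact: bnd_star.
  apply: null_le dn _ => N; rewrite cnorm_distC.
  by apply: pospart_subsc_dist => //; exact: ltW.
exists (fun j => if j is i.+1 then x i else fun N => v 0%N N * c N); split.
- by case=> [|j] //; exact: bndM.
- move=> [|i] [|j] N //= ik jk ij; last by apply: xx.
    exact: zx.
  by rewrite -[LHS]starK starM starK zx // star0.
- case=> [_|j jk]; last by rewrite xE // !v'E.
  have bsv : abnd (fun N => star (v 0%N N)) by exact: bnd_star.
  rewrite clsM // -cls_star //; congr (_ * _); rewrite -clsM //.
  apply: cls_eq => //; first by apply: bndM => //; exact: bnd_star.
  by apply: null_le dn _ => N; apply: pospart_subsc_dist => //; exact: ltW.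
- move=> N z zv [|j] jk; first by rewrite mulrA zv // mul0r.
  apply: xz => // i ik; rewrite /v' /G mulrA -scalerAr.
  rewrite (pospart_intertwine (z := sc (d N))) //; last 2 first.
  - exact: star_alg.
  - by rewrite mulrBr mulrA zv // mul0r subr0 sc_comm.
  rewrite pospart_id; last by apply: psd_sc; exact: ltW.
  by rewrite -scalerAl -mulrA zv // mulr0 scaler0.
Qed.

(* The exponent is the price of orthogonalizing the rows one after another. *)
Lemma oz_lift n (F : 'I_n.+1 -> 'I_n.+1 -> asymp A) : oz F ->
  exists g : nat -> 'I_n.+1 -> 'I_n.+1 -> A, [/\ forall N, oz (g N), forall i j, abnd (fun N => g N i j) &
    forall i j, cls (fun N => oz1 (g N) * g N i j) = oz1 F ^+ 23 * F i j].
Proof.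
move=> hF; pose v j := aseq (F (inord j) ord0).
have bv j : abnd (v j) by exact: aseq_bnd.
have vE (i : 'I_n.+1) : cls (v i) = F i ord0.
  by rewrite /v inord_val; apply: asymp_eq; apply: cls_close; exact: aseq_bnd.
have [|x [bx xx xE _]] := @orthogonalize n.+1 v bv.
  move=> i j ik jk ij; have Ei := vE (Ordinal ik); have Ej := vE (Ordinal jk).
  by rewrite /= in Ei Ej; rewrite Ei Ej (oz_star hF) (oz_orth hF).
pose h := F ord0 ord0; have sh : star h = h by exact: oz_star.
(* In row 0, [v_i^* v_i = F_0i F_i0 = h ^ 2] for every [i]. *)
have xhE (i : 'I_n.+1) : cls (x i) = F i ord0 * h ^+ 2.
  by rewrite xE // vE (oz_star hF) (oz_mul hF).
pose b (i : 'I_n.+1) N := star (x i N) * x i N.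
have bb i : abnd (b i) by apply: bndM => //; exact: bnd_star.
have bE i : cls (b i) = h ^+ 6.
  rewrite clsM ?cls_star //; last exact: bnd_star.
  rewrite xhE starM starX sh (oz_star hF) -mulrA [F _ _ * (_ * _)]mulrA (oz_mul hF) -/h.
  by rewrite -expr2 -!exprD.
have pb i N : psd (b i N) := psd_star_mul _.
pose d N : R := \sum_i cnorm (b i N - b ord0 N) + N.+1%:R^-1.
have N0 N : 0 < N.+1%:R^-1 :> R by rewrite invr_gt0.
have d0 N : 0 < d N.
  by apply: ltr_wpDl => //; apply: sumr_ge0 => j _; exact: cnorm_ge0.
have dn : null d.
  by apply: nullD (@null_inv R); apply: null_sum => j; apply/cls_eqP => //; rewrite !bE.
have dv j N : cnorm (b j N - b ord0 N) <= d N.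
  rewrite /d (bigD1 j) //= -addrA lerDl addr_ge0 ?(ltW (N0 N)) //.
  by apply: sumr_ge0 => i _; exact: cnorm_ge0.
(* All [b i N] are within [d N] of [b ord0 N], so they dominate [b ord0 N - d N]; this single [c]
   can serve as the modulus for all rows. *)
pose c (N : nat) : A := pospart (b ord0 N - sc (d N)).
have sb N : star (b ord0 N - sc (d N)) = b ord0 N - sc (d N) by apply: sa_subsc; exact: psd_sa.
have pc N : psd (c N) by exact: pospart_psd.
have cn : aclose c (b ord0).
  by apply: null_le dn _ => N; apply: pospart_subsc_dist => //; exact: ltW.
have bc : abnd c by exact: (@bnd_close _ _ (b ord0) c (bb ord0) (aclose_sym cn)).
have cE : cls c = h ^+ 6 by rewrite -(bE ord0); apply: cls_eq.
pose r N := csqrt (c N); have sr N : star (r N) = r N by exact: csqrt_sa.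
have rr N : r N * r N = c N by exact: csqrtE.
have br : abnd r.
  have [M cM] := bc; exists (M + 1) => N; have := cM N; rewrite -rr cnorm_sa_sqr // expr2.
  have := cnorm_ge0 (r N); move: (cnorm (r N)) => s; nra.
have key (i : 'I_n.+1) N : star (x i N * r N) * (x i N * r N) - c N * c N = r N * (b i N - b ord0 N + sc (d N)) * r N.
  rewrite starM sr; have -> : r N * star (x i N) * (x i N * r N) = r N * b i N * r N by rewrite /b; ncring.
  rewrite -(pospart_mul (sb N)) -/(c N).
  have -> : r N * (b i N - b ord0 N + sc (d N)) * r N = r N * b i N * r N -
     r N * (b ord0 N - sc (d N)) * r N by ncring.
  congr (_ - _); rewrite -csqrt_comm //; last exact: pospart_comm.
  by rewrite -mulrA rr.
have kp (i : 'I_n.+1) N : psd (star (x i N * r N) * (x i N * r N) - c N * c N).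
  rewrite key; apply: psd_conj_sa => //.
  have -> : b i N - b ord0 N + sc (d N) = sc (d N) - (b ord0 N - b i N) by ncring.
  apply: psd_scB; first by rewrite starB !psd_sa.
  by rewrite cnorm_distC.
(* Polar decomposition replaces [x_i r] by a nearby [s_i] whose modulus is exactly [c], the same for
   all [i]; the second clause preserves orthogonality of the ranges. The products [s_i s_j^*] then
   form an exact system. *)
have /choice[W HW] : forall p : 'I_n.+1 * nat, exists w, [/\ star w * w = c p.2 * c p.2,
    (forall z, z * (x p.1 p.2 * r p.2) = 0 -> z * w = 0) &
    forall t, 0 < t -> cnorm (star (x p.1 p.2 * r p.2) * (x p.1 p.2 * r p.2) - c p.2 * c p.2) <= t ^+ 2 ->
       cnorm (w - x p.1 p.2 * r p.2) <= t].
  by move=> [i N]; exact: polar_lift.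
pose s (i : 'I_n.+1) (N : nat) : A := W (i, N).
have ss (i : 'I_n.+1) N : star (s i N) * s i N = c N * c N by case: (HW (i, N)).
have so (i j : 'I_n.+1) N : i != j -> star (s i N) * s j N = 0.
  move=> ij; have ji : j != i by rewrite eq_sym.
  have xs0 : star (x j N) * s i N = 0.
    by case: (HW (i, N)) => _ H _; apply: H; rewrite mulrA xx ?mul0r ?ltn_ord.
  case: (HW (j, N)) => _ H _; apply: H => /=.
  by rewrite mulrA -[star _ * x j N]starK starM starK xs0 star0 mul0r.
have sx (i : 'I_n.+1) : aclose (s i) (fun N => x i N * r N).
  have [M cM] := bc; have M0 : 0 <= M := le_trans (cnorm_ge0 _) (cM 0%N).
  move=> e e0; have e2 : 0 < e / 2 by lra.
  have [N1 HN1] := nullMl (2 * M) dn (fun N => ltW (d0 N)) (exprn_gt0 2 e2).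
  exists N1 => N NN; case: (HW (i, N)) => _ _ /(_ _ e2) /= H.
  apply: le_lt_trans (H _) _; last by lra.
  apply: le_trans (ltW (HN1 N NN)); rewrite key.
  have h1 : cnorm (b i N - b ord0 N + sc (d N)) <= 2 * d N.
    apply: le_trans (cnormD _ _) _; rewrite cnorm_alg ger0_norm ?(ltW (d0 N)) //.
    by have := dv i N; lra.
  have h2 : cnorm (r N) * cnorm (r N) <= M by rewrite -expr2 -cnorm_sa_sqr // rr.
  apply: le_trans (cnormM_le (cnormM_le (lexx _) h1) (lexx _)) _.
  by have := d0 N; have := cnorm_ge0 (r N); move: (cnorm (r N)) h2 (d N) => a h2 t; nra.
have bs (i : 'I_n.+1) : abnd (s i) by apply: bnd_close (aclose_sym (sx i)); exact: bndM.
have sE (i : 'I_n.+1) : cls (s i) = F i ord0 * h ^+ 2 * cls r.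
  by rewrite -xhE -clsM //; apply: cls_eq => //; exact: bndM.
have rE : cls r * cls r = h ^+ 6.
  by rewrite -clsM // -cE; congr cls; apply: funext => N; exact: rr.
have srE : star (cls r) = cls r.
  by rewrite -cls_star //; congr cls; apply: funext => N; exact: sr.
pose g (N : nat) (i j : 'I_n.+1) : A := s i N * star (s j N).
have hg N : oz (g N).
  split=> [i j|i j k l jk|i j l].
  - by rewrite starM starK.
  - by rewrite /g mulrA -(mulrA (s i N)) so // mulr0 mul0r.
  - rewrite /g !mulrA -(mulrA _ (star (s j N))) -(mulrA _ (star (s l N))) !ss.
    by [].
exists g; split=> [//|i j|i j].
  by apply: bndM => //; exact: bnd_star.
(* The exponents: [s_i] contributes [h ^ 2 r] and [s_j^*] contributes [r h ^ 2], with
   [r ^ 2 = h ^ 6] and [c ^ 2 = h ^ 12], so [F_i0 h ^ 22 F_0j]; multiplying [F_i0] by [F_0j] yields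
   one more factor [oz1 F]. *)
transitivity (cls (fun N => s i N * (c N * c N) * star (s j N))).
  congr cls; apply: funext => N; rewrite oz1_mul // -(ss j) /g; ncring.
have bst : abnd (fun N => star (s j N)) by exact: bnd_star.
have bcc : abnd (fun N => c N * c N) by exact: bndM.
rewrite clsM //; last exact: bndM.
rewrite [cls (fun N => s i N * (c N * c N))]clsM // clsM // cls_star // !sE cE.
rewrite [star (_ * cls r)]starM [star (F _ _ * _)]starM srE starX sh (oz_star hF).
have r2 : GRing.comm (cls r) (h ^+ 6) by rewrite -rE /GRing.comm mulrA.
transitivity (F i ord0 * h ^+ 22 * F ord0 j).
  by rewrite -collect_powers; exact: (collect_root (F i ord0) (h ^+ 2) (F ord0 j) rE r2).
have Fh m k : F k ord0 * h ^+ m = oz1 F ^+ m * F k ord0.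
  elim: m => [|m IH]; first by rewrite !expr0 mulr1 mul1r.
  by rewrite exprSr mulrA IH -mulrA -oz1_mul // mulrA -exprSr.
apply: etrans (congr1 (fun t => t * F ord0 j) (Fh 22%N i)) _.
apply: etrans (esym (mulrA _ _ _)) _.
apply: etrans (congr1 (fun t => oz1 F ^+ 22 * t) (oz_mul hF i ord0 j)) _.
apply: etrans (congr1 (fun t => oz1 F ^+ 22 * t) (esym (oz1_mul hF i j))) _.
apply: etrans (mulrA _ _ _) _.
exact: (congr1 (fun t => t * F i j) (esym (exprSr (oz1 F) 22))).
Qed.

End Lift.

(** * Crossed products *)

Section SubCstar.
Variables (R : realType) (B : cstarAlgType R).

Record csub := Csub {
  csub_mem : B -> Prop;
  csub_lim : forall x l, (forall n : nat, csub_mem (x n)) -> cvgs x l -> csub_mem l;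
  csub_one : csub_mem 1;
  csub_lin : forall (c : R[i]) x y, csub_mem x -> csub_mem y -> csub_mem (c *: x + y);
  csub_mul : forall x y, csub_mem x -> csub_mem y -> csub_mem (x * y);
  csub_star : forall x, csub_mem x -> csub_mem (star x)
}.

Variable S : csub.

Definition csub_pred : {pred B} := fun x => `[<csub_mem S x>].

Lemma csub_subalg : subalg_closed csub_pred.
Proof.
split=> [|c x y /asboolP Sx /asboolP Sy|x y /asboolP Sx /asboolP Sy]; apply/asboolP.
- exact: csub_one.
- exact: csub_lin.
- exact: csub_mul.
Qed.

HB.instance Definition _ := GRing.isSubalgClosed.Build R[i] B csub_pred csub_subalg.

Record csubT := CsubT { csub_val :> B; csub_valP : csub_val \in csub_pred }.

HB.instance Definition _ := [isSub of csubT for csub_val].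
HB.instance Definition _ := [Choice of csubT by <:].
HB.instance Definition _ := [SubChoice_isSubAlgebra of csubT by <:].

Lemma csubT_mem (x : csubT) : csub_mem S x.
Proof. exact/asboolP/csub_valP. Qed.

Definition csubT_of x (Sx : csub_mem S x) : csubT := CsubT (asboolT Sx).

Definition csubT_star (x : csubT) : csubT := csubT_of (csub_star (csubT_mem x)).

Lemma csubT_starK : involutive csubT_star.
Proof. by move=> x; apply: val_inj; exact: starK. Qed.
Lemma csubT_starD : {morph csubT_star : x y / x + y}.
Proof. by move=> x y; apply: val_inj; exact: starD. Qed.
Lemma csubT_starM (x y : csubT) : csubT_star (x * y) = csubT_star y * csubT_star x.
Proof. by apply: val_inj; exact: starM. Qed.

HB.instance Definition _ := PzRing_isStar.Build csubT csubT_starK csubT_starD csubT_starM.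

Definition csubT_norm (x : csubT) : R := cnorm (csub_val x).

Lemma csubT_norm0 x : csubT_norm x = 0 -> x = 0.
Proof. by move=> x0; apply: val_inj; exact: cnorm0_eq0. Qed.
Lemma csubT_normD (x y : csubT) : csubT_norm (x + y) <= csubT_norm x + csubT_norm y.
Proof. exact: cnormD. Qed.
Lemma csubT_normZ (c : R[i]) (x : csubT) :
  csubT_norm (c *: x) = ComplexField.Normc.normc c * csubT_norm x.
Proof. exact: cnormZ. Qed.
Lemma csubT_normM (x y : csubT) : csubT_norm (x * y) <= csubT_norm x * csubT_norm y.
Proof. exact: cnormM. Qed.
Lemma csubT_complete (x : nat -> csubT) :
  (forall eps : R, 0 < eps -> exists N : nat, forall m n : nat,
     (N <= m)%N -> (N <= n)%N -> csubT_norm (x m - x n) < eps) ->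
  exists l : csubT, csubT_norm (x n - l) @[n --> \oo] --> (0 : R).
Proof.
move=> /(@cnorm_complete R B (fun n => csub_val (x n))) [l xl].
have Sl : csub_mem S l.
  by apply: (csub_lim (x := fun n => csub_val (x n))) => [n|]; [exact: csubT_mem|exact/cvgsP].
by exists (csubT_of Sl).
Qed.
Lemma csubT_starZ (c : R[i]) (x : csubT) : csubT_star (c *: x) = conjc c *: csubT_star x.
Proof. by apply: val_inj; exact: starZ. Qed.
Lemma csubT_norm_star (x : csubT) : csubT_norm (csubT_star x * x) = csubT_norm x ^+ 2.
Proof. exact: cnorm_star. Qed.

HB.instance Definition _ := isCstarAlgebra.Build R csubT csubT_norm0 csubT_normD csubT_normZ
  csubT_normM csubT_complete csubT_starZ csubT_norm_star.

End SubCstar.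

Section CrossedProduct.
Variables (R : realType) (A : cstarAlgType R) (alpha : A -> A) (B : cstarAlgType R)
  (iota : A -> B) (u : B).
Hypothesis alpha_aut : star_automorphism alpha.
Hypothesis B_crossed : crossed_product alpha iota u.

Lemma cp_iota : star_hom iota. Proof. by case: B_crossed => -[]. Qed.
Lemma cp_unitary : unitary u. Proof. by case: B_crossed => -[]. Qed.
Lemma cp_conj a : u * iota a * star u = iota (alpha a). Proof. by case: B_crossed => -[]. Qed.
Lemma cp_su_u : star u * u = 1. Proof. by case: cp_unitary. Qed.
Lemma cp_u_su : u * star u = 1. Proof. by case: cp_unitary. Qed.

Lemma cp_uniq (D : cstarAlgType R) (f g : B -> D) : star_hom f -> star_hom g ->
  (forall a, f (iota a) = g (iota a)) -> f u = g u -> f =1 g.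
Proof.
move=> hf hg fg fgu; have ci := cp_iota.
have cov : covariant alpha (fun a => g (iota a)) (g u).
  split.
  - split.
    + by move=> c x y; rewrite shD // shZ // shD // shZ.
    + by split=> [|x y]; rewrite ?(sh1 ci) ?(sh1 hg) // !shM.
    + by move=> x; rewrite !sh_star.
  - by split; rewrite -sh_star // -shM // ?cp_su_u ?cp_u_su sh1.
  - by move=> a; rewrite -sh_star // -!shM // cp_conj.
case: B_crossed => _ /(_ D _ _ cov) [h [_ huniq]].
by move=> x; rewrite -(huniq f) // -(huniq g).
Qed.

(* The C*-subalgebra generated by [iota A] and [u] receives a homomorphism from [B] by
   universality, which composed with the inclusion is the identity by uniqueness. *)
Lemma cp_generated (S : csub B) : (forall a, csub_mem S (iota a)) -> csub_mem S u ->
  forall x, csub_mem S x.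
Proof.
move=> Si Su; have ci := cp_iota; pose D : cstarAlgType R := csubT S.
pose pi a : D := csubT_of (Si a); pose v : D := csubT_of Su.
have cov : covariant alpha pi v.
  split.
  - split.
    + by move=> c x y; apply: val_inj; rewrite /= shD // shZ.
    + by split=> [|x y]; apply: val_inj; rewrite /= ?sh1 ?shM.
    + by move=> x; apply: val_inj; rewrite /= sh_star.
  - by split; apply: val_inj; rewrite /= ?cp_su_u ?cp_u_su.
  - by move=> a; apply: val_inj; rewrite /= cp_conj.
case: B_crossed => _ /(_ D _ _ cov) [rho [[hrho rhoi rhou] _]].
have hinc : star_hom (fun x => csub_val (rho x)).
  by split=> [c x y||x]; [rewrite shD // shZ|split=> [|x y]; rewrite ?sh1 ?shM|rewrite sh_star].
have hid : star_hom (@id B) by split.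
have := cp_uniq hinc hid; rewrite /= => H x.
rewrite -[x]H; first exact: csubT_mem.
  by move=> a; rewrite rhoi.
by rewrite rhou.
Qed.

Lemma cp_u_comm a : u * iota a = iota (alpha a) * u.
Proof. by rewrite -cp_conj -mulrA cp_su_u mulr1. Qed.

Lemma cp_uX_comm k a : u ^+ k * iota a = iota (iter k alpha a) * u ^+ k.
Proof.
elim: k => [|k IH]; first by rewrite !expr0 mul1r mulr1.
by rewrite exprS -mulrA IH mulrA cp_u_comm iterS mulrA.
Qed.

Lemma cp_suX_uX k : star u ^+ k * u ^+ k = 1.
Proof.
elim: k => [|k IH]; first by rewrite !expr0 mul1r.
by rewrite exprSr exprS mulrA -(mulrA _ (star u)) cp_su_u mulr1.
Qed.

Lemma cp_uX_suX k : u ^+ k * star u ^+ k = 1.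
Proof.
elim: k => [|k IH]; first by rewrite !expr0 mul1r.
by rewrite exprSr exprS mulrA -(mulrA _ u) cp_u_su mulr1.
Qed.

Lemma cp_suX_comm k a : iota a * star u ^+ k = star u ^+ k * iota (iter k alpha a).
Proof.
rewrite -[LHS]mul1r -(cp_suX_uX k) -!mulrA; congr (_ * _).
by rewrite mulrA cp_uX_comm -mulrA cp_uX_suX mulr1.
Qed.

(** The monomial of degree [m.2 - m.1.1], with natural exponents on both sides instead of one
    integer exponent. Those of degree 0 lie in [iota A], as [alpha] is onto. *)
Definition mono (m : nat * A * nat) : B := star u ^+ m.1.1 * iota m.1.2 * u ^+ m.2.

Definition peval (s : seq (nat * A * nat)) : B := \sum_(m <- s) mono m.

Definition pdiag (s : seq (nat * A * nat)) : B := \sum_(m <- s | m.1.1 == m.2) mono m.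

Lemma monoM m m' : exists m'', mono m * mono m' = mono m''.
Proof.
case: m m' => [[i a] j] [[k b] l]; rewrite /mono /=; have ci := cp_iota.
case: (leqP k j) => [kj|/ltnW jk].
  exists (i, a * iter (j - k) alpha b, (j - k + l)%N) => /=.
  have uj : u ^+ j = u ^+ (j - k) * u ^+ k by rewrite -exprD subnK.
  have -> : star u ^+ i * iota a * u ^+ j * (star u ^+ k * iota b * u ^+ l) =
    star u ^+ i * iota a * (u ^+ (j - k) * (u ^+ k * star u ^+ k) * iota b) * u ^+ l.
    by rewrite uj; ncring.
  by rewrite cp_uX_suX mulr1 cp_uX_comm (shM ci) exprD; ncring.
exists ((i + (k - j))%N, iter (k - j) alpha a * b, l) => /=.
have uk : star u ^+ k = star u ^+ j * star u ^+ (k - j) by rewrite -exprD subnKC.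
have -> : star u ^+ i * iota a * u ^+ j * (star u ^+ k * iota b * u ^+ l) =
  star u ^+ i * (iota a * (u ^+ j * star u ^+ j) * star u ^+ (k - j)) * iota b * u ^+ l.
  by rewrite uk; ncring.
by rewrite cp_uX_suX mulr1 cp_suX_comm (shM ci) exprD; ncring.
Qed.

Lemma mono_star m : star (mono m) = mono (m.2, star m.1.2, m.1.1).
Proof.
case: m => [[i a] j]; rewrite /mono /= !starM !starX starK.
by rewrite (sh_star cp_iota) mulrA.
Qed.

Lemma monoZ (c : R[i]) m : c *: mono m = mono (m.1.1, c *: m.1.2, m.2).
Proof. by rewrite /mono /= (shZ cp_iota) -scalerAr -scalerAl. Qed.

Lemma pevalD s t : peval s + peval t = peval (s ++ t).
Proof. by rewrite /peval big_cat. Qed.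

Lemma pevalM s t : exists r, peval s * peval t = peval r.
Proof.
elim: s => [|m s [r IH]]; first by exists [::]; rewrite /peval big_nil mul0r.
have [q qE] : exists q, mono m * peval t = peval q.
  elim: t {IH} => [|m' t [q IH]]; first by exists [::]; rewrite /peval big_nil mulr0.
  have [m'' m''E] := monoM m m'; exists (m'' :: q).
  by rewrite /peval !big_cons mulrDr m''E -!/(peval _) IH.
exists (q ++ r); rewrite -pevalD -IH -qE -mulrDl.
by rewrite /peval big_cons.
Qed.

Lemma peval_star s : star (peval s) = peval [seq (m.2, star m.1.2, m.1.1) | m <- s].
Proof.
by rewrite /peval star_sum big_map; apply: eq_bigr => m _; exact: mono_star.
Qed.

Lemma pevalZ (c : R[i]) s : c *: peval s = peval [seq (m.1.1, c *: m.1.2, m.2) | m <- s].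
Proof.
by rewrite /peval scaler_sumr big_map; apply: eq_bigr => m _; exact: monoZ.
Qed.

(** The elements that can be approximated form a closed star subalgebra containing [iota A] and [u],
    so [cp_generated] applies. *)
Lemma peval_dense x (e : R) : 0 < e -> exists s, cnorm (x - peval s) <= e.
Proof.
pose P x := forall e : R, 0 < e -> exists s, cnorm (x - peval s) <= e.
have exact_ y s : y = peval s -> P y.
  by move=> -> d d0; exists s; rewrite subrr cnorm0 ltW.
have Plim (v : nat -> B) l : (forall n, P (v n)) -> cvgs v l -> P l.
  move=> Pv vl d d0; have d2 : 0 < d / 2 by lra.
  have [n vn] := null_lt vl d2; have [s Hs] := Pv n _ d2; exists s.
  by have := cnorm_triangle (v n) l (peval s); move: vn; rewrite (cnorm_distC (v n) l); lra.
have P1 : P 1.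
  apply: (exact_ _ [:: (0%N, 1, 0%N)]).
  by rewrite /peval big_seq1 /mono /= !expr0 (sh1 cp_iota) !mul1r.
have Plin (c : R[i]) y z : P y -> P z -> P (c *: y + z).
  move=> Py Pz d d0; have d2 : 0 < d / 2 by lra.
  have n0 : 0 < ComplexField.Normc.normc c + 1 by have := nrm_ge0 c; lra.
  have [s Hs] := Py _ (divr_gt0 d2 n0); have [t Ht] := Pz _ d2.
  exists ([seq (m.1.1, c *: m.1.2, m.2) | m <- s] ++ t).
  rewrite -pevalD -pevalZ opprD addrACA -scalerBr.
  apply: le_trans (cnormD _ _) _; rewrite cnormZ.
  suff : ComplexField.Normc.normc c * cnorm (y - peval s) <= d / 2 by lra.
  move: Hs; rewrite ler_pdivlMr //; have := cnorm_ge0 (y - peval s); have := nrm_ge0 c.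
  by move: (ComplexField.Normc.normc c) (cnorm _) => p q; nra.
have Pmul y z : P y -> P z -> P (y * z).
  move=> Py Pz d d0; have d2 : 0 < d / 2 by lra.
  have z1 : 0 < cnorm z + 1 by have := cnorm_ge0 z; lra.
  have [s Hs] := Py _ (divr_gt0 d2 z1).
  have s1 : 0 < cnorm (peval s) + 1 by have := cnorm_ge0 (peval s); lra.
  have [t Ht] := Pz _ (divr_gt0 d2 s1).
  have [r rE] := pevalM s t; exists r; rewrite -rE.
  have -> : y * z - peval s * peval t = (y - peval s) * z + peval s * (z - peval t) by ncring.
  apply: le_trans (cnormD _ _) _.
  have h1 := cnormM (y - peval s) z; have h2 := cnormM (peval s) (z - peval t).
  move: Hs Ht; rewrite !ler_pdivlMr //.
  have := cnorm_ge0 (y - peval s); have := cnorm_ge0 (z - peval t).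
  by nra.
have Pstar y : P y -> P (star y).
  move=> Py d d0; have [s Hs] := Py _ d0.
  exists [seq (m.2, star m.1.2, m.1.1) | m <- s].
  by rewrite -peval_star -starB cnorm_starE.
have := @cp_generated (Csub Plim P1 Plin Pmul Pstar); apply => /=.
  move=> a; apply: (exact_ _ [:: (0%N, a, 0%N)]).
  by rewrite /peval big_seq1 /mono /= !expr0 !mul1r mulr1.
apply: (exact_ _ [:: (0%N, 1, 1%N)]).
by rewrite /peval big_seq1 /mono /= !expr0 (sh1 cp_iota) !mul1r expr1.
Qed.

Lemma cp_gauge (z : R[i]) : conjc z * z = 1 -> exists f : B -> B,
  [/\ star_hom f, forall a, f (iota a) = iota a & f u = z *: u].
Proof.
move=> zz; have cov : covariant alpha iota (z *: u).
  split; first exact: cp_iota.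
    have zz' : z * conjc z = 1 by rewrite mulrC.
    by split; rewrite starZ -scalerAl -scalerAr scalerA ?zz ?zz' scale1r ?cp_su_u ?cp_u_su.
  move=> a; rewrite starZ -scalerAl -scalerAl -scalerAr scalerA mulrC zz scale1r.
  exact: cp_conj.
by case: B_crossed => _ /(_ B _ _ cov) [f [Hf _]]; exists f.
Qed.

Lemma gauge_mono (z : R[i]) (f : B -> B) m : star_hom f ->
  (forall a, f (iota a) = iota a) -> f u = z *: u ->
  f (mono m) = (conjc z ^+ m.1.1 * z ^+ m.2) *: mono m.
Proof.
move=> hf fi fu; rewrite /mono !(shM hf) !(shX hf) (sh_star hf) fi fu starZ.
by rewrite !exprZn -scalerAl -scalerAl -scalerAr scalerA.
Qed.

Lemma alpha_surj k a : exists b, iter k alpha b = a.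
Proof.
have [g gK Kg] := proj2 alpha_aut; elim: k a => [|k IH] a; first by exists a.
by have [b bE] := IH (g a); exists b; rewrite iterS bE.
Qed.

Lemma mono_diag m : m.1.1 == m.2 -> exists b, mono m = iota b.
Proof.
case: m => [[i a] j] /= /eqP <-; have [b bE] := alpha_surj i a.
by exists b; rewrite /mono /= -bE -cp_suX_comm -mulrA cp_suX_uX mulr1.
Qed.

Lemma pdiag_iota s : exists b, pdiag s = iota b.
Proof.
elim: s => [|m s [b bE]]; first by exists 0; rewrite /pdiag big_nil (sh0 cp_iota).
rewrite /pdiag big_cons; case: ifP => [/mono_diag[c cE]|_]; last by exists b.
by exists (c + b); rewrite cE -/(pdiag s) bE (shD cp_iota).
Qed.

End CrossedProduct.

(** * Roots of unity and the coefficients of the Fejer kernel *)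

Section RootsOfUnity.
Variable R : realType.
Local Notation nrm := (@ComplexField.Normc.normc R).

Definition order2 m := (2 ^ m.+1)%N.

(** Powers of two are convenient because any [2 ^ m]-th root of -1 has exact order [2 ^ m.+1]. *)
Definition zeta m : R[i] := (2 ^ m).-root (-1).

Lemma zeta_half m : zeta m ^+ (2 ^ m) = -1.
Proof. by rewrite rootCK // expn_gt0. Qed.

Lemma zeta_order m : zeta m ^+ order2 m = 1.
Proof. by rewrite /order2 expnSr exprM zeta_half sqrrN expr1n. Qed.

Lemma nrmX (z : R[i]) k : nrm (z ^+ k) = nrm z ^+ k.
Proof.
by elim: k => [|k IH]; rewrite ?expr0 ?ComplexField.Normc.normc1 // !exprS nrmM IH.
Qed.

Lemma nrm_zeta m : nrm (zeta m) = 1.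
Proof.
apply/eqP; rewrite -(@pexpr_eq1 _ _ (order2 m)) ?expn_gt0 ?nrm_ge0 //.
by rewrite -nrmX zeta_order ComplexField.Normc.normc1.
Qed.

Lemma zeta_unit m : conjc (zeta m) * zeta m = 1.
Proof. by rewrite -nrm_sqr nrm_zeta expr1n. Qed.

Lemma zeta_neq1 m k : (0 < k < order2 m)%N -> zeta m ^+ k != 1.
Proof.
case/andP=> k0 kN; apply/negP => /eqP zk.
have [d dprim dk] := prim_order_exists k0 zk.
have : (d %| order2 m)%N by rewrite (prim_order_dvd dprim) zeta_order.
rewrite /order2 => /(dvdn_pfactor _ _ (isT : prime 2))[j jm dE].
case: (leqP j m) => [jm'|mj].
  have : zeta m ^+ (2 ^ m) = 1.
    by apply/eqP; rewrite -(prim_order_dvd dprim) dE dvdn_exp2l.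
  rewrite zeta_half => /eqP; rewrite eq_sym -subr_eq0 opprK -(natrD _ 1 1).
  by rewrite pnatr_eq0.
have jE : j = m.+1 by apply/eqP; rewrite eqn_leq jm.
by have := dvdn_leq k0 dk; rewrite dE jE leqNgt kN.
Qed.

Lemma zeta_orth m a b : (a < order2 m)%N -> (b < order2 m)%N ->
  \sum_(t < order2 m) conjc (zeta m ^+ t) ^+ a * (zeta m ^+ t) ^+ b =
  if a == b then (order2 m)%:R else 0.
Proof.
move=> am bm; pose q := conjc (zeta m) ^+ a * zeta m ^+ b.
have termE t : conjc (zeta m ^+ t) ^+ a * (zeta m ^+ t) ^+ b = q ^+ t.
  by rewrite rmorphXn /= /q exprMn -!exprM (mulnC a) (mulnC b).
rewrite (eq_bigr (fun t : 'I_(order2 m) => q ^+ t)) => [|t _]; last exact: termE.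
case: eqP => [ab|/eqP ab].
  rewrite (eq_bigr (fun=> 1)) => [|t _].
    by rewrite sumr_const card_ord.
  by rewrite /q ab -exprMn zeta_unit !expr1n.
have qN : q ^+ order2 m = 1.
  rewrite exprMn -!exprM (mulnC a) (mulnC b) !exprM -rmorphXn /= zeta_order.
  by rewrite conjc1 !expr1n mulr1.
have q1 : q != 1.
  apply/negP => /eqP q1.
  have h c d : (c < d)%N -> (d < order2 m)%N -> zeta m ^+ c = zeta m ^+ d -> False.
    move=> cd dm cdE; have /negP[] : zeta m ^+ (d - c) != 1.
      by apply: zeta_neq1; rewrite subn_gt0 cd (leq_ltn_trans (leq_subr _ _) dm).
    apply/eqP; rewrite -[LHS]mul1r -(expr1n _ c) -(zeta_unit m) exprMn -mulrA -exprD.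
    by rewrite subnKC ?(ltnW cd) // -cdE -exprMn zeta_unit expr1n.
  have E : zeta m ^+ b = zeta m ^+ a.
    have : zeta m ^+ a * q = zeta m ^+ b.
      by rewrite /q mulrA -exprMn mulrC [zeta m * _]mulrC zeta_unit expr1n mulr1.
    by rewrite q1 mulr1.
  by case: (ltngtP a b) ab => // [ab|ba] _; [apply: (h a b)|apply: (h b a)].
have := subrX1 q (order2 m); rewrite qN subrr => /eqP; rewrite eq_sym mulf_eq0.
by rewrite subr_eq0 (negPf q1) /= => /eqP.
Qed.

End RootsOfUnity.

Section FejerCount.

(** [K] times the coefficient of degree [j - i] of the Fejer kernel of order [K]. *)
Definition diag_count K i j := (\sum_(l < K) \sum_(k < K) (l + i == k + j))%N.

Lemma count_lt K j : (\sum_(l < K) (l < j) <= j)%N.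
Proof.
suff : (\sum_(l < K) (l < j) <= minn K j)%N by move/leq_trans; apply; exact: geq_minr.
elim: K => [|K IH]; first by rewrite big_ord0.
rewrite big_ord_recr /=; apply: leq_trans (leq_add IH (leqnn _)) _; lia.
Qed.

Lemma count_ge K i : (\sum_(l < K) (K <= l + i) <= i)%N.
Proof.
apply: leq_trans (count_lt K i); rewrite (reindex_inj rev_ord_inj) /=.
apply: leq_sum => l _ /=; have := ltn_ord l; move: (nat_of_ord l) => k kK.
by case: (leqP K (K - k.+1 + i)); case: (ltnP k i); lia.
Qed.

Lemma diag_count_le K i j : (diag_count K i j <= K)%N.
Proof.
rewrite /diag_count -[leqRHS]card_ord -sum1_card; apply: leq_sum => l _.
case: (boolP [exists k : 'I_K, l + i == k + j]%N) => [/existsP[k /eqP kE]|].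
  rewrite (bigD1 k) //= kE eqxx big1 // => k' k'k; apply/eqP; rewrite eqb0 eqn_add2r eq_sym.
  exact: k'k.
rewrite negb_exists => /forallP H; rewrite big1 // => k _.
by apply/eqP; rewrite eqb0; exact: H.
Qed.

Lemma diag_count_ge K i j : (K <= diag_count K i j + (i + j))%N.
Proof.
have h1 := count_lt K j; have h2 := count_ge K i.
have : (\sum_(l < K) 1 <= \sum_(l < K) (\sum_(k < K) (l + i == k + j) + ((l < j) + (K <= l + i))))%N.
  apply: leq_sum => l _; case: (ltnP l j) => [|jl]; first by lia.
  case: (leqP K (l + i)) => [|lK]; first by lia.
  have kK : (l + i - j < K)%N by lia.
  rewrite (bigD1 (Ordinal kK)) //=; have -> : (l + i == l + i - j + j)%N by apply/eqP; lia.
  by lia.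
rewrite sum1_card card_ord big_split big_split /= -/(diag_count K i j) => /leq_trans; apply.
by rewrite leq_add2l [leqRHS]addnC leq_add.
Qed.

End FejerCount.

(** * The conditional expectation onto [iota A] and its faithfulness *)

Section Expectation.
Variables (R : realType) (A : cstarAlgType R) (alpha : A -> A) (B : cstarAlgType R)
  (iota : A -> B) (u : B).
Hypothesis alpha_aut : star_automorphism alpha.
Hypothesis B_crossed : crossed_product alpha iota u.
Hypothesis iota_inj : injective iota.
Local Notation nrm := (@ComplexField.Normc.normc R).
Local Notation mono := (mono iota u).
Local Notation peval := (peval iota u).
Local Notation pdiag := (pdiag iota u).
Local Notation N m := (order2 m).
Let ci := cp_iota B_crossed.

Lemma gauge_exists : exists f : nat -> nat -> B -> B, forall m t,
  [/\ star_hom (f m t), forall a, f m t (iota a) = iota a & f m t u = (zeta R m ^+ t) *: u].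
Proof.
have /choice[g Hg] : forall p : nat * nat, exists f : B -> B,
    [/\ star_hom f, forall a, f (iota a) = iota a & f u = (zeta R p.1 ^+ p.2) *: u].
  move=> [m t]; apply: (cp_gauge B_crossed).
  by rewrite /= rmorphXn /= -exprMn zeta_unit expr1n.
by exists (fun m t => g (m, t)) => m t; exact: (Hg (m, t)).
Qed.

Definition gauge := projT1 (cid gauge_exists).

Lemma gaugeP m t : [/\ star_hom (gauge m t), forall a, gauge m t (iota a) = iota a
  & gauge m t u = (zeta R m ^+ t) *: u].
Proof. exact: projT2 (cid gauge_exists) m t. Qed.

Lemma gauge_hom m t : star_hom (gauge m t). Proof. by case: (gaugeP m t). Qed.

Lemma gauge_monoE m t p : gauge m t (mono p) =
  (conjc (zeta R m ^+ t) ^+ p.1.1 * (zeta R m ^+ t) ^+ p.2) *: mono p.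
Proof. by case: (gaugeP m t) => h1 h2 h3; exact: gauge_mono h1 h2 h3. Qed.

(** A weighted mean over the gauge action, with the circle replaced by a finite group of roots of
    unity. Constant weight 1 approximates the conditional expectation, Fejer weights approximate the
    identity; on polynomials of small degree no discretization error occurs. *)
Definition wav m (w : nat -> R) x : B :=
  ((N m)%:R^-1)%:C *: \sum_(t < N m) (w t)%:C *: gauge m t x.

Lemma wavB m (w : nat -> R) x y : wav m w (x - y) = wav m w x - wav m w y.
Proof.
rewrite /wav -scalerBr -sumrB; congr (_ *: _); apply: eq_bigr => t _.
by rewrite (shB (gauge_hom m t)) scalerBr.
Qed.

Lemma wav_norm m (w : nat -> R) x : (forall t, 0 <= w t) -> \sum_(t < N m) w t = (N m)%:R ->
  cnorm (wav m w x) <= cnorm x.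
Proof.
move=> w0 wN; have N0 : 0 < (N m)%:R :> R by rewrite ltr0n expn_gt0.
rewrite cnormZr ger0_norm ?invr_ge0 ?ler0n // ler_pdivrMl //.
apply: le_trans (cnorm_sum _ _ _) _; rewrite -wN mulr_suml; apply: ler_sum => t _.
rewrite cnormZr ger0_norm //; apply: ler_wpM2l => //; exact: sh_norm (gauge_hom m t) x.
Qed.

Lemma wav_psd m (w : nat -> R) x : (forall t, 0 <= w t) -> psd x -> psd (wav m w x).
Proof.
move=> w0 px; apply: psdZ; first by rewrite invr_ge0 ler0n.
by apply: psd_sum => t _; apply: psdZ => //; exact: sh_psd (gauge_hom m t) _ px.
Qed.

Lemma wav_le m (w : nat -> R) (K : R) x : (forall t, 0 <= w t <= K) -> psd x ->
  cnorm (wav m w x) <= K * cnorm (wav m (fun=> 1) x).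
Proof.
move=> wK px; have K0 : 0 <= K by have /andP[h1 h2] := wK 0%N; exact: le_trans h1 h2.
rewrite -[K in leRHS]ger0_norm // -cnormZr; apply: psd_cnorm_le.
  by apply: wav_psd => // t; have /andP[] := wK t.
rewrite /wav scalerA mulrC -scalerA -scalerBr; apply: psdZ; first by rewrite invr_ge0 ler0n.
rewrite scaler_sumr -sumrB; apply: psd_sum => t _.
rewrite rmorph1 scale1r -scalerBl -rmorphB; apply: psdZ; last exact: sh_psd (gauge_hom m t) _ px.
by rewrite subr_ge0; have /andP[] := wK t.
Qed.

Lemma wav_mono m (w : nat -> R) p : wav m w (mono p) =
  (((N m)%:R^-1)%:C * \sum_(t < N m) (w t)%:C *
    (conjc (zeta R m ^+ t) ^+ p.1.1 * (zeta R m ^+ t) ^+ p.2)) *: mono p.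
Proof.
rewrite -scalerA scaler_suml /wav; congr (_ *: _); apply: eq_bigr => t _.
by rewrite gauge_monoE scalerA.
Qed.

Lemma wav_sum m (w : nat -> R) (s : seq (nat * A * nat)) :
  wav m w (peval s) = \sum_(p <- s) wav m w (mono p).
Proof.
rewrite /peval /wav -scaler_sumr exchange_big; congr (_ *: _); apply: eq_bigr => t _ /=.
by rewrite (sh_sum (gauge_hom m t)) scaler_sumr.
Qed.

Definition pdeg (s : seq (nat * A * nat)) := (\max_(p <- s) (p.1.1 + p.2))%N.

Lemma pdeg_mem s p : p \in s -> (p.1.1 + p.2 <= pdeg s)%N.
Proof. by move=> ps; rewrite /pdeg (big_rem p ps) leq_maxl. Qed.

Definition Eav m := wav m (fun=> 1).

Lemma NinvK m : ((N m)%:R^-1 : R)%:C * (N m)%:R = 1.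
Proof.
rewrite -(rmorph_nat (@real_complex R)) -rmorphM mulVf ?rmorph1 //.
by rewrite pnatr_eq0 -lt0n expn_gt0.
Qed.

Lemma Eav_mono m p : (p.1.1 + p.2 < N m)%N -> Eav m (mono p) = if p.1.1 == p.2 then mono p else 0.
Proof.
move=> pN; rewrite /Eav wav_mono.
under eq_bigr => t _ do rewrite rmorph1 mul1r.
rewrite zeta_orth; last 2 first.
- exact: leq_ltn_trans (leq_addr _ _) pN.
- exact: leq_ltn_trans (leq_addl _ _) pN.
by case: eqP => _; rewrite ?NinvK ?scale1r ?mulr0 ?scale0r.
Qed.

Lemma Eav_peval m s : (pdeg s < N m)%N -> Eav m (peval s) = pdiag s.
Proof.
move=> sN; rewrite /Eav wav_sum /pdiag [RHS]big_mkcond /=.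
rewrite big_seq_cond [RHS]big_seq_cond; apply: eq_bigr => p /andP[ps _].
by apply: Eav_mono; apply: leq_ltn_trans (pdeg_mem ps) sN.
Qed.

Lemma Eav_norm m x : cnorm (Eav m x) <= cnorm x.
Proof. by apply: wav_norm => //; rewrite sumr_const card_ord. Qed.

Lemma order2_large k : exists M : nat, forall m, (M <= m)%N -> (k < N m)%N.
Proof.
exists k => m km; apply: leq_ltn_trans km _; rewrite /order2.
by apply: leq_trans (ltn_expl m (ltnSn 1)) _; rewrite leq_exp2l.
Qed.

(** As soon as the order of the root exceeds the degree, the mean of a polynomial equals its
    diagonal part, an element of [iota A]. These parts form a Cauchy sequence, whose limit is found
    in [A] because [iota] is isometric. *)
Lemma cp_expect x : exists c, cvgs (fun m => Eav m x) (iota c) /\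
  forall d : R, 0 < d -> exists s, cnorm (x - peval s) <= d /\ cnorm (iota c - pdiag s) <= d.
Proof.
have e0 k : 0 < k.+1%:R^-1 :> R by rewrite invr_gt0.
have /choice[s Hs] : forall k : nat, exists s, cnorm (x - peval s) <= k.+1%:R^-1.
  by move=> k; exact: (peval_dense B_crossed).
have /choice[c Hc] : forall k : nat, exists b, pdiag (s k) = iota b.
  by move=> k; exact: (pdiag_iota alpha_aut B_crossed).
have Edist k m : (pdeg (s k) < N m)%N -> cnorm (Eav m x - iota (c k)) <= k.+1%:R^-1.
  by move=> km; rewrite -Hc -(Eav_peval km) -wavB; apply: le_trans (Eav_norm _ _) (Hs k).
have [l cl] : exists l, cvgs c l.
  apply: (@cauchy_cvgs R A c (fun k => 2 * k.+1%:R^-1)).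
    by apply: nullMl (@null_inv R) _ => k; exact: ltW.
  move=> i j ji; rewrite -(sh_isometry ci iota_inj) (shB ci).
  suff : cnorm (iota (c i) - iota (c j)) <= 2 * j.+1%:R^-1 by [].
  have [M1 H1] := order2_large (pdeg (s i)); have [M2 H2] := order2_large (pdeg (s j)).
  have := Edist i _ (H1 _ (leq_maxl M1 M2)); have := Edist j _ (H2 _ (leq_maxr M1 M2)).
  have ij : i.+1%:R^-1 <= j.+1%:R^-1 :> R by rewrite lef_pV2 ?posrE // ler_nat.
  have := cnorm_triangle (Eav (maxn M1 M2) x) (iota (c i)) (iota (c j)).
  rewrite (cnorm_distC (iota (c i)) (Eav _ _)) => h1 h2 h3; apply: le_trans h1 _.
  by rewrite mulr_natl mulr2n; apply: lerD => //; exact: le_trans h3 ij.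
have cli : cvgs (fun k => iota (c k)) (iota l) by exact: (sh_cvgs ci).
have small (d : R) : 0 < d -> exists k, k.+1%:R^-1 <= d /\ cnorm (iota (c k) - iota l) <= d.
  move=> d0; have [N1 H1] := @null_inv R d d0; have [N2 H2] := cli d d0.
  by exists (maxn N1 N2); split; apply: ltW; [apply: H1; exact: leq_maxl|apply: H2; exact: leq_maxr].
exists l; split=> [d d0|d d0].
  have d4 : 0 < d / 4 by lra.
  have [k [k1 k2]] := small _ d4; have [M HM] := order2_large (pdeg (s k)).
  exists M => m /HM /Edist H; have {}H := le_trans H k1.
  suff : cnorm (Eav m x - iota l) < d by [].
  by have := cnorm_triangle (iota (c k)) (Eav m x) (iota l); lra.
have [k [k1 k2]] := small _ d0; exists (s k); split; first exact: le_trans (Hs k) k1.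
by rewrite Hc cnorm_distC.
Qed.

Definition fejer K m t : R := K%:R^-1 * nrm (\sum_(l < K) zeta R m ^+ t ^+ l) ^+ 2.

Lemma fejer_itv K m t : (0 < K)%N -> 0 <= fejer K m t <= K%:R.
Proof.
move=> K0; have K0' : 0 < K%:R :> R by rewrite ltr0n.
apply/andP; split; first by rewrite mulr_ge0 ?invr_ge0 ?sqr_ge0 ?ler0n.
rewrite /fejer ler_pdivrMl // -expr2 ler_pXn2r ?nnegrE ?nrm_ge0 ?ler0n //.
apply: le_trans (nrm_sum _ _ _) _.
rewrite (eq_bigr (fun=> 1)) => [|l _]; first by rewrite sumr_const card_ord.
by rewrite !nrmX nrm_zeta !expr1n.
Qed.

Lemma fejerC K m t : (fejer K m t)%:C =
  (K%:R^-1)%:C * \sum_(l < K) \sum_(k < K) conjc (zeta R m ^+ t) ^+ l * (zeta R m ^+ t) ^+ k.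
Proof.
rewrite /fejer rmorphM /= nrm_sqr rmorph_sum /= mulr_suml; congr (_ * _).
apply: eq_bigr => l _; rewrite mulr_sumr; apply: eq_bigr => k _.
by rewrite rmorphXn.
Qed.

Lemma fejer_coef K m i j : (K + i + j < N m)%N ->
  ((N m)%:R^-1)%:C * \sum_(t < N m) (fejer K m t)%:C *
     (conjc (zeta R m ^+ t) ^+ i * (zeta R m ^+ t) ^+ j) =
  (K%:R^-1 * (diag_count K i j)%:R)%:C.
Proof.
move=> KN; transitivity (((N m)%:R^-1)%:C * ((K%:R^-1)%:C * \sum_(l < K) \sum_(k < K)
   \sum_(t < N m) conjc (zeta R m ^+ t) ^+ (l + i) * (zeta R m ^+ t) ^+ (k + j))).
  congr (_ * _).
  under eq_bigr => t _ do rewrite fejerC -mulrA.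
  rewrite -mulr_sumr; congr (_ * _).
  under eq_bigr => t _ do rewrite mulr_suml.
  rewrite exchange_big; apply: eq_bigr => l _ /=.
  under eq_bigr => t _ do rewrite mulr_suml.
  rewrite exchange_big; apply: eq_bigr => k _ /=.
  by apply: eq_bigr => t _; rewrite !exprD; ring.
rewrite mulrCA rmorphM; congr (_ * _).
under eq_bigr => l _.
  under eq_bigr => k _.
    rewrite zeta_orth; last 2 first.
    - by have := ltn_ord l; lia.
    - by have := ltn_ord k; lia.
    rewrite -mulrb; over.
  over.
rewrite /= rmorph_nat /diag_count natr_sum mulr_sumr; apply: eq_bigr => l _.
rewrite natr_sum mulr_sumr; apply: eq_bigr => k _.
by case: eqP => _; rewrite ?mulr1n ?mulr0n ?mulr0 ?NinvK.
Qed.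

Lemma fejer_sum K m : (0 < K)%N -> (K < N m)%N -> \sum_(t < N m) fejer K m t = (N m)%:R.
Proof.
move=> K0 KN; have := @fejer_coef K m 0 0; rewrite !addn0 => /(_ KN) H.
have cK : diag_count K 0 0 = K.
  by apply/eqP; rewrite eqn_leq diag_count_le; have := diag_count_ge K 0 0; rewrite !addn0.
apply: (@complexI R); rewrite rmorph_sum rmorph_nat /=.
have HE : \sum_(t < N m) (fejer K m t)%:C * (conjc (zeta R m ^+ t) ^+ 0 * (zeta R m ^+ t) ^+ 0) =
    \sum_(t < N m) (fejer K m t)%:C by apply: eq_bigr => t _; rewrite !expr0 !mulr1.
have K1 : K%:R^-1 * K%:R = 1 :> R by rewrite mulVf // pnatr_eq0 -lt0n.
move: H; rewrite HE cK K1 rmorph1 => H.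
set Sf := \sum_(t < _) _ in H *.
transitivity ((N m)%:R * (((N m)%:R^-1)%:C * Sf)); last by rewrite H mulr1.
by rewrite mulrA [_ * (_)%:C]mulrC NinvK mul1r.
Qed.

Lemma fejer_mono K m p : (0 < K)%N -> (K + p.1.1 + p.2 < N m)%N ->
  cnorm (wav m (fejer K m) (mono p) - mono p) <= K%:R^-1 * ((p.1.1 + p.2)%:R * cnorm (mono p)).
Proof.
move=> K0 KN; rewrite wav_mono fejer_coef //.
have K0' : 0 < K%:R :> R by rewrite ltr0n.
set c := diag_count _ _ _; set d := (p.1.1 + p.2)%N.
have c1 : (c <= K)%N := diag_count_le _ _ _; have c2 : (K <= c + d)%N := diag_count_ge _ _ _.
rewrite -{2}[mono p]scale1r -scalerBl -(rmorph1 (@real_complex R)) -rmorphB cnormZr mulrA.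
apply: ler_wpM2r; first exact: cnorm_ge0.
have -> : K%:R^-1 * c%:R - 1 = - (K%:R^-1 * (K%:R - c%:R)) :> R.
  by rewrite mulrBr mulVf ?gt_eqF // opprB.
have c1' : c%:R <= K%:R :> R by rewrite ler_nat.
have c2' : K%:R <= c%:R + d%:R :> R by rewrite -natrD ler_nat.
rewrite normrN ger0_norm; last by rewrite mulr_ge0 ?invr_ge0 ?ler0n ?subr_ge0.
by rewrite ler_pM2l ?invr_gt0 //; lra.
Qed.

Lemma fejer_approx s (e : R) : 0 < e -> exists K, (0 < K)%N /\
  forall m, (K + pdeg s < N m)%N -> cnorm (wav m (fejer K m) (peval s) - peval s) <= e.
Proof.
move=> e0; pose C := \sum_(p <- s) (p.1.1 + p.2)%:R * cnorm (mono p).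
have C0 : 0 <= C by apply: sumr_ge0 => p _; rewrite mulr_ge0 ?ler0n ?cnorm_ge0.
pose K := (Num.bound (C / e)).+1; exists K; split=> // m KN.
have CK : K%:R^-1 * C <= e.
  rewrite ler_pdivrMl ?ltr0n // mulrC -ler_pdivrMl // mulrC.
  have : C / e < (Num.bound (C / e))%:R by apply: archi_boundP; apply: divr_ge0 => //; exact: ltW.
  move/ltW/le_trans; apply; by rewrite ler_nat.
apply: le_trans CK; rewrite wav_sum -sumrB mulr_sumr.
apply: le_trans (cnorm_sum _ _ _) _; rewrite big_seq_cond [leRHS]big_seq_cond.
apply: ler_sum => p /andP[ps _]; apply: fejer_mono => //.
by apply: leq_ltn_trans KN; rewrite -addnA leq_add2l pdeg_mem.
Qed.

(** The Fejer weights of order [K] lie between 0 and [K], so the Fejer mean of a positive [x] has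
    norm at most [K ||Eav m x||], which tends to 0 in [m]; and up to an error controlled by the
    choice of [s] and [K], [x] equals its Fejer mean. *)
Lemma Eav_faithful x : psd x -> cvgs (fun m => Eav m x) 0 -> x = 0.
Proof.
move=> px Ex; apply: cnorm_le0; apply/ler_addgt0Pr => e e0; rewrite add0r.
have e4 : 0 < e / 4 by lra.
have [s Hs] := peval_dense B_crossed x e4; have [K [K0 HK]] := fejer_approx s e4.
have K0' : 0 < K%:R :> R by rewrite ltr0n.
have [M1 H1] := Ex _ (divr_gt0 e4 K0'); have [M2 H2] := order2_large (K + pdeg s).
pose m := maxn M1 M2; have := H1 m (leq_maxl _ _); rewrite subr0 ltr_pdivlMr // mulrC => E1.
have m2 : (K + pdeg s < N m)%N := H2 m (leq_maxr _ _).
have F1 := HK m m2; have fi t := fejer_itv m t K0.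
have F2 := wav_le m fi px; rewrite -/(Eav m) in F2.
have F3 : cnorm (wav m (fejer K m) (x - peval s)) <= e / 4.
  apply: le_trans Hs; apply: wav_norm => [t|]; first by have /andP[] := fi t.
  by apply: fejer_sum => //; apply: leq_ltn_trans m2; exact: leq_addr.
rewrite wavB in F3.
have := cnorm_triangle (peval s) x 0; rewrite !subr0.
have := cnorm_triangle (wav m (fejer K m) (peval s)) (peval s) 0; rewrite !subr0.
have := cnorm_triangle (wav m (fejer K m) x) (wav m (fejer K m) (peval s)) 0; rewrite !subr0.
rewrite (cnorm_distC (wav _ _ (peval s)) (wav _ _ x)) (cnorm_distC (peval s) (wav _ _ _)).
lra.
Qed.

Lemma cp_expectation x : psd x -> x != 0 -> exists c, [/\ psd c, c != 0 &
  forall d : R, 0 < d -> exists s, cnorm (x - peval s) <= d /\ cnorm (iota c - pdiag s) <= d].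
Proof.
move=> px x0; have [c [Ec Hc]] := cp_expect x; exists c; split=> //.
  apply: (sh_psd_inj ci iota_inj); apply: psd_lim Ec => m.
  exact: wav_psd.
apply/eqP => c0; rewrite c0 (sh0 ci) in Ec.
by move/eqP: x0; apply; exact: Eav_faithful.
Qed.

End Expectation.

(** * Rokhlin towers *)

Lemma eventually_fin (I : finType) (P : I -> nat -> Prop) :
  (forall i, exists N0 : nat, forall n, (N0 <= n)%N -> P i n) ->
  exists N0 : nat, forall n, (N0 <= n)%N -> forall i, P i n.
Proof.
move=> /choice[f Hf]; exists (\max_i f i)%N => n Nn i; apply: Hf.
by apply: leq_trans Nn; exact: leq_bigmax.
Qed.

Section RokhlinLower.
Variables (R : realType) (A : cstarAlgType R).

Lemma cls_sa (x : nat -> A) : abnd x -> (forall n, star (x n) = x n) -> star (cls x) = cls x.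
Proof. by move=> bx sx; rewrite -cls_star //; congr cls; apply: funext. Qed.

Lemma comm_star (T : pzStarRingType) (x y : T) : star x = x -> x * y = y * x ->
  x * star y = star y * x.
Proof. by move=> sx xy; rewrite -{1}sx -starM -xy starM sx. Qed.

(** If [e] asymptotically commutes with the [r_i], then [e ^ 2] is close to
    [sum_i r_i (e c e) r_i^*], so [1] is almost bounded by [K ||e c e||] with
    [K = sum_i ||r_i|| ^ 2]. The bound [t] depends on the [r_i] only and thus serves all floors of
    all towers. *)
Lemma rokhlin_lower M (r : 'I_M -> A) (c : A) : \sum_i r i * c * star (r i) = 1 ->
  exists2 t : R, 0 < t & forall e : nat -> A, (forall n, psd (e n)) -> (forall n, cnorm (e n) = 1) ->
    (forall i, null (fun n => cnorm (e n * r i - r i * e n))) ->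
    exists N0 : nat, forall n, (N0 <= n)%N -> t <= cnorm (e n * c * e n).
Proof.
move=> rE; pose K := \sum_i cnorm (r i) ^+ 2.
have K0 : 0 <= K by apply: sumr_ge0 => i _; exact: sqr_ge0.
have t0 : 0 < (2 * (K + 1))^-1 by rewrite invr_gt0; lra.
exists (2 * (K + 1))^-1 => // e pe e1 er.
have be : abnd e by apply: bnd_le1 => n; rewrite e1.
have sE : star (cls e) = cls e by apply: cls_sa => // n; exact: psd_sa.
have Er i : cls e * acst (r i) = acst (r i) * cls e by apply: cls_commute.
have bece : abnd (fun n => e n * c * e n).
  by apply: bndM => //; apply: bndM => //; exact: bnd_cst.
have brhs : abnd (fun n => \sum_i r i * (e n * c * e n) * star (r i)).
  apply: bnd_sum => i _; apply: bndM; last exact: bnd_cst.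
  by apply: bndM => //; exact: bnd_cst.
have : cls (fun n => e n * e n) = cls (fun n => \sum_i r i * (e n * c * e n) * star (r i)).
  rewrite cls_sum => [|i]; last first.
    apply: bndM; last exact: bnd_cst.
    by apply: bndM => //; exact: bnd_cst.
  rewrite clsM // -[X in X * _]mulr1 -acst1 -rE acst_sum mulr_sumr mulr_suml.
  apply: eq_bigr => i _; rewrite !acstM acst_star.
  rewrite [cls (fun n => r i * (e n * c * e n) * star (r i))]clsM //; last 2 first.
  - by apply: bndM => //; exact: bnd_cst.
  - exact: bnd_cst.
  rewrite clsM //; last exact: bnd_cst.
  rewrite clsM //; last by apply: bndM => //; exact: bnd_cst.
  rewrite clsM //; last exact: bnd_cst.
  rewrite -/(acst (r i)) -/(acst c) -/(acst (star (r i))) acst_star.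
  have Ers := comm_star sE (Er i).
  have -> : cls e * (acst (r i) * acst c * star (acst (r i))) * cls e =
    (cls e * acst (r i)) * acst c * (star (acst (r i)) * cls e) by ncring.
  by rewrite Er -Ers; ncring.
move=> /cls_eqP - /(_ (bndM be be) brhs) H.
have h2 : 0 < 1 / 2 :> R by lra.
have [N0 HN] := H _ h2; exists N0 => n /HN.
have := cnorm_le_dist (e n * e n) (\sum_i r i * (e n * c * e n) * star (r i)).
rewrite cnorm_sa_sqr ?psd_sa // e1 expr1n.
have : cnorm (\sum_i r i * (e n * c * e n) * star (r i)) <= K * cnorm (e n * c * e n).
  apply: le_trans (cnorm_sum _ _ _) _; rewrite mulr_suml; apply: ler_sum => i _.
  rewrite expr2 [leRHS]mulrAC.
  by apply: cnormM_le; [exact: cnormM|rewrite cnorm_starE].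
have w0 := cnorm_ge0 (e n * c * e n); move: (cnorm (e n * c * e n)) w0 => w w0 h1 h3 h4.
rewrite -[_^-1]mul1r ler_pdivrMr; last by lra.
nra.
Qed.

End RokhlinLower.

Section Towers.
Variables (R : realType) (A : cstarAlgType R) (alpha : A -> A).
Hypothesis A_simple : simple_cstar A.
Hypothesis alpha_Rokhlin : generalized_tracial_Rokhlin alpha.

Record tower (k : nat) (e : 'I_k -> nat -> A) (F : seq A) (a : A) : Prop := Tower {
  tower_psd : forall i n, psd (e i n);
  tower_norm : forall i n, cnorm (e i n) = 1;
  tower_orth : forall i j n, i != j -> e i n * e j n = 0;
  tower_small : forall n, cuntz_le (1 - \sum_i e i n) a;
  tower_comm : forall i y, y \in F -> null (fun n => cnorm (e i n * y - y * e i n));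
  tower_shift : forall i j : 'I_k, j = i.+1 :> nat -> null (fun n => cnorm (alpha (e i n) - e j n))
}.

Lemma tower_exists k F a : (0 < k)%N -> psd a -> a != 0 -> exists e : 'I_k -> nat -> A, tower e F a.
Proof.
move=> k0 pa a0; have N0 n : 0 < n.+1%:R^-1 :> R by rewrite invr_gt0.
have /choice[e He] := fun n : nat => @alpha_Rokhlin F n.+1%:R^-1 k a (N0 n) k0
  (proj2 (positiveP a) pa) a0.
exists (fun i n => e n i); split.
- by move=> i n; have [h _ _ _ _] := He n; apply/positiveP; case: (h i).
- by move=> i n; have [h _ _ _ _] := He n; case: (h i).
- by move=> i j n ij; have [_ h _ _ _] := He n; exact: h.
- by move=> n; case: (He n).
- move=> i y yF; apply: null_le (@null_inv R) _ => n.
  by have [_ _ _ h _] := He n; apply: ltW; exact: h.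
- move=> i j ij; apply: null_le (@null_inv R) _ => n.
  by have [_ _ _ _ h] := He n; apply: ltW; exact: h.
Qed.

Lemma tower_bnd k (e : 'I_k -> nat -> A) F a i : tower e F a -> abnd (e i).
Proof. by move=> he; apply: bnd_le1 => n; rewrite (tower_norm he). Qed.

(** The floors of a tower almost commuting with [b] provide orthogonal pieces [c_i = e_i b e_i],
    each of norm at least [t], whose sum [D] is within [t / 2] of a conjugate of [b]. Multiplication
    by [z = (D - t / 2)_+] brings the sum exactly below [b] and is too small a cut to kill any
    piece. *)
Lemma split_positive L b : (0 < L)%N -> psd b -> b != 0 -> exists d : 'I_L -> A,
  [/\ forall i, psd (d i), forall i, d i != 0, forall i j, i != j -> d i * d j = 0
    & cuntz_le (\sum_i d i) b].
Proof.
move=> L0 pb b0; have [M [r rE]] := simple_full A_simple pb b0.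
have [t t0 Ht] := rokhlin_lower rE.
have [e he] := tower_exists (b :: [seq r i | i : 'I_M]) L0 pb b0.
pose c i n := e i n * b * e i n.
have se i n : star (e i n) = e i n by apply: psd_sa; exact: tower_psd he i n.
have pc i n : psd (c i n) by apply: psd_conj_sa.
have be i : abnd (e i) := tower_bnd i he.
have lower : exists N0 : nat, forall n, (N0 <= n)%N -> forall i, t <= cnorm (c i n).
  apply: eventually_fin => i; apply: Ht.
  - exact: tower_psd he i.
  - exact: tower_norm he i.
  - by move=> j; apply: (tower_comm he); rewrite inE fintype.image_f ?orbT.
pose es n := \sum_i e i n.
have bes : abnd es by apply: bnd_sum.
have bc i : abnd (c i) by apply: bndM => //; apply: bndM => //; exact: bnd_cst.
have bD : abnd (fun n => \sum_i c i n) by apply: bnd_sum.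
have beb : abnd (fun n => es n * b * es n).
  by apply: bndM => //; apply: bndM => //; exact: bnd_cst.
have cE i : cls (c i) = cls (e i) * acst b * cls (e i).
  rewrite clsM //; last by apply: bndM => //; exact: bnd_cst.
  by rewrite clsM //; exact: bnd_cst.
have Ecl : cls (fun n => \sum_i c i n) = cls (fun n => es n * b * es n).
  rewrite clsM //; last by apply: bndM => //; exact: bnd_cst.
  rewrite clsM //; last exact: bnd_cst.
  rewrite -/(acst b) !cls_sum // !mulr_suml; apply: eq_bigr => i _.
  rewrite cE mulr_sumr (bigD1 i) //= big1 ?addr0 // => j ji.
  have -> : cls (e i) * acst b = acst b * cls (e i).
    by apply: cls_commute => //; apply: (tower_comm he); rewrite inE eqxx.
  rewrite -mulrA -clsM //; have -> : cls (fun n => e i n * e j n) = 0.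
    rewrite -(acst0 A); congr cls; apply: funext => n; apply: (tower_orth he).
    by rewrite eq_sym.
  by rewrite mulr0.
have [N1 H1] := lower; have t2 : 0 < t / 2 by lra.
have [N2 H2] : exists N2 : nat, forall n, (N2 <= n)%N ->
    cnorm (\sum_i c i n - es n * b * es n) < t / 2.
  by apply: (proj1 (cls_eqP bD beb) Ecl).
pose n := maxn N1 N2; have {}H1 := H1 n (leq_maxl _ _); have {}H2 := H2 n (leq_maxr _ _).
pose D := \sum_i c i n; have pD : psd D by apply: psd_sum.
have cc i j : i != j -> c i n * c j n = 0.
  move=> ij; rewrite /c; have -> : e i n * b * e i n * (e j n * b * e j n) =
     e i n * b * (e i n * e j n) * b * e j n by ncring.
  by rewrite (tower_orth he) // mulr0 !mul0r.
have cD i : c i n * D = c i n * c i n.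
  rewrite /D mulr_sumr (bigD1 i) //= big1 ?addr0 // => j ji.
  by apply: cc; rewrite eq_sym.
have Dc i : D * c i n = c i n * c i n.
  rewrite /D mulr_suml (bigD1 i) //= big1 ?addr0 // => j ji; exact: cc.
have sD : star (D - sc (t / 2)) = D - sc (t / 2) by apply: sa_subsc; exact: psd_sa.
have pz := pospart_psd sD; set z := pospart _ in pz.
have ncz x : x * D = D * x -> x * z = z * x.
  by move=> xD; apply: pospart_comm => //; rewrite mulrBl mulrBr xD sc_comm.
have cz i : c i n * z = z * c i n by apply: ncz; rewrite cD Dc.
exists (fun i => c i n * z); split.
- by move=> i; apply: psd_mul.
(* If [c_i z = 0], then [c_i ^ 2 <= (t / 2) c_i], against [||c_i|| >= t]. *)
- move=> i; apply/eqP => cz0.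
  have p : psd ((t / 2)%:C *: c i n - c i n * c i n).
    have -> : (t / 2)%:C *: c i n - c i n * c i n = c i n * (z - (D - sc (t / 2))).
      by rewrite -cD mulrBr cz0 sub0r mulrBr sc_comm mulr_algl; ncring.
    apply: psd_mul => //; first exact: pospart_ge.
    by rewrite !mulrBr !mulrBl cz cD Dc sc_comm.
  have := psd_cnorm_le (psd_sqr (psd_sa (pc i n))) p.
  rewrite cnorm_sa_sqr ?psd_sa // cnormZr ger0_norm ?(ltW t2) // expr2.
  by have := H1 i; have := cnorm_ge0 (c i n); move: (cnorm (c i n)) => w; nra.
- move=> i j ij; have -> : c i n * z * (c j n * z) = c i n * (z * c j n) * z by ncring.
  by rewrite -cz mulrA cc // !mul0r.
- rewrite -mulr_suml -/D; apply: cuntz_trans (cuntz_mul_comm pD _) _; first exact: (ncz D).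
  have ses : star (es n) = es n by rewrite star_sum; apply: eq_bigr.
  apply: cuntz_trans (cuntz_conj_sa b ses); apply: cuntz_cut; first exact: psd_sa.
    exact: psd_conj_sa.
  exact: ltW.
Qed.

End Towers.

Section LowerBound.
Variables (R : realType) (A : cstarAlgType R) (alpha : A -> A) (B : cstarAlgType R)
  (iota : A -> B) (u : B).
Hypothesis A_simple : simple_cstar A.
Hypothesis alpha_aut : star_automorphism alpha.
Hypothesis alpha_Rokhlin : generalized_tracial_Rokhlin alpha.
Hypothesis B_crossed : crossed_product alpha iota u.
Let ci := cp_iota B_crossed.

Lemma cp_iota_inj : injective iota.
Proof.
suff ker x : iota x = 0 -> x = 0.
  move=> x y xy; apply/eqP; rewrite -subr_eq0; apply/eqP; apply: ker.
  by rewrite (shB ci) xy subrr.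
move=> x0; have [||||H|H] := @A_simple [set a | iota a = 0].
- move=> v l /= v0 /cvgsP vl; apply: cvgs_uniq (sh_cvgs ci vl) _.
  by apply: cvgs_ext (cvgs_cst 0) => n; rewrite v0.
- exact: (sh0 ci).
- by move=> y z /= y0 z0; rewrite (shD ci) y0 z0 addr0.
- by move=> a y /= y0; rewrite !(shM ci) y0 mulr0 mul0r.
- by have : [set a | iota a = 0] x by []; rewrite H.
- have : [set a | iota a = 0] (1 : A) by rewrite H.
  by rewrite /= (sh1 ci) => /eqP; rewrite oner_eq0.
Qed.

Lemma bnd_iota (x : nat -> A) : abnd x -> abnd (fun n => iota (x n)).
Proof. by move=> [M xM]; exists M => n; apply: le_trans (sh_norm ci _) (xM n). Qed.

Section TowerInB.
Variables (k : nat) (e : 'I_k -> nat -> A) (F : seq A) (a : A).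
Hypothesis he : tower alpha e F a.
Local Notation E i := (cls (fun n => iota (e i n))).
Local Notation U := (acst u).

Lemma bnd_towerB i : abnd (fun n => iota (e i n)).
Proof. by apply: bnd_iota; exact: tower_bnd he. Qed.

Lemma towerB_sa i : star (E i) = E i.
Proof.
apply: cls_sa => [|n]; first exact: bnd_towerB.
by rewrite -(sh_star ci) psd_sa //; exact: tower_psd he i n.
Qed.

Lemma towerB_orth i j : i != j -> E i * E j = 0.
Proof.
move=> ij; rewrite -clsM; try exact: bnd_towerB.
rewrite -(acst0 B); congr cls; apply: funext => n.
by rewrite -(shM ci) (tower_orth he) // (sh0 ci).
Qed.

Lemma towerB_comm i y : y \in F -> E i * acst (iota y) = acst (iota y) * E i.
Proof.
move=> yF; apply: cls_commute; first exact: bnd_towerB.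
apply: null_le (tower_comm he i yF) _ => n; rewrite -!(shM ci) -(shB ci).
exact: (sh_norm ci).
Qed.

Lemma acst_uu : star U * U = 1.
Proof. by rewrite -acst_star -acstM (cp_su_u B_crossed). Qed.

Lemma acst_uX_suX m : U ^+ m * star U ^+ m = 1.
Proof. by rewrite -acst_star -!acstX -acstM (cp_uX_suX B_crossed). Qed.

Lemma acst_suX_uX m : star U ^+ m * U ^+ m = 1.
Proof. by rewrite -acst_star -!acstX -acstM (cp_suX_uX B_crossed). Qed.

Lemma towerB_shift (i j : 'I_k) : j = i.+1 :> nat -> U * E i = E j * U.
Proof.
move=> ij; have bi := bnd_towerB i; have bj := bnd_towerB j.
rewrite /acst -!clsM //; try exact: bnd_cst.
apply: cls_eq; [by apply: bndM => //; exact: bnd_cst|by apply: bndM => //; exact: bnd_cst|].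
apply: null_le (tower_shift he ij) _ => n.
rewrite (cp_u_comm B_crossed) -mulrBl -(shB ci) -[leRHS]mulr1.
apply: cnormM_le; first exact: (sh_norm ci).
rewrite -(@ler_pXn2r _ 2) ?nnegrE ?cnorm_ge0 // -cnorm_star (cp_su_u B_crossed).
by rewrite cnorm1 expr1n.
Qed.

Lemma towerB_shiftX m (i j : 'I_k) : j = (i + m)%N :> nat -> U ^+ m * E i = E j * U ^+ m.
Proof.
elim: m j => [|m IH] j ij.
  have -> : j = i by apply: val_inj; rewrite /= ij addn0.
  by rewrite !expr0 mul1r mulr1.
have mk : (i + m < k)%N by have := ltn_ord j; lia.
rewrite exprS -mulrA (IH (Ordinal mk)) // mulrA (@towerB_shift _ j) ?mulrA //=.
by rewrite ij addnS.
Qed.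

End TowerInB.

(** Compression by floor 0 of a high tower removes the monomials of nonzero degree, so it takes [x]
    close to the compression of its expectation [c]. The latter stays in [iota A] and has norm at
    least [t]; cutting it at [t / 2] leaves a nonzero element below [x]. *)
Lemma cp_lower x : psd x -> x != 0 -> exists b, [/\ psd b, b != 0 & cuntz_le (iota b) x].
Proof.
move=> px x0; have [c [pc c0 Hc]] := cp_expectation alpha_aut B_crossed cp_iota_inj px x0.
have [M [r rE]] := simple_full A_simple pc c0.
have [t t0 Ht] := rokhlin_lower rE.
have t8 : 0 < t / 8 by lra.
have [s [xs cs]] := Hc _ t8.
(* High enough that [u ^ i] and [u ^ j], for every monomial of [s], move floor 0 to existing floors
   [i] and [j]; these are orthogonal when [i != j]. *)
pose k := (pdeg s).+1.
pose F := [seq r i | i : 'I_M] ++ [seq p.1.2 | p <- s].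
have [e he] := tower_exists alpha_Rokhlin F (ltn0Sn (pdeg s)) pc c0.
have [N1 H1] : exists N0 : nat, forall n, (N0 <= n)%N -> t <= cnorm (e ord0 n * c * e ord0 n).
  apply: Ht.
  - exact: tower_psd he ord0.
  - exact: tower_norm he ord0.
  - by move=> j; apply: (tower_comm he); rewrite mem_cat fintype.image_f.
pose f n := iota (e ord0 n).
have bf : abnd f := bnd_towerB he ord0.
have cls_sand y : cls (fun n => f n * y * f n) = cls f * acst y * cls f.
  rewrite clsM //; last by apply: bndM => //; exact: bnd_cst.
  by rewrite clsM //; exact: bnd_cst.
have bsand y : abnd (fun n => f n * y * f n).
  by apply: bndM => //; apply: bndM => //; exact: bnd_cst.
have key : cls (fun n => f n * peval iota u s * f n) = cls (fun n => f n * pdiag iota u s * f n).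
  rewrite !cls_sand /peval /pdiag !acst_sum !mulr_sumr !mulr_suml [RHS]big_mkcond /=.
  rewrite big_seq_cond [RHS]big_seq_cond; apply: eq_bigr => p /andP[ps _].
  case: ifP => // /negbT ij; have deg := pdeg_mem ps.
  have ik : (p.1.1 < k)%N by rewrite /k ltnS; apply: leq_trans deg; exact: leq_addr.
  have jk : (p.2 < k)%N by rewrite /k ltnS; apply: leq_trans deg; exact: leq_addl.
  have pF : p.1.2 \in F by rewrite mem_cat (map_f (fun p : nat * A * nat => p.1.2) ps) orbT.
  rewrite /mono !acstM !acstX acst_star.
  have hi := towerB_shiftX he (m := p.1.1) (i := ord0) (j := Ordinal ik) (erefl _).
  have hj := towerB_shiftX he (m := p.2) (i := ord0) (j := Ordinal jk) (erefl _).
  have hi' : cls f * star (acst u) ^+ p.1.1 =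
      star (acst u) ^+ p.1.1 * cls (fun n => iota (e (Ordinal ik) n)).
    have := congr1 star hi; rewrite !starM !starX.
    by rewrite (towerB_sa he ord0) (towerB_sa he (Ordinal ik)).
  have -> : cls f * (star (acst u) ^+ p.1.1 * acst (iota p.1.2) * acst u ^+ p.2) * cls f =
     (cls f * star (acst u) ^+ p.1.1) * acst (iota p.1.2) * (acst u ^+ p.2 * cls f) by ncring.
  rewrite hi' hj.
  set Ei := cls _; set Ej := cls (fun n => iota (e (Ordinal jk) n)).
  have -> : star (acst u) ^+ p.1.1 * Ei * acst (iota p.1.2) * (Ej * acst u ^+ p.2) =
    star (acst u) ^+ p.1.1 * (Ei * acst (iota p.1.2)) * Ej * acst u ^+ p.2 by ncring.
  rewrite (towerB_comm he _ pF).
  have -> : star (acst u) ^+ p.1.1 * (acst (iota p.1.2) * Ei) * Ej * acst u ^+ p.2 =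
    star (acst u) ^+ p.1.1 * acst (iota p.1.2) * (Ei * Ej) * acst u ^+ p.2 by ncring.
  by rewrite (towerB_orth he) ?mulr0 ?mul0r.
have [N2 H2] : exists N2 : nat, forall n, (N2 <= n)%N ->
    cnorm (f n * peval iota u s * f n - f n * pdiag iota u s * f n) < t / 8.
  by apply: (proj1 (cls_eqP (bsand _) (bsand _)) key).
pose n := maxn N1 N2; have {}H1 := H1 n (leq_maxl _ _); have {}H2 := H2 n (leq_maxr _ _).
have se : star (e ord0 n) = e ord0 n by apply: psd_sa; exact: tower_psd he ord0 n.
have sf : star (f n) = f n by rewrite -(sh_star ci) se.
have f1 : cnorm (f n) <= 1 by rewrite -(tower_norm he ord0 n); exact: (sh_norm ci).
have fy y : cnorm (f n * y * f n) <= cnorm y.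
  by rewrite -[leRHS]mulr1 -[X in X * 1]mul1r; apply: cnormM_le => //; apply: cnormM_le.
have pece : psd (e ord0 n * c * e ord0 n) by apply: psd_conj_sa.
have D : cnorm (iota (e ord0 n * c * e ord0 n) - f n * x * f n) <= t / 2.
  rewrite !(shM ci) -/(f n).
  have -> : f n * iota c * f n - f n * x * f n = f n * (iota c - pdiag iota u s) * f n -
    (f n * peval iota u s * f n - f n * pdiag iota u s * f n) - f n * (x - peval iota u s) * f n by ncring.
  have := cnormB (f n * (iota c - pdiag iota u s) * f n -
    (f n * peval iota u s * f n - f n * pdiag iota u s * f n)) (f n * (x - peval iota u s) * f n).
  have := cnormB (f n * (iota c - pdiag iota u s) * f n)
    (f n * peval iota u s * f n - f n * pdiag iota u s * f n).
  have := fy (x - peval iota u s); have := fy (iota c - pdiag iota u s).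
  by lra.
have t2 : 0 <= t / 2 by lra.
exists (pospart (e ord0 n * c * e ord0 n - sc (t / 2))); split.
- by apply: pospart_psd; apply: sa_subsc; exact: psd_sa.
- by apply: pospart_subsc_neq0 => //; lra.
- rewrite (sh_pospart ci) ?(shB ci) ?(sh_sc ci); last by apply: sa_subsc; exact: psd_sa.
  apply: cuntz_trans (cuntz_conj_sa x sf); apply: cuntz_cut => //.
    by rewrite -(sh_star ci) psd_sa.
  exact: psd_conj_sa.
Qed.

End LowerBound.

(** * Matrix units over a tower *)

Section Amplify.
Variables (T : pzStarRingType).

Lemma oz_reindex (I J : finType) (h : I -> J) (f : J -> J -> T) : injective h -> oz f ->
  oz (fun i j => f (h i) (h j)).
Proof.
move=> ih hf; split => [i j|i j k l jk|i j l].
- exact: oz_star.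
- by apply: (oz_orth hf); apply: contra jk => /eqP/ih ->.
- exact: oz_mul.
Qed.

(** The units [e_ij (x) 1] of the tensor product of [M_I] and [M_K]. *)
Definition amp (I K : finType) (f : I * K -> I * K -> T) i j := \sum_q f (i, q) (j, q).

Lemma oz1_amp (I K : finType) (f : I * K -> I * K -> T) : oz1 (amp f) = oz1 f.
Proof. by rewrite /oz1 /amp pair_bigA; apply: eq_bigr => -[]. Qed.

Lemma oz_amp (I K : finType) (f : I * K -> I * K -> T) : oz f -> oz (amp f).
Proof.
move=> hf.
have M i j k l : amp f i j * amp f k l = if j == k then oz1 f * amp f i l else 0.
  rewrite /amp mulr_suml; have [<-|jk] := eqVneq j k.
    rewrite mulr_sumr; apply: eq_bigr => q _.
    rewrite mulr_sumr (bigD1 q) //= big1 ?addr0 => [|q' qq].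
      by rewrite (ozM hf) eqxx.
    by rewrite (oz_orth hf) // xpair_eqE eqxx eq_sym.
  rewrite big1 // => q _; rewrite mulr_sumr big1 // => q' _.
  by rewrite (oz_orth hf) // xpair_eqE (negPf jk).
split => [i j|i j k l jk|i j l].
- by rewrite /amp star_sum; apply: eq_bigr => q _; exact: oz_star.
- by rewrite M (negPf jk).
- by rewrite !M !eqxx.
Qed.

End Amplify.

Section Glue.
Variables (T : pzStarRingType) (I P : finType) (c : P -> T) (G : P -> I -> I -> T).
Hypothesis c_sa : forall p, star (c p) = c p.
Hypothesis c_orth : forall p q, p != q -> c p * c q = 0.

Lemma glue_mul (x y : P -> T) a b : (forall p q, c q * x p = x p * c q) ->
  (\sum_p c p ^+ a.+1 * x p) * (\sum_p c p ^+ b.+1 * y p) =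
  \sum_p c p ^+ (a + b).+2 * (x p * y p).
Proof.
move=> cx; rewrite mulr_suml; apply: eq_bigr => p _.
rewrite mulr_sumr (bigD1 p) //= big1 ?addr0 => [|q qp].
  have -> : c p ^+ a.+1 * x p * (c p ^+ b.+1 * y p) = c p ^+ a.+1 * (x p * c p ^+ b.+1) * y p.
    by rewrite !mulrA.
  have -> : x p * c p ^+ b.+1 = c p ^+ b.+1 * x p by exact: (commrX _ (esym (cx p p))).
  by rewrite !mulrA -exprD addSn addnS.
have -> : c p ^+ a.+1 * x p * (c q ^+ b.+1 * y q) =
    c p ^+ a * (c p * x p * c q) * (c q ^+ b * y q) by rewrite exprSr exprS !mulrA.
by rewrite cx -[x p * _ * _]mulrA c_orth 1?eq_sym // mulr0 mulr0 mul0r.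
Qed.

Lemma glueX (x : P -> T) m : (forall p q, c q * x p = x p * c q) ->
  (\sum_p c p * x p) ^+ m.+1 = \sum_p c p ^+ m.+1 * x p ^+ m.+1.
Proof.
move=> cx; elim: m => [|m IH]; first by rewrite expr1; apply: eq_bigr.
rewrite exprSr {}IH; have -> : \sum_p c p * x p = \sum_p c p ^+ 1 * x p by apply: eq_bigr.
rewrite (@glue_mul _ _ m 0) => [|p q]; last exact: (commrX _ (cx p q)).
by apply: eq_bigr => p _; rewrite addn0 -exprSr.
Qed.

Hypothesis hG : forall p, oz (G p).
Hypothesis cG : forall p q i j, c q * G p i j = G p i j * c q.

Definition glue i j := \sum_p c p * G p i j.

Lemma oz1_glue : oz1 glue = \sum_p c p * oz1 (G p).
Proof. by rewrite /oz1 /glue exchange_big; apply: eq_bigr => p _; rewrite mulr_sumr. Qed.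

Lemma oz_glue : oz glue.
Proof.
have M i j k l : glue i j * glue k l = \sum_p c p ^+ 2 * (G p i j * G p k l).
  have E i' j' : glue i' j' = \sum_p c p ^+ 1 * G p i' j' by apply: eq_bigr.
  by rewrite !E (@glue_mul _ _ 0 0).
split => [i j|i j k l jk|i j l].
- rewrite /glue star_sum; apply: eq_bigr => p _.
  by rewrite starM c_sa (oz_star (hG p)) cG.
- by rewrite M big1 // => p _; rewrite (oz_orth (hG p)) ?mulr0.
- by rewrite !M; apply: eq_bigr => p _; rewrite (oz_mul (hG p)).
Qed.

Lemma oz1_cG p q : c q * oz1 (G p) = oz1 (G p) * c q.
Proof. by rewrite /oz1 mulr_sumr mulr_suml; apply: eq_bigr. Qed.

Lemma glue_pow m i j : oz1 glue ^+ m.+1 * glue i j =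
  \sum_p c p ^+ m.+2 * (oz1 (G p) ^+ m.+1 * G p i j).
Proof.
rewrite oz1_glue glueX; last exact: oz1_cG.
have -> : glue i j = \sum_p c p ^+ 1 * G p i j by apply: eq_bigr.
rewrite (@glue_mul _ _ m 0) => [|p q]; last exact: (commrX _ (oz1_cG p q)).
by apply: eq_bigr => p _; rewrite addn0.
Qed.

End Glue.

Section TowerMatrix.
Variables (T : pzStarRingType) (I K S : finType) (e f : K -> T)
  (F : K -> I * K -> I * K -> T) (W : K -> K -> T).
Hypothesis e_sa : forall p, star (e p) = e p.
Hypothesis e_orth : forall p q, p != q -> e p * e q = 0.
Hypothesis hF : forall p, oz (F p).
Hypothesis eF : forall q p x y, e q * F p x y = F p x y * e q.
Hypothesis f_sa : forall p, star (f p) = f p.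
Hypothesis f_comm : forall p x, f p * x = x * f p.

Local Notation H p := (oz1 (F p)).
(** The section works with exact relations in an arbitrary star ring and is applied to [asymp B]:
    [f p] is a central weight, [F p] the conjugate by [u ^ p] of one order zero system, and [W q p]
    stands for [u ^ q u ^ -p]. *)
Definition tower_oz := glue (fun p => f p * e p) (fun p => amp (F p)).

Lemma fe_sa p : star (f p * e p) = f p * e p.
Proof. by rewrite starM e_sa f_sa f_comm. Qed.

Lemma fe_orth p q : p != q -> f p * e p * (f q * e q) = 0.
Proof. by move=> pq; rewrite -mulrA (mulrA (e p)) -f_comm -(mulrA (f q)) e_orth // !mulr0. Qed.

Lemma fe_comm p x : e p * x = x * e p -> f p * e p * x = x * (f p * e p).
Proof. by move=> ex; rewrite -mulrA ex mulrA f_comm -mulrA. Qed.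

Lemma e_amp p q i j : e q * amp (F p) i j = amp (F p) i j * e q.
Proof. by rewrite /amp mulr_sumr mulr_suml; apply: eq_bigr. Qed.

Lemma e_H p q : e q * H p = H p * e q.
Proof. by rewrite /oz1 mulr_sumr mulr_suml; apply: eq_bigr. Qed.

Lemma oz_tower : oz tower_oz.
Proof.
apply: oz_glue fe_sa fe_orth _ _ => [p|p q i j]; first exact: oz_amp.
exact/fe_comm/e_amp.
Qed.

Lemma feX p m : (f p * e p) ^+ m = f p ^+ m * e p ^+ m.
Proof. by rewrite exprMn_comm //; exact: f_comm. Qed.

Lemma tower_pow m i j : oz1 tower_oz ^+ m.+1 * tower_oz i j =
  \sum_p f p ^+ m.+2 * e p ^+ m.+2 * (H p ^+ m.+1 * amp (F p) i j).
Proof.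
rewrite glue_pow; last 2 first.
- exact: fe_orth.
- by move=> p q i' j'; exact/fe_comm/e_amp.
by apply: eq_bigr => p _; rewrite oz1_amp feX.
Qed.

Lemma oz1_towerX m : oz1 tower_oz ^+ m.+1 = \sum_p f p ^+ m.+1 * e p ^+ m.+1 * H p ^+ m.+1.
Proof.
rewrite oz1_glue glueX; last 2 first.
- exact: fe_orth.
- by move=> p q; rewrite oz1_amp; exact/fe_comm/e_H.
by apply: eq_bigr => p _; rewrite oz1_amp feX.
Qed.

(** A power is needed because the lift of the system [sigma] produces [oz1 sigma ^ m * sigma i j],
    so that the unit to be compared with 1 is [oz1 sigma ^ m.+1]. *)
Lemma tower_defect m : 1 - oz1 tower_oz ^+ m.+1 =
  (1 - \sum_p e p ^+ m.+1) + \sum_p e p ^+ m.+1 * (1 - H p ^+ m.+1)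
  + \sum_p (1 - f p ^+ m.+1) * (e p ^+ m.+1 * H p ^+ m.+1).
Proof.
rewrite oz1_towerX -addrA -big_split /=.
have -> : \sum_p (e p ^+ m.+1 * (1 - H p ^+ m.+1) + (1 - f p ^+ m.+1) * (e p ^+ m.+1 * H p ^+ m.+1)) =
  \sum_p e p ^+ m.+1 - \sum_p f p ^+ m.+1 * e p ^+ m.+1 * H p ^+ m.+1.
  by rewrite -sumrB; apply: eq_bigr => p _; ncring.
by ncring.
Qed.

Hypothesis star_W : forall q p, star (W q p) = W p q.
Hypothesis WW : forall q p, W q p * W p q = 1.
Hypothesis WF : forall q p x y, W q p * F p x y = F q x y * W q p.
Hypothesis We : forall q p, W q p * e p = e q * W q p.

Variables (r : S -> T) (b : T) (w : K -> T) (col : K * S -> K) (t : nat).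
Hypothesis rb1 : \sum_s r s * b * star (r s) = 1.
Hypothesis e_r : forall q s, e q * r s = r s * e q.
Hypothesis e_b : forall q, e q * b = b * e q.
Hypothesis F_r : forall q s x y, F q x y * r s = r s * F q x y.
Hypothesis F_b : forall q x y, F q x y * b = b * F q x y.
Hypothesis w_sa : forall p, star (w p) = w p.
Hypothesis w_comm : forall p x, w p * x = x * w p.
Hypothesis col_inj : forall x y, x != y -> w x.1 != 0 -> w y.1 != 0 -> col x != col y.

Let G q := amp (fun x y : K * I => F q (x.2, x.1) (y.2, y.1)).
(* Moves floor [p] of the tower onto all floors [q] at once, keeping in each matrix only the
   column that encodes the color of [x = (p, s)]. *)
Definition ramp_shift (x : K * S) := \sum_q e q * G q (col x) q * W q x.1.
(** With [w p] a square root of [1 - f p ^ (2t + 2)], the last factor turns the [(e p * H p) ^ 2] of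
    [ramp_shift_sum] into the ramp term of [tower_defect] for [m = 2t + 1]. *)
Definition ramp_factor := \sum_x star (r x.2) * ramp_shift x * (w x.1 * (e x.1 * H x.1) ^+ t).
Let z s s' := r s * b * star (r s').

Let hG q : oz (G q).
Proof.
apply: oz_amp; apply: (@oz_reindex _ _ _ (fun x : K * I => (x.2, x.1))) => //.
by move=> [a c] [a' c'] [-> ->].
Qed.

Let oz1G q : oz1 (G q) = H q.
Proof.
rewrite oz1_amp /oz1 (reindex (fun x : K * I => (x.2, x.1))) //=.
by exists (fun x => (x.2, x.1)) => -[].
Qed.

Let e_G q p x y : e q * G p x y = G p x y * e q.
Proof. by rewrite /G /amp mulr_sumr mulr_suml; apply: eq_bigr. Qed.

Let e_z q s s' : e q * z s s' = z s s' * e q.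
Proof.
have er : e q * star (r s') = star (r s') * e q by apply: comm_star.
by rewrite /z !mulrA e_r -(mulrA _ (e q)) e_b mulrA -(mulrA _ (e q)) er !mulrA.
Qed.

Let F_z q s s' x y : F q x y * z s s' = z s s' * F q x y.
Proof.
have Fr : F q x y * star (r s') = star (r s') * F q x y.
  by rewrite -(oz_star (hF q) y x) -!starM F_r.
by rewrite /z !mulrA F_r -(mulrA _ (F q x y)) F_b mulrA -(mulrA _ (F q x y)) Fr !mulrA.
Qed.

Let G_z q s s' x y : G q x y * z s s' = z s s' * G q x y.
Proof. by rewrite /G /amp mulr_sumr mulr_suml; apply: eq_bigr. Qed.

Let WG q p x y : W q p * G p x y = G q x y * W q p.
Proof. by rewrite /G /amp mulr_sumr mulr_suml; apply: eq_bigr. Qed.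

Let WH q p : W q p * H p = H q * W q p.
Proof. by rewrite /oz1 mulr_sumr mulr_suml; apply: eq_bigr. Qed.

Lemma star_ramp_shift x : star (ramp_shift x) = \sum_q W x.1 q * G q q (col x) * e q.
Proof.
rewrite star_sum; apply: eq_bigr => q _.
by rewrite !starM star_W e_sa (oz_star (hG q)) mulrA.
Qed.

Lemma ramp_shift_mul x y s s' : star (ramp_shift x) * z s s' * ramp_shift y =
  \sum_q W x.1 q * (G q q (col x) * G q (col y) q) * (e q * e q * z s s') * W q y.1.
Proof.
move: (z s s') (fun q => e_z q s s') (fun q => G_z q s s') => v ev Gv.
rewrite star_ramp_shift !mulr_suml; apply: eq_bigr => q _.
rewrite mulr_sumr (bigD1 q) //= big1 ?addr0 => [|q' qq].
  have -> : W x.1 q * G q q (col x) * e q * v * (e q * G q (col y) q * W q y.1) =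
    W x.1 q * G q q (col x) * (e q * v * e q * G q (col y) q) * W q y.1 by ncring.
  have -> : e q * v * e q * G q (col y) q = G q (col y) q * (e q * e q * v).
    have h1 : e q * e q * v = v * (e q * e q) by rewrite -mulrA ev mulrA ev mulrA.
    have h2 : e q * e q * G q (col y) q = G q (col y) q * (e q * e q).
      by rewrite -mulrA e_G mulrA e_G mulrA.
    by rewrite h1 ev -(mulrA (v)) -mulrA h2 !mulrA Gv.
  by ncring.
have -> : W x.1 q * G q q (col x) * e q * v * (e q' * G q' (col y) q' * W q' y.1) =
  W x.1 q * G q q (col x) * (e q * v) * e q' * (G q' (col y) q' * W q' y.1) by ncring.
rewrite ev.
have -> : W x.1 q * G q q (col x) * (v * e q) * e q' * (G q' (col y) q' * W q' y.1) =
  W x.1 q * G q q (col x) * v * (e q * e q') * (G q' (col y) q' * W q' y.1) by ncring.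
by rewrite e_orth 1?eq_sym // mulr0 mul0r.
Qed.

Lemma ramp_shift_orth x y s s' : col x != col y ->
  star (ramp_shift x) * z s s' * ramp_shift y = 0.
Proof.
move=> xy; rewrite ramp_shift_mul big1 // => q _.
by rewrite (oz_orth (hG q)) // mulr0 !mul0r.
Qed.

(** On floor [q] the colors cancel by [ozM] and leave the diagonal unit [q]; moved back to floor [p]
    by [W p q] it becomes [G p q q], the piece of floor [p] that had been sent to [q]. The sum over
    [q] restores [H p], and the sum over [s] is absorbed by [rb1]. *)
Lemma ramp_shift_sum p : \sum_s star (ramp_shift (p, s)) * z s s * ramp_shift (p, s) =
  (e p * H p) ^+ 2.
Proof.
transitivity (\sum_q \sum_s W p q * (G q q (col (p, s)) * G q (col (p, s)) q) * (e q * e q * z s s) * W q p).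
  by rewrite exchange_big; apply: eq_bigr => s _; rewrite ramp_shift_mul.
transitivity (\sum_q (e p * e p) * H p * G p q q); last first.
  by rewrite -mulr_sumr -/(oz1 (G p)) oz1G expr2 !mulrA -(mulrA (e p) (H p)) -e_H !mulrA.
apply: eq_bigr => q _.
transitivity (W p q * (H q * G q q q) * (e q * e q) * (\sum_s z s s) * W q p).
  rewrite mulr_sumr mulr_suml; apply: eq_bigr => s _.
  by rewrite (ozM (hG q)) eqxx oz1G; congr (_ * _); exact: mulrA.
rewrite rb1 mulr1.
have -> : W p q * (H q * G q q q) * (e q * e q) * W q p =
  (W p q * H q) * G q q q * e q * e q * W q p by ncring.
rewrite WH; have -> : H p * W p q * G q q q * e q * e q * W q p =
  H p * (W p q * G q q q) * e q * e q * W q p by ncring.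
rewrite WG; have -> : H p * (G p q q * W p q) * e q * e q * W q p =
  H p * G p q q * (W p q * e q) * e q * W q p by ncring.
rewrite We; have -> : H p * G p q q * (e p * W p q) * e q * W q p =
  H p * G p q q * e p * (W p q * e q) * W q p by ncring.
rewrite We; have -> : H p * G p q q * e p * (e p * W p q) * W q p =
  H p * (G p q q * e p * e p) * (W p q * W q p) by ncring.
rewrite WW mulr1.
have -> : G p q q * e p * e p = e p * e p * G p q q by rewrite -e_G -mulrA -e_G mulrA.
by rewrite !mulrA -e_H -(mulrA (e p)) -e_H !mulrA.
Qed.

(* Since [sum_s r_s b r_s^* = 1] and distinct colors select orthogonal columns, the mass
   lost on the ramps is spread, up to a partial isometry, inside [b]. *)
Lemma ramp_factor_sqr : star ramp_factor * b * ramp_factor =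
  \sum_p w p * w p * (e p * H p) ^+ (2 * t.+1).
Proof.
pose Y p := w p * (e p * H p) ^+ t.
have H_sa p : star (H p) = H p by apply: oz1_sa.
have seH p : star (e p * H p) = e p * H p by rewrite starM e_sa H_sa e_H.
have sY p : star (Y p) = Y p by rewrite /Y starM starX seH w_sa -w_comm.
have fE : ramp_factor = \sum_x star (r x.2) * ramp_shift x * Y x.1 by [].
have sfE : star ramp_factor = \sum_x Y x.1 * star (ramp_shift x) * r x.2.
  by rewrite fE star_sum; apply: eq_bigr => x _; rewrite starM (sY x.1) starM starK mulrA.
transitivity (\sum_x Y x.1 * (star (ramp_shift x) * z x.2 x.2 * ramp_shift x) * Y x.1).
  rewrite sfE fE !mulr_suml; apply: eq_bigr => x _.
  rewrite mulr_sumr (bigD1 x) //= big1 ?addr0 => [|y yx].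
    by rewrite /z; ncring.
  have -> : Y x.1 * star (ramp_shift x) * r x.2 * b * (star (r y.2) * ramp_shift y * Y y.1) =
     Y x.1 * (star (ramp_shift x) * z x.2 y.2 * ramp_shift y) * Y y.1 by rewrite /z; ncring.
  have [wx|wx] := eqVneq (w x.1) 0; first by rewrite /Y wx !mul0r.
  have [wy|wy] := eqVneq (w y.1) 0; first by rewrite /Y wy !mul0r mulr0.
  by rewrite ramp_shift_orth ?mulr0 ?mul0r //; apply: col_inj => //; rewrite eq_sym.
transitivity (\sum_p \sum_s Y p * (star (ramp_shift (p, s)) * z s s * ramp_shift (p, s)) * Y p).
  by rewrite pair_bigA; apply: eq_bigr => -[].
apply: eq_bigr => p _; rewrite -mulr_suml -mulr_sumr ramp_shift_sum /Y.
move: (e p * H p) => v; have -> : (2 * t.+1 = t + 2 + t)%N by lia.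
rewrite !exprD; move: (v ^+ t) (v ^+ 2) => a c.
by rewrite mulrA -(w_comm p (w p * a * c)) !mulrA.
Qed.

End TowerMatrix.

(** * From an approximate unit image to a contractive order zero map *)

Section Renormalize.
Variables (R : realType) (A : cstarAlgType R).

Lemma expr_1sub_factor (T : pzRingType) (h : T) m : 1 - h ^+ m = (\sum_(i < m) h ^+ i) * (1 - h).
Proof.
elim: m => [|m IH]; first by rewrite big_ord0 mul0r expr0 subrr.
by rewrite big_ord_recr mulrDl -IH mulrBr mulr1 -exprSr /=; ncring.
Qed.

Lemma expr_1sub_comm (T : pzRingType) (h : T) m :
  (\sum_(i < m) h ^+ i) * (1 - h) = (1 - h) * (\sum_(i < m) h ^+ i).
Proof.
rewrite mulr_sumr mulr_suml; apply: eq_bigr => i _.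
by rewrite mulrBr mulrBl mulr1 mul1r -exprSr -exprS.
Qed.

Lemma psd_1sub_expr (h : A) m : psd h -> psd (1 - h) -> psd (1 - h ^+ m).
Proof.
move=> ph ph1; rewrite expr_1sub_factor; apply: psd_mul => //; last exact: expr_1sub_comm.
by apply: psd_sum => i _; exact: psdX.
Qed.

Lemma cuntz_1sub_expr (h : A) m : psd h -> cuntz_le (1 - h ^+ m) (1 - h).
Proof.
move=> ph; rewrite expr_1sub_factor; apply: cuntz_mul_comm; last exact: expr_1sub_comm.
by apply: psd_sum => i _; exact: psdX.
Qed.

(* With [S = oz1 g], rescaling by the inverse of [max (1 - eta) (S * S)] makes the
   defect vanish wherever it was below [eta]. *)
Lemma oz_renorm n (g : 'I_n -> 'I_n -> A) (r : A) (eta : R) : oz g -> psd r -> 0 < eta < 1 ->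
  cnorm (1 - oz1 g * oz1 g - r) <= eta -> exists phi : 'M[R[i]]_n -> A,
  [/\ cpc_order_zero phi,
      forall i j, cnorm (oz1 g * g i j - phi (delta_mx i j)) <= 3 * eta
    & cuntz_le (1 - phi 1%:M) r].
Proof.
move=> hg pr /andP[eta0 eta1] dr; pose S := oz1 g; pose Q := S * S.
have sS : star S = S := oz1_sa hg.
have t0 : 0 < 1 - eta by lra.
have pQ : psd Q by exact: psd_sqr.
have sQ := psd_sa pQ.
pose x := Q - sc (1 - eta); have sx : star x = x by exact: sa_subsc.
pose P := pospart x; have pP : psd P by exact: pospart_psd.
pose v := cinv (1 - eta) P; have pv : psd v by exact: cinv_psd.
have Ev : (sc (1 - eta) + P) * v = 1 by exact: cinvE.
pose rho := csqrt v; have rr : rho * rho = v by exact: csqrtE.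
have srho : star rho = rho by exact: csqrt_sa.
have nx y : y * Q = Q * y -> y * x = x * y by move=> h; rewrite /x mulrBr mulrBl h sc_comm.
have nP y : y * Q = Q * y -> y * P = P * y by move=> h; apply: pospart_comm => //; exact: nx.
have nv y : y * Q = Q * y -> y * v = v * y by move=> h; apply: cinv_comm => //; exact: nP.
have nrho y : y * Q = Q * y -> y * rho = rho * y by move=> h; apply: csqrt_comm => //; exact: nv.
have gS i j : g i j * S = S * g i j := oz1_comm hg i j.
have gQ i j : g i j * Q = Q * g i j by rewrite /Q mulrA gS -(mulrA S (g i j)) gS mulrA.
have SQ : S * Q = Q * S by rewrite /Q mulrA.
have Srho := nrho _ SQ.
have Sv := nv _ SQ.
have Qv : Q * v = v * Q by exact: nv.
have xP0 : x * P = P * P := pospart_mul sx.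
have xP : x * P = P * x.
  by have h := congr1 star xP0; rewrite !starM sx (psd_sa pP) in h; rewrite xP0 h.
have xv : x * v = v * x by rewrite -(nx v) // Qv.
have Pv : P * v = v * P by rewrite (nP v) // Qv.
have defect : 1 - Q * v = (P - x) * v.
  by rewrite -Ev /x; ncring.
have rhoS : cnorm (rho * S) <= 1.
  apply: cnorm_sqr_le => //; rewrite starM sS srho expr1n scale1r.
  have -> : S * rho * (rho * S) = Q * v.
    by rewrite -mulrA (mulrA rho rho) rr mulrA Sv -mulrA Qv.
  rewrite defect; apply: psd_mul => //; first exact: pospart_ge.
  by rewrite mulrBl mulrBr Pv xv.
have phi_cpc := oz_map_cpc hg srho (fun i j => nrho _ (gQ i j)) rhoS.
exists (oz_map g rho); split=> //.
- move=> i j; set T := oz1 g * g i j.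
  have phiE : oz_map g rho (delta_mx i j) = v * T by rewrite oz_map_delta rr -mulrA.
  have phi1 : cnorm (v * T) <= 1.
    rewrite -phiE; case: phi_cpc => _ _ H _; apply: le_trans (H _) _.
    by rewrite opnorm_delta.
  rewrite phiE; clear phiE; clearbody T; have -> : T - v * T = (P - sc eta) * (v * T).
    rewrite mulrA [(P - _) * v]mulrBl; have -> : P * v = (sc (1 - eta) + P) * v - sc (1 - eta) * v by ncring.
    rewrite Ev.
    have -> : sc (1 - eta) = 1 - sc eta :> A by rewrite rmorphB rmorph1 scalerBl scale1r.
    by ncring.
  (* As [r >= 0], the hypothesis gives [Q <= 1 + eta], hence [x <= 2 eta]. With the extra [eta] from
     [P - eta] this is the constant 3. *)
  have Pn : cnorm P <= 2 * eta.
    apply: pospart_le_norm => //; first by lra.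
    have -> : sc (2 * eta) - x = r + (sc eta - (- (1 - Q - r))).
      rewrite /x; have -> : sc (1 - eta) = 1 - sc eta :> A by rewrite rmorphB rmorph1 scalerBl scale1r.
      have -> : sc (2 * eta) = sc eta + sc eta :> A by rewrite -scalerDl -rmorphD; congr (_%:C%:A); lra.
      by ncring.
    apply: psdD => //; apply: psd_scB; rewrite ?cnormN //.
    by rewrite starN !starB star1 sQ psd_sa.
  rewrite -[leRHS]mulr1; apply: cnormM_le => //; apply: le_trans (cnormB _ _) _.
  by rewrite cnorm_alg ger0_norm ?(ltW eta0) //; lra.
- rewrite (oz_map1 (fun i j => nrho _ (gQ i j))) -/S; have -> : rho * S * (rho * S) = Q * v.
    by rewrite -[X in X * _]Srho -mulrA (mulrA rho rho) rr mulrA Sv -mulrA Qv.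
  rewrite defect; have -> : P - x = pospart (- x).
    have h := pospartB x; transitivity (P - (pospart x - pospart (- x))); first by rewrite h.
    by rewrite /P; ncring.
  have nxv : v * pospart (- x) = pospart (- x) * v.
    by apply: pospart_comm; rewrite ?starN ?sx // mulrN mulNr xv.
  rewrite -nxv; apply: cuntz_trans (cuntz_mul_comm pv nxv) _.
  have -> : - x = (1 - Q) - sc eta.
    by rewrite /x rmorphB rmorph1 scalerBl scale1r; ncring.
  by apply: cuntz_cut => //; rewrite starB star1 sQ.
Qed.

End Renormalize.

(** * Almost commutation with generators controls the whole crossed product *)

Section CommutationTransfer.
Variables (R : realType) (B : cstarAlgType R).
Implicit Types (x y z t : B).

Definition ncomm x y := cnorm (x * y - y * x).

Lemma ncomm_star x y : ncomm (star x) (star y) = ncomm x y.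
Proof. by rewrite /ncomm -!starM -starB cnorm_starE cnorm_distC. Qed.

Lemma ncommM t x y : ncomm t (x * y) <= ncomm t x * cnorm y + cnorm x * ncomm t y.
Proof.
rewrite /ncomm; have -> : t * (x * y) - x * y * t = (t * x - x * t) * y + x * (t * y - y * t) by ncring.
by apply: le_trans (cnormD _ _) _; apply: lerD; exact: cnormM.
Qed.

Lemma ncomm_lin t (c : R[i]) x y :
  ncomm t (c *: x + y) <= ComplexField.Normc.normc c * ncomm t x + ncomm t y.
Proof.
rewrite /ncomm; have -> : t * (c *: x + y) - (c *: x + y) * t = c *: (t * x - x * t) + (t * y - y * t).
  by rewrite mulrDr mulrDl -scalerAr -scalerAl scalerBr; ncring.
by apply: le_trans (cnormD _ _) _; rewrite cnormZ.
Qed.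

Lemma ncomm_dist t x y : cnorm t <= 1 -> ncomm t x <= ncomm t y + 2 * cnorm (x - y).
Proof.
move=> t1; rewrite /ncomm.
have -> : t * x - x * t = (t * y - y * t) + (t * (x - y) - (x - y) * t) by ncring.
apply: le_trans (cnormD _ _) _; rewrite lerD2l; apply: le_trans (cnormB _ _) _.
have : cnorm (t * (x - y)) <= 1 * cnorm (x - y) by exact: cnormM_le.
have : cnorm ((x - y) * t) <= cnorm (x - y) * 1 by exact: cnormM_le.
by lra.
Qed.

Variable (G : B -> Prop).

(** [star t] is included so that the elements controlled by this condition are closed under
    [star]. *)
Definition almost_comm (F : seq B) (d : R) t :=
  forall y, y \in F -> ncomm t y <= d /\ ncomm (star t) y <= d.

Definition comm_ctrl x := forall eta : R, 0 < eta -> exists F d, [/\ 0 < d, forall y, y \in F -> G y &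
  forall t, cnorm t <= 1 -> almost_comm F d t -> ncomm t x <= eta].

Lemma almost_commW F F' d d' t : {subset F' <= F} -> d <= d' -> almost_comm F d t -> almost_comm F' d' t.
Proof. by move=> FF dd H y /FF/H[h h']; split; apply: le_trans dd. Qed.

Lemma comm_ctrl2 x y (e : R) : comm_ctrl x -> comm_ctrl y -> 0 < e ->
  exists F d, [/\ 0 < d, forall z, z \in F -> G z &
   forall t, cnorm t <= 1 -> almost_comm F d t -> ncomm t x <= e /\ ncomm t y <= e].
Proof.
move=> cx cy e0; have [F [d [d0 FG H]]] := cx _ e0; have [F' [d' [d'0 FG' H']]] := cy _ e0.
exists (F ++ F'), (Num.min d d'); split.
- by rewrite lt_min d0.
- by move=> z; rewrite mem_cat => /orP[/FG|/FG'].
- move=> t t1 ac; split; [apply: H => //|apply: H' => //]; apply: almost_commW ac.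
  + by move=> z zF; rewrite mem_cat zF.
  + by rewrite ge_min lexx.
  + by move=> z zF; rewrite mem_cat zF orbT.
  + by rewrite ge_min lexx orbT.
Qed.

(** Ended by [Defined], because its membership predicate has to unfold to [comm_ctrl] when
    [cp_generated] is applied to it. *)
Definition comm_ctrl_csub : csub B.
Proof.
apply: (@Csub _ _ comm_ctrl).
- move=> x l cx xl eta eta0; have e4 : 0 < eta / 4 by lra.
  have [n Hn] := null_lt xl e4; have e2 : 0 < eta / 2 by lra.
  have [F [d [d0 FG H]]] := cx n _ e2; exists F, d; split=> // t t1 /(H t t1) h.
  have := ncomm_dist l (x n) t1; rewrite cnorm_distC; lra.
- move=> eta eta0; exists [::], 1; split=> // t _ _.
  by rewrite /ncomm mulr1 mul1r subrr cnorm0 ltW.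
- move=> c x y cx cy eta eta0; set k := ComplexField.Normc.normc c.
  have k0 : 0 <= k by exact: nrm_ge0.
  have e0 : 0 < eta / (k + 1) by apply: divr_gt0 => //; lra.
  have [F [d [d0 FG H]]] := comm_ctrl2 cx cy e0; exists F, d; split=> // t t1 /(H t t1)[h h'].
  apply: le_trans (ncomm_lin _ _ _ _) _; rewrite -/k.
  have -> : eta = k * (eta / (k + 1)) + eta / (k + 1) by field; lra.
  by apply: lerD => //; apply: ler_wpM2l.
- move=> x y cx cy eta eta0; set k := cnorm x + cnorm y.
  have x0 := cnorm_ge0 x; have y0 := cnorm_ge0 y; have k0 : 0 <= k by rewrite /k; lra.
  have e0 : 0 < eta / (k + 1) by apply: divr_gt0 => //; lra.
  have [F [d [d0 FG H]]] := comm_ctrl2 cx cy e0; exists F, d; split=> // t t1 /(H t t1)[h h'].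
  apply: le_trans (ncommM _ _ _) _.
  have -> : eta = (k + 1) * (eta / (k + 1)) by field; lra.
  have : ncomm t x * cnorm y <= eta / (k + 1) * cnorm y by apply: ler_wpM2r.
  have : cnorm x * ncomm t y <= cnorm x * (eta / (k + 1)) by apply: ler_wpM2l.
  by rewrite /k in e0 *; move: (eta / _) e0 => w; nra.
- move=> x cx eta eta0; have [F [d [d0 FG H]]] := cx _ eta0; exists F, d; split=> // t t1 ac.
  rewrite -ncomm_star starK; apply: H; first by rewrite cnorm_starE.
  by move=> z /ac[h h']; rewrite starK.
Defined.

End CommutationTransfer.

Section CrossedCommutation.
Variables (R : realType) (A : cstarAlgType R) (alpha : A -> A) (B : cstarAlgType R)
  (iota : A -> B) (u : B).
Hypothesis B_crossed : crossed_product alpha iota u.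

Lemma cp_comm_ctrl (Y : seq B) (eta : R) : 0 < eta -> exists (F : seq A) (d : R), 0 < d /\
  forall t, cnorm t <= 1 -> almost_comm (u :: map iota F) d t -> forall y, y \in Y -> ncomm t y <= eta.
Proof.
move=> eta0; pose G (x : B) := x = u \/ exists a, x = iota a.
have all y : comm_ctrl G y.
  apply: (cp_generated B_crossed (S := comm_ctrl_csub G)) => [a|] e e0.
    exists [:: iota a], e; split=> // [z|t t1 /(_ _ (mem_head _ _))[]//].
    by rewrite inE => /eqP ->; right; exists a.
  exists [:: u], e; split=> // [z|t t1 /(_ _ (mem_head _ _))[]//].
  by rewrite inE => /eqP ->; left.
have list (F : seq B) : (forall y, y \in F -> G y) -> exists F' : seq A,
    {subset F <= u :: map iota F'}.
  elim: F => [|y F IH] FG; first by exists [::].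
  have [|F' FF'] := IH; first by move=> z zF; apply: FG; rewrite inE zF orbT.
  case: (FG y (mem_head _ _)) => [->|[a ->]].
    exists F' => z; rewrite inE => /orP[/eqP ->|/FF' //]; exact: mem_head.
  exists (a :: F') => z; rewrite inE => /orP[/eqP ->|/FF']; rewrite !inE ?eqxx ?orbT //.
  by case/orP=> -> //; rewrite !orbT.
elim: Y => [|y Y [F [d [d0 H]]]]; first by exists [::], 1.
have [F2 [d2 [d20 F2G H2]]] := all y _ eta0; have [F2' F2F] := list _ F2G.
exists (F ++ F2'), (Num.min d d2); split; first by rewrite lt_min d0.
move=> t t1 ac z; rewrite inE => /orP[/eqP ->|zY].
  apply: H2 => //; apply: almost_commW ac; last by rewrite ge_min lexx orbT.
  move=> w /F2F; rewrite !inE map_cat mem_cat => /orP[->|->] //; by rewrite !orbT.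
apply: H => //; apply: almost_commW ac; last by rewrite ge_min lexx.
by move=> w; rewrite !inE map_cat mem_cat => /orP[->|->] //; rewrite !orbT.
Qed.

End CrossedCommutation.

Lemma sh_comp (R : realType) (A B D : cstarAlgType R) (f : B -> D) (g : A -> B) :
  star_hom f -> star_hom g -> star_hom (fun a => f (g a)).
Proof.
move=> hf hg; split.
- by move=> c x y; rewrite shD // shZ // shD // shZ.
- by split=> [|x y]; rewrite ?(sh1 hg) ?(sh1 hf) // !shM.
- by move=> x; rewrite -!sh_star.
Qed.

Lemma oz_sh (R : realType) (A B : cstarAlgType R) (f : A -> B) (I : finType) (g : I -> I -> A) :
  star_hom f -> oz g -> oz (fun i j => f (g i j)).
Proof.
move=> hf hg; split => [i j|i j k l jk|i j l].
- by rewrite -sh_star // (oz_star hg).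
- by rewrite -shM // (oz_orth hg) // sh0.
- by rewrite -!shM // (oz_mul hg).
Qed.

Lemma oz_cls (R : realType) (A : cstarAlgType R) (I : finType) (g : nat -> I -> I -> A) :
  (forall N, oz (g N)) -> (forall i j, abnd (fun N => g N i j)) -> oz (fun i j => cls (fun N => g N i j)).
Proof.
move=> hg bg; split => [i j|i j k l jk|i j l].
- rewrite -cls_star //; congr cls; apply: funext => N; exact: oz_star.
- rewrite -clsM // -(acst0 A); congr cls; apply: funext => N; exact: oz_orth.
- rewrite -!clsM //; congr cls; apply: funext => N; exact: oz_mul.
Qed.

(** * Conjugates of an order zero system along a tower *)

Section TowerSystem.
Variables (R : realType) (A : cstarAlgType R) (alpha : A -> A) (B : cstarAlgType R)
  (iota : A -> B) (u : B).
Hypothesis A_Zabs : tracially_Z_absorbing A.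
Hypothesis alpha_aut : star_automorphism alpha.
Hypothesis alpha_Rokhlin : generalized_tracial_Rokhlin alpha.
Hypothesis B_crossed : crossed_product alpha iota u.
Let ci := cp_iota B_crossed.

Definition twist p a := iota (iter p alpha a).

Lemma sh_twist p : star_hom (twist p).
Proof.
apply: sh_comp => //; elim: p => [|p IH]; first by split.
by apply: sh_comp => //; case: alpha_aut.
Qed.

Lemma twist_conj p a : twist p a = u ^+ p * iota a * star u ^+ p.
Proof. by rewrite (cp_uX_comm B_crossed) -mulrA (cp_uX_suX B_crossed) mulr1. Qed.

(** Commutation is asked of every conjugate [u ^ p g u ^ -p], because floor [p] of the weighted
    tower carries that conjugate. The factor ['I_k] of the index set provides the columns for the
    ramps. *)
Record tmatrix (I : finType) k (F : seq A) (a d : A) (e : 'I_k -> nat -> A)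
  (g : nat -> I * 'I_k -> I * 'I_k -> A) : Prop := TMatrix {
  tm_tower : tower alpha e F a;
  tm_oz : forall N, oz (g N);
  tm_small : forall N, cuntz_le (1 - oz1 (g N)) d;
  tm_psd : forall N, psd (oz1 (g N));
  tm_psd1 : forall N, psd (1 - oz1 (g N));
  tm_diag : forall N x, psd (g N x x);
  tm_norm : forall N x y, cnorm (g N x y) <= 1;
  tm_comm : forall (p : 'I_k) y x x', y \in F -> null (fun N => ncomm (twist p (g N x x')) (iota y));
  tm_comm_tower : forall (p q : 'I_k) x x', null (fun N => ncomm (twist p (g N x x')) (iota (e q N)))
}.

(** For each [N] the tower comes first, and the order zero map is then chosen to almost commute with
    its floors as well. *)
Lemma tmatrix_exists (I : finType) (i0 : I) k F a d : (0 < k)%N -> psd a -> a != 0 -> psd d -> d != 0 ->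
  exists (e : 'I_k -> nat -> A) g, @tmatrix I k F a d e g.
Proof.
move=> k0 pa a0 pd d0; have [e he] := tower_exists alpha_Rokhlin F k0 pa a0.
(* [beta (p, y)] is [alpha^-p y]: commuting with it before the twist by [alpha^p] is commuting with
   [y] after it. *)
have /choice[beta Hb] : forall py : nat * A, exists b, iter py.1 alpha b = py.2.
  by move=> [p y]; exact: (alpha_surj alpha_aut).
pose J : finType := (I * 'I_k)%type; have J0 : (0 < #|{: J}|)%N.
  by apply/card_gt0P; exists (i0, Ordinal k0).
have N0 n : 0 < n.+1%:R^-1 :> R by rewrite invr_gt0.
have H (N : nat) : exists phi : 'M[R[i]]_#|{: J}| -> A, [/\ cpc_order_zero phi, cuntz_le (1 - phi 1%:M) d &
   forall x x' (p : 'I_k) y, y \in F \/ (exists q, y = e q N) ->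
   ncomm (twist p (phi (delta_mx x x'))) (iota y) <= N.+1%:R^-1].
  pose L := F ++ [seq e q N | q : 'I_k].
  case: A_Zabs => _ /(_ [seq beta (nat_of_ord p, y) | p <- enum 'I_k, y <- L] N.+1%:R^-1 d _ (N0 N)
    (proj2 (positiveP d) pd) d0 J0)[phi [hphi phi_d phi_comm]].
  exists phi; split=> // x x' p y yF.
  have yL : y \in L.
    rewrite mem_cat; case: yF => [->//|[q ->]]; rewrite [X in _ || X]fintype.image_f ?orbT //.
  have := phi_comm (delta_mx x x') (beta (nat_of_ord p, y)) (opnorm_delta _ _ _).
  have -> : beta (nat_of_ord p, y) \in [seq beta (nat_of_ord p, y) | p <- enum 'I_k, y <- L].
    by apply: (allpairs_f (fun (p : 'I_k) y => beta (nat_of_ord p, y))); rewrite ?mem_enum.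
  move=> /(_ isT)/ltW; apply: le_trans.
  rewrite /ncomm; have -> : iota y = twist p (beta (nat_of_ord p, y)).
    by rewrite /twist (Hb (nat_of_ord p, y)).
  rewrite -!(shM (sh_twist p)) -(shB (sh_twist p)); exact: sh_norm (sh_twist p) _.
have /choice[phi Hphi] := H.
pose g N (x y : J) := phi N (delta_mx (enum_rank x) (enum_rank y)).
have g1 N : oz1 (g N) = phi N 1%:M.
  have [hphi _ _] := Hphi N; rewrite (cpc1 hphi) /oz1 (reindex enum_rank) //=.
  by apply: onW_bij; exact: enum_rank_bij.
have gpsd N x : psd (g N x x) by have [hphi _ _] := Hphi N; exact: (cpc_psd hphi).
exists e, g; split=> //.
- move=> N; have [hphi _ _] := Hphi N.
  exact: (oz_reindex enum_rank_inj (cpc_oz hphi)).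
- by move=> N; rewrite g1; have [] := Hphi N.
- by move=> N; apply: psd_sum.
- move=> N; have [[_ _ nphi _] _ _] := Hphi N; rewrite g1 -[1]scale1r.
  have -> : 1 = 1%:C :> R[i] by rewrite rmorph1.
  apply: psd_scB; first by rewrite -g1; apply: psd_sa; apply: psd_sum.
  by apply: le_trans (nphi _) _; exact: opnorm1.
- by move=> N x y; have [hphi _ _] := Hphi N; exact: (cpc_norm hphi).
- move=> p y x x' yF; apply: null_le (@null_inv R) _ => N.
  by have [_ _ h] := Hphi N; apply: h; left.
- move=> p q x x'; apply: null_le (@null_inv R) _ => N.
  by have [_ _ h] := Hphi N; apply: h; right; exists q.
Qed.

Section AsymptoticTower.
Variables (I : finType) (k : nat) (F : seq A) (a d : A) (e : 'I_k -> nat -> A)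
  (g : nat -> I * 'I_k -> I * 'I_k -> A).
Hypothesis hT : tmatrix F a d e g.
Local Notation U := (acst u).

Definition towerE (p : 'I_k) := cls (fun N => iota (e p N)).
Definition towerF (p : 'I_k) x y := cls (fun N => twist p (g N x y)).
Definition towerW (q p : 'I_k) : asymp B := acst (u ^+ q * star u ^+ p).

Lemma bnd_twist p x y : abnd (fun N => twist p (g N x y)).
Proof.
by apply: bnd_le1 => N; apply: le_trans (sh_norm (sh_twist p) _) (tm_norm hT _ _ _).
Qed.

Lemma oz_towerF p : oz (towerF p).
Proof.
apply: oz_cls => [N|x y]; last exact: bnd_twist.
exact: oz_sh (sh_twist p) (tm_oz hT N).
Qed.

Lemma towerEF q p x y : towerE q * towerF p x y = towerF p x y * towerE q.
Proof.
have b1 := bnd_towerB B_crossed (tm_tower hT) q; have b2 := bnd_twist p x y.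
rewrite -!clsM //; apply: cls_eq; [exact: bndM|exact: bndM|].
by apply: null_eq (tm_comm_tower hT p q x y) => N; rewrite cnorm_distC.
Qed.

Lemma towerF_comm p x x' y : y \in F ->
  towerF p x x' * acst (iota y) = acst (iota y) * towerF p x x'.
Proof. by move=> yF; apply: cls_commute; [exact: bnd_twist|exact: (tm_comm hT)]. Qed.

Lemma towerF_conj p x y : towerF p x y = U ^+ p * cls (fun N => iota (g N x y)) * star U ^+ p.
Proof.
have b0 : abnd (fun N => iota (g N x y)) by exact: (bnd_twist 0).
rewrite -acst_star -!acstX /acst -!clsM //; try exact: bnd_cst.
  by congr cls; apply: funext => N; rewrite twist_conj.
by apply: bndM => //; exact: bnd_cst.
Qed.

Lemma towerE_conj (i p : 'I_k) : i = 0%N :> nat -> towerE p = U ^+ p * towerE i * star U ^+ p.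
Proof.
move=> i0; rewrite (towerB_shiftX B_crossed (tm_tower hT) (m := p) (j := p)) ?i0 //.
by rewrite -mulrA (acst_uX_suX B_crossed) mulr1.
Qed.

Lemma towerWE q p : towerW q p = U ^+ q * star U ^+ p.
Proof. by rewrite -acst_star -!acstX -acstM. Qed.

Lemma star_towerW q p : star (towerW q p) = towerW p q.
Proof. by rewrite !towerWE starM !starX starK. Qed.

Lemma towerWW q p : towerW q p * towerW p q = 1.
Proof.
rewrite !towerWE mulrA -[_ * _ * U ^+ p]mulrA (acst_suX_uX B_crossed) mulr1.
exact: (acst_uX_suX B_crossed).
Qed.

Lemma towerW_conj q p x : towerW q p * (U ^+ p * x * star U ^+ p) =
  (U ^+ q * x * star U ^+ q) * towerW q p.
Proof.
rewrite towerWE; have -> : U ^+ q * star U ^+ p * (U ^+ p * x * star U ^+ p) =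
  U ^+ q * (star U ^+ p * U ^+ p) * x * star U ^+ p by ncring.
rewrite (acst_suX_uX B_crossed) mulr1.
have -> : U ^+ q * x * star U ^+ q * (U ^+ q * star U ^+ p) =
  U ^+ q * x * (star U ^+ q * U ^+ q) * star U ^+ p by ncring.
by rewrite (acst_suX_uX B_crossed) mulr1.
Qed.

Lemma towerWF q p x y : towerW q p * towerF p x y = towerF q x y * towerW q p.
Proof. by rewrite !towerF_conj towerW_conj. Qed.

Lemma towerWe q p : towerW q p * towerE p = towerE q * towerW q p.
Proof.
pose i := Ordinal (leq_ltn_trans (leq0n p) (ltn_ord p)).
by rewrite (@towerE_conj i p) // (@towerE_conj i q) // towerW_conj.
Qed.

Lemma towerF_shift (p q : 'I_k) x y : q = p.+1 :> nat -> U * towerF p x y = towerF q x y * U.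
Proof.
move=> qp; rewrite !towerF_conj qp !exprS.
have -> : U * U ^+ p * cls (fun N => iota (g N x y)) * (star U * star U ^+ p) * U =
  U * U ^+ p * cls (fun N => iota (g N x y)) * (star U * star U ^+ p * U) by ncring.
have -> : star U * star U ^+ p * U = star U ^+ p.
  by rewrite -exprS exprSr -mulrA (acst_uu B_crossed) mulr1.
by ncring.
Qed.

End AsymptoticTower.

End TowerSystem.

(** * The weighted tower in the crossed product *)

Section RampWeight.
Variables (R : realType) (l m : nat).
Hypothesis l0 : (0 < l)%N.

Definition ramp (p : nat) : R := Num.min 1 (Num.min (p%:R / l%:R) ((m - p)%:R / l%:R)).

Let lR : 0 < l%:R :> R. Proof. by rewrite ltr0n. Qed.

Lemma ramp_itv p : 0 <= ramp p <= 1.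
Proof.
by rewrite /ramp !le_min ler01 !divr_ge0 // ge_min lexx.
Qed.

Lemma ramp0 : ramp 0 = 0.
Proof. by rewrite /ramp mul0r (min_l (x := 0)) ?divr_ge0 // min_r. Qed.

Lemma ramp_last : ramp m = 0.
Proof. by rewrite /ramp subnn mul0r (min_r (y := 0)) ?divr_ge0 // min_r. Qed.

Lemma ramp_eq1 p : (l <= p)%N -> (l <= m - p)%N -> ramp p = 1.
Proof.
move=> lp lmp; rewrite /ramp min_l // le_min !ler_pdivlMr // !mul1r !ler_nat.
by rewrite lp.
Qed.

Lemma ramp_step p : `|ramp p.+1 - ramp p| <= l%:R^-1.
Proof.
have H (x y x' y' d : R) : 0 <= d -> `|x' - x| <= d -> `|y' - y| <= d ->
    `|Num.min x' y' - Num.min x y| <= d.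
  by rewrite !ler_norml => d0 /andP[a1 a2] /andP[b1 b2]; case: (leP x' y') => ?; case: (leP x y) => ?; apply/andP; split; lra.
have d0 : 0 <= l%:R^-1 :> R by rewrite invr_ge0.
have step (x y : nat) : (y <= x <= y.+1)%N -> `|x%:R / l%:R - y%:R / l%:R| <= l%:R^-1 :> R.
  case/andP=> yx xy; rewrite -mulrBl -natrB // normrM ger0_norm ?ler0n // ger0_norm ?invr_ge0 //.
  by rewrite -[leRHS]mul1r ler_wpM2r // -[1]/(1%:R) ler_nat; lia.
apply: (H) => //; first by rewrite subrr normr0.
apply: H => //; first by apply: (step); lia.
by rewrite distrC; apply: step; lia.
Qed.

Lemma expr_dist_le (x y : R) j : 0 <= x <= 1 -> 0 <= y <= 1 -> `|x ^+ j - y ^+ j| <= j%:R * `|x - y|.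
Proof.
move=> /andP[x0 x1] /andP[y0 y1]; elim: j => [|j IH].
  by rewrite !expr0 subrr normr0 mul0r.
have -> : x ^+ j.+1 - y ^+ j.+1 = x * (x ^+ j - y ^+ j) + (x - y) * y ^+ j.
  by rewrite !exprS; ring.
apply: le_trans (ler_normD _ _) _; rewrite !normrM -natr1 mulrDl mul1r.
apply: lerD.
  rewrite -[leRHS]mul1r; apply: ler_pM => //; rewrite ger0_norm //.
by rewrite -[leRHS]mulr1; apply: ler_pM => //; rewrite ger0_norm ?exprn_ge0 // exprn_ile1.
Qed.

(** Numbers the floors of the ramps: the first [l] floors from below, then the last ones by their
    distance to the top. On the plateau its value does not matter. *)
Definition ramp_rank (p : nat) := if (p < l)%N then p else (l + (m - p))%N.

Definition ramp_color N (x : 'I_m.+1 * 'I_N) : 'I_m.+1 := inord (ramp_rank x.1 * N + x.2).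

(** Rank and index are quotient and remainder of the color by [N]. The bound [2 l N <= m + 1] keeps
    [inord] from collapsing colors. *)
Lemma ramp_color_inj N (x y : 'I_m.+1 * 'I_N) : (2 * l * N <= m.+1)%N ->
  x != y -> ramp x.1 != 1 -> ramp y.1 != 1 -> ramp_color x != ramp_color y.
Proof.
move=> lN; have rk (z : 'I_m.+1 * 'I_N) : ramp z.1 != 1 -> (ramp_rank z.1 < 2 * l)%N.
  move=> z1; rewrite /ramp_rank; case: (ltnP z.1 l) => lz; first lia.
  case: (ltnP (m - z.1) l) => [|mz]; first lia.
  by rewrite ramp_eq1 ?eqxx in z1.
have val_color (z : 'I_m.+1 * 'I_N) : ramp z.1 != 1 -> ramp_color z = (ramp_rank z.1 * N + z.2)%N :> nat.
  move=> /rk zl; rewrite inordK //; apply: leq_trans lN.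
  have := ltn_ord z.2; nia.
move=> xy wx wy; apply: contra xy => /eqP/(congr1 val) /=.
rewrite !val_color // => E.
have N0 : (0 < N)%N by case: (N) (x.2) => // -[].
have := congr1 (modn^~ N) E; have := congr1 (divn^~ N) E.
rewrite !divnMDl // !modnMDl !divn_small // !modn_small // !addn0 /ramp_rank => E1 E2.
have x1 : x.1 = y.1.
  apply: val_inj => /=; have := ltn_ord x.1; have := ltn_ord y.1; move: E1.
  by case: (ltnP x.1 l) => ?; case: (ltnP y.1 l) => ?; lia.
have x2 : x.2 = y.2 by apply: val_inj.
by rewrite [x]surjective_pairing [y]surjective_pairing x1 x2.
Qed.

End RampWeight.

Lemma scX (R : realType) (A : cstarAlgType R) (t : R) j : (sc t : A) ^+ j = sc (t ^+ j).
Proof.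
elim: j => [|j IH]; first by rewrite !expr0 rmorph1 scale1r.
by rewrite !exprS IH scM.
Qed.

Lemma sc1 (R : realType) (A : cstarAlgType R) : sc 1 = 1 :> A.
Proof. by rewrite rmorph1 scale1r. Qed.

Lemma sc_sub (R : realType) (A : cstarAlgType R) (s t : R) : sc (s - t) = sc s - sc t :> A.
Proof. by rewrite rmorphB scalerBl. Qed.

Section CrossedTower.
Variables (R : realType) (A : cstarAlgType R) (alpha : A -> A) (B : cstarAlgType R)
  (iota : A -> B) (u : B).
Hypothesis alpha_aut : star_automorphism alpha.
Hypothesis B_crossed : crossed_product alpha iota u.
Let ci := cp_iota B_crossed.

Variables (n m l M t : nat) (F : seq A) (b0 b1 b2 d : A) (b' : 'I_m.+1 -> A)
  (e : 'I_m.+1 -> nat -> A) (g : nat -> 'I_n.+1 * 'I_m.+1 -> 'I_n.+1 * 'I_m.+1 -> A)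
  (r : 'I_M -> A).
Hypothesis l0 : (0 < l)%N.
Hypothesis lM : (2 * l * M <= m.+1)%N.
Hypothesis hT : tmatrix alpha iota F b0 d e g.
Hypothesis rb1 : \sum_s r s * b1 * star (r s) = 1.
Hypothesis rF : forall s, r s \in F.
Hypothesis b1F : b1 \in F.
Hypothesis pb0 : psd b0.
Hypothesis pb1 : psd b1.
Hypothesis pb' : forall p, psd (b' p).
Hypothesis bb' : forall p q, p != q -> b' p * b' q = 0.
Hypothesis db' : forall p, cuntz_le d (b' p).
Hypothesis b01 : b0 * b1 = 0.
Hypothesis pb2 : psd b2.
Hypothesis b'_le : cuntz_le (\sum_p b' p) b2.
Hypothesis b02 : b0 * b2 = 0.
Hypothesis b12 : b1 * b2 = 0.

Local Notation tw p := (twist alpha iota p).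
Local Notation TE := (towerE iota e).
Local Notation TF := (towerF alpha iota g).
Local Notation TW := (@towerW _ B u m.+1).
Let f (p : 'I_m.+1) : asymp B := acst (sc (ramp R l m p)).
Let w (p : 'I_m.+1) : asymp B := acst (sc (Num.sqrt (1 - ramp R l m p ^+ (2 * t).+2))).

Local Notation sigma := (tower_oz TE f TF).

Let f_sa p : star (f p) = f p. Proof. by rewrite -acst_star star_alg. Qed.
Let f_comm p x : f p * x = x * f p. Proof. by rewrite [RHS]acst_sc_comm. Qed.
Let w_sa p : star (w p) = w p. Proof. by rewrite -acst_star star_alg. Qed.
Let w_comm p x : w p * x = x * w p. Proof. by rewrite [RHS]acst_sc_comm. Qed.

Let ramp1 p : 0 <= 1 - ramp R l m p ^+ (2 * t).+2.
Proof. by have /andP[h0 h1] := ramp_itv R l m p; rewrite subr_ge0 exprn_ile1. Qed.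

Let wf p : w p * w p = 1 - f p ^+ (2 * t).+2.
Proof. by rewrite -acstM -scM -expr2 sqr_sqrtr // -acstX scX sc_sub acstB sc1 acst1. Qed.

Let w_neq0 p : w p != 0 -> ramp R l m p != 1.
Proof.
apply: contra_neq => p1; rewrite /w p1 expr1n subrr sqrtr0 rmorph0 scale0r; exact: acst0.
Qed.

Let Hp (p : 'I_m.+1) N := tw p (oz1 (g N)).

Let stw p : star_hom (tw p) := sh_twist alpha_aut B_crossed p.

Let Hp_psd p N : psd (Hp p N).
Proof. exact: (sh_psd (stw p) (tm_psd hT N)). Qed.

Let Hp_psd1 p N : psd (1 - Hp p N).
Proof. by rewrite -(sh1 (stw p)) -(shB (stw p)); exact: (sh_psd (stw p) (tm_psd1 hT N)). Qed.

Let HpE p N : Hp p N = \sum_x tw p (g N x x).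
Proof. by rewrite /Hp (sh_sum (stw p)). Qed.

Let Hp_norm p N : cnorm (Hp p N) <= 1.
Proof. by apply: psd_norm => //; rewrite sc1. Qed.

Let bHp p : abnd (Hp p). Proof. exact: bnd_le1. Qed.

Let cls_Hp p : cls (Hp p) = oz1 (TF p).
Proof.
rewrite /oz1 /towerF -cls_sum => [|x]; last exact: (bnd_twist alpha_aut B_crossed hT).
by congr cls; apply: funext => N; rewrite HpE.
Qed.

Let te := tm_tower hT.
Let bE p : abnd (fun N => iota (e p N)) := bnd_towerB B_crossed te p.
Let E_sa p : star (TE p) = TE p := towerB_sa B_crossed te p.
Let E_orth p q : p != q -> TE p * TE q = 0 := @towerB_orth _ _ _ _ _ _ B_crossed _ _ _ _ te p q.
Let hF p := oz_towerF alpha_aut B_crossed hT p.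
Let eF := towerEF alpha_aut B_crossed hT.

Let psd_iE p N : psd (iota (e p N)).
Proof. exact: (sh_psd ci (tower_psd te p N)). Qed.

Let pos1 N := iota (1 - \sum_p e p N ^+ (2 * t).+2).
(** The symmetric form is positive and Cuntz-below [iota b2] at every [N], and its class is the
    second summand of [tower_defect]. Halving the exponent [2t + 2] of [e] in this way is the reason
    for wanting an odd lifting exponent. *)
Let pos2 N := \sum_p iota (e p N) ^+ t.+1 * (1 - Hp p N ^+ (2 * t).+2) * iota (e p N) ^+ t.+1.

Let cls_pos1 : cls pos1 = 1 - \sum_p TE p ^+ (2 * t).+2.
Proof.
have bX p : abnd (fun N => iota (e p N) ^+ (2 * t).+2) by exact: bndX.
have -> : pos1 = fun N => 1 - \sum_p iota (e p N) ^+ (2 * t).+2.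
  apply: funext => N; rewrite /pos1 (shB ci) (sh1 ci) (sh_sum ci); congr (_ - _).
  by apply: eq_bigr => p _; rewrite (shX ci).
rewrite clsB ?cls_sum //; [|exact: bnd_cst|exact: bnd_sum].
by congr (_ - _); apply: eq_bigr => p _; exact: clsX.
Qed.

Let cls_pos2 : cls pos2 = \sum_p TE p ^+ (2 * t).+2 * (1 - oz1 (TF p) ^+ (2 * t).+2).
Proof.
have bX p : abnd (fun N => iota (e p N) ^+ t.+1) by exact: bndX.
have bH p : abnd (fun N => 1 - Hp p N ^+ (2 * t).+2).
  by apply: bndD; [exact: bnd_cst|apply: bndN; exact: bndX].
rewrite cls_sum => [|p]; last by apply: bndM => //; exact: bndM.
apply: eq_bigr => p _; rewrite clsM //; last exact: bndM.
rewrite clsM // clsX // clsB; [|exact: bnd_cst|exact: bndX].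
rewrite clsX // cls_Hp -/(TE p) -mulrA.
have -> : (cls (fun _ : nat => 1 : B) - oz1 (TF p) ^+ (2 * t).+2) * TE p ^+ t.+1 =
   TE p ^+ t.+1 * (1 - oz1 (TF p) ^+ (2 * t).+2).
  have eh : TE p * oz1 (TF p) = oz1 (TF p) * TE p by exact: e_H.
  apply: commrX; rewrite /GRing.comm mulrBl mulrBr mulr1 -[cls _]/(1 : asymp B) mul1r; congr (_ - _).
  exact/esym/(commrX (2 * t).+2 eh).
by rewrite mulrA -exprD; congr (_ ^+ _ * _); lia.
Qed.

Let pos1_psd N : psd (pos1 N).
Proof.
apply: (sh_psd ci); apply: orth_psd_1sub_sum => [p|p|p q pq].
- exact/psdX/(tower_psd te).
- apply: le_trans (cnormX _ _) _; rewrite (tower_norm te) expr1n //.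
- by rewrite exprSr (exprS (e q N)) mulrA -(mulrA _ (e p N)) (tower_orth te) // mulr0 mul0r.
Qed.

Let pos2_psd N : psd (pos2 N).
Proof.
apply: psd_sum => p _; apply: psd_conj_sa; first by rewrite starX psd_sa.
exact: psd_1sub_expr.
Qed.

Let iXorth j (p q : 'I_m.+1) N : p != q -> iota (e p N) ^+ j.+1 * iota (e q N) ^+ j.+1 = 0.
Proof.
move=> pq; rewrite exprSr (exprS (iota (e q N))) mulrA -(mulrA _ (iota (e p N))).
by rewrite -(shM ci) (tower_orth te) // (sh0 ci) mulr0 mul0r.
Qed.

Let pos1_le N : cuntz_le (pos1 N) (iota b0).
Proof.
apply: (sh_cuntz ci); apply: cuntz_trans (tower_small te N).
have -> : \sum_p e p N ^+ (2 * t).+2 = (\sum_p e p N) ^+ (2 * t).+2.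
  have -> : \sum_p e p N = \sum_p e p N * 1 by apply: eq_bigr => p _; rewrite mulr1.
  rewrite glueX => [|p q pq|p q]; last by rewrite mul1r mulr1.
    by apply: eq_bigr => p _; rewrite expr1n mulr1.
  exact: (tower_orth te).
by apply: cuntz_1sub_expr; apply: psd_sum => p _; exact: tower_psd te p N.
Qed.

Let pos2_le N : cuntz_le (pos2 N) (iota b2).
Proof.
apply: cuntz_trans (sh_cuntz ci b'_le); rewrite (sh_sum ci); apply: cuntz_sum => [p|p q pq|p].
- exact: sh_psd.
- by rewrite -(shM ci) bb' // (sh0 ci).
- apply: cuntz_trans (cuntz_conj_sa _ _) _; first by rewrite starX psd_sa.
  rewrite /Hp -(shX (stw p)) -(sh1 (stw p)) -(shB (stw p)) (twist_conj B_crossed) -starX.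
  apply: cuntz_trans (cuntz_conj _ _) _; apply: (sh_cuntz ci).
  apply: cuntz_trans (db' p); apply: cuntz_trans (tm_small hT N).
  by apply: cuntz_1sub_expr; exact: tm_psd hT N.
Qed.

(** [tower_defect] is an identity of classes only; each of its summands has a representative that is
    positive and satisfies the Cuntz comparison at every stage. *)
Lemma crossed_tower_defect : exists rr : nat -> B, [/\ forall N, psd (rr N),
  forall N, cuntz_le (rr N) (iota (b0 + b2 + b1)), abnd rr &
  cls rr = 1 - oz1 sigma ^+ (2 * t).+2].
Proof.
(* Any bounded representative [x] of [ramp_factor] will do: [x^* b1 x] lies below [b1] at every
   stage, whatever relations fail there. *)
have [x bx xE] := cls_surj (ramp_factor TE TF TW (fun s => acst (iota (r s))) w (@ramp_color l m M) t).
pose pos3 N := star (x N) * iota b1 * x N.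
have b3 : abnd pos3 by apply: bndM => //; apply: bndM; [exact: bnd_star|exact: bnd_cst].
have bp1 : abnd pos1.
  apply: (bnd_iota B_crossed (x := fun N => 1 - \sum_p e p N ^+ (2 * t).+2)); apply: bndD; first exact: bnd_cst.
  by apply: bndN; apply: bnd_sum => p _; apply: bndX; exact: tower_bnd te.
have bp2 : abnd pos2.
  apply: bnd_sum => p _; apply: bndM; last exact: bndX.
  by apply: bndM; [exact: bndX|apply: bndD; [exact: bnd_cst|apply: bndN; exact: bndX]].
exists (fun N => pos1 N + pos2 N + pos3 N); split.
- move=> N; apply: psdD; first exact: psdD.
  by apply: psd_conj_star; exact: sh_psd.
- move=> N; rewrite !(shD ci); apply: cuntz_add.
  + by rewrite -(shD ci); apply: (sh_psd ci); exact: psdD.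
  + exact: sh_psd.
  + rewrite -(shD ci) -(shM ci) mulrDl b01 add0r.
    by rewrite -(psd_sa pb1) -(psd_sa pb2) -starM b12 star0 (sh0 ci).
  + apply: cuntz_add; [exact: sh_psd|exact: sh_psd| |exact: pos1_le|exact: pos2_le].
    by rewrite -(shM ci) b02 (sh0 ci).
  + exact: cuntz_conj_star.
- by apply: bndD => //; exact: bndD.
- rewrite clsD //; last exact: bndD.
  rewrite clsD // cls_pos1 cls_pos2 tower_defect //; congr (_ + _).
  rewrite /pos3 clsM //; last by apply: bndM; [exact: bnd_star|exact: bnd_cst].
  rewrite clsM; [|exact: bnd_star|exact: bnd_cst].
  rewrite cls_star // -xE -/(acst (iota b1)) ramp_factor_sqr //.
  + apply: eq_bigr => p _; rewrite wf mulnS; congr (_ * _).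
    by rewrite exprMn_comm //; exact: e_H.
  + exact: star_towerW.
  + exact: (towerWW B_crossed).
  + exact: (towerWF alpha_aut B_crossed hT).
  + exact: (towerWe B_crossed hT).
  + rewrite -acst1 -(sh1 ci) -rb1 (sh_sum ci) acst_sum; apply: eq_bigr => s _.
    by rewrite !(shM ci) !acstM (sh_star ci) acst_star.
  + by move=> q s; apply: (towerB_comm B_crossed te).
  + by move=> q; apply: (towerB_comm B_crossed te).
  + by move=> q s y z; apply: (towerF_comm alpha_aut B_crossed hT).
  + by move=> q y z; apply: (towerF_comm alpha_aut B_crossed hT).
  + by move=> y z yz wy wz; apply: ramp_color_inj => //; exact: w_neq0.
Qed.


Let AE (p : 'I_m.+1) N := amp (fun x y => tw p (g N x y)).

Let oz_AE p N : oz (AE p N).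
Proof. exact/oz_amp/(oz_sh (stw p))/(tm_oz hT). Qed.

Let oz1_AE p N : oz1 (AE p N) = Hp p N.
Proof. by rewrite oz1_amp HpE. Qed.

Let AE_norm p N i j : cnorm (AE p N i j) <= 1.
Proof.
rewrite -(@ler_pXn2r _ 2) ?nnegrE ?cnorm_ge0 // expr1n -cnorm_star (oz_star (oz_AE p N)).
rewrite (ozM (oz_AE p N)) eqxx oz1_AE -[1]mulr1; apply: cnormM_le => //.
have pAE a : psd (AE p N a a).
  by apply: psd_sum => q _; exact: (sh_psd (stw p) (tm_diag hT N _)).
apply: le_trans (Hp_norm p N); apply: psd_cnorm_le => //.
by rewrite -oz1_AE /oz1 (bigD1 j) //= addrC addrK; exact: psd_sum.
Qed.

Let bAE p i j : abnd (fun N => AE p N i j). Proof. exact: bnd_le1. Qed.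

Let cls_AE p i j : cls (fun N => AE p N i j) = amp (TF p) i j.
Proof. by rewrite cls_sum // => q; exact: (bnd_twist alpha_aut B_crossed hT). Qed.

Let Z p i j : asymp B := oz1 (TF p) ^+ (2 * t).+1 * amp (TF p) i j.
Let zz p i j N := Hp p N ^+ (2 * t).+1 * AE p N i j.

Let bzz p i j : abnd (zz p i j). Proof. by apply: bndM => //; exact: bndX. Qed.

Let cls_zz p i j : cls (zz p i j) = Z p i j.
Proof. by rewrite clsM ?clsX ?cls_Hp ?cls_AE //; exact: bndX. Qed.

Let zz_norm p i j N : cnorm (zz p i j N) <= 1.
Proof.
rewrite -[1]mulr1; apply: cnormM_le => //; apply: le_trans (cnormX _ _) _.
by apply: exprn_ile1 => //; exact: cnorm_ge0.
Qed.

Let E_Z q p i j : TE q * Z p i j = Z p i j * TE q.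
Proof.
have eh : TE q ^+ 1 * oz1 (TF p) = oz1 (TF p) * TE q ^+ 1 by rewrite expr1; exact: e_H.
have h := commrX (2 * t).+1 eh; rewrite /GRing.comm expr1 in h.
by rewrite /Z mulrA h -!mulrA; congr (_ * _); exact: e_amp.
Qed.

Let U_shift (p q : 'I_m.+1) i j : q = p.+1 :> nat ->
  acst u * (TE p ^+ (2 * t).+2 * Z p i j) = TE q ^+ (2 * t).+2 * Z q i j * acst u.
Proof.
move=> pq; have Ue : acst u * TE p = TE q * acst u by exact: (towerB_shift B_crossed te pq).
have UF x y : acst u * TF p x y = TF q x y * acst u.
  by exact: (towerF_shift alpha_aut B_crossed hT).
have UX (x y : asymp B) j' : acst u * x = y * acst u -> acst u * x ^+ j' = y ^+ j' * acst u.
  move=> xy; elim: j' => [|j' IH]; first by rewrite !expr0 mulr1 mul1r.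
  by rewrite !exprS mulrA xy -mulrA IH mulrA.
have UH : acst u * oz1 (TF p) = oz1 (TF q) * acst u.
  by rewrite /oz1 mulr_sumr mulr_suml; apply: eq_bigr => x _; exact: UF.
have UA : acst u * amp (TF p) i j = amp (TF q) i j * acst u.
  by rewrite /amp mulr_sumr mulr_suml; apply: eq_bigr => x _; exact: UF.
by rewrite /Z mulrA (UX _ _ _ Ue) -mulrA (mulrA (acst u)) (UX _ _ _ UH) -(mulrA _ (acst u)) UA !mulrA.
Qed.

Let step (i : 'I_m) : R := ramp R l m i.+1 ^+ (2 * t).+2 - ramp R l m i ^+ (2 * t).+2.

Let step_le i : `|step i| <= (2 * t).+2%:R / l%:R.
Proof.
apply: le_trans (expr_dist_le _ (ramp_itv _ _ _ _) (ramp_itv _ _ _ _)) _.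
by apply: ler_wpM2l => //; exact: ramp_step.
Qed.

(** As [u] moves floor [p] to floor [p + 1], the commutator is a sum over floors of differences of
    consecutive weights; the weights at both ends vanish, so the missing passage from the last floor
    to the first does no harm. The representative [y] is block diagonal, and [orth_sandwich_norm]
    bounds it by the largest difference. *)
Lemma crossed_tower_shift i j (x : nat -> B) : abnd x ->
  cls x = oz1 sigma ^+ (2 * t).+1 * sigma i j ->
  forall del : R, (2 * t).+2%:R / l%:R < del ->
  exists N0 : nat, forall N, (N0 <= N)%N -> ncomm (x N) u < del.
Proof.
move=> bx xE del ldel; pose q (a : 'I_m) : 'I_m.+1 := lift ord0 a.
pose y N := (\sum_a iota (e (q a) N) ^+ t.+1 * ((step a)%:C *: zz (q a) i j N) * iota (e (q a) N) ^+ t.+1) * u.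
have by1 a : abnd (fun N => iota (e (q a) N) ^+ t.+1 * ((step a)%:C *: zz (q a) i j N)).
  by apply: bndM; [exact: bndX|exact: bndZ].
have by2 a : abnd (fun N => iota (e (q a) N) ^+ t.+1 * ((step a)%:C *: zz (q a) i j N) * iota (e (q a) N) ^+ t.+1).
  by apply: bndM => //; exact: bndX.
have bY : abnd y by apply: bndM; [exact: bnd_sum|exact: bnd_cst].
have y_norm N : cnorm (y N) <= (2 * t).+2%:R / l%:R.
  rewrite -[leRHS]mulr1; apply: cnormM_le; last first.
    rewrite -(@ler_pXn2r _ 2) ?nnegrE ?cnorm_ge0 // -cnorm_star (cp_su_u B_crossed).
    by rewrite cnorm1 expr1n.
  apply: (@orth_sandwich_norm _ _ _ (fun a => iota (e (q a) N) ^+ t.+1)).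
  - by move=> a; exact: psdX.
  - move=> a; apply: le_trans (cnormX _ _) _; apply: exprn_ile1; first exact: cnorm_ge0.
    by apply: le_trans (sh_norm ci _) _; rewrite (tower_norm te).
  - by move=> a c ac; apply: iXorth; rewrite (inj_eq lift_inj).
  - by rewrite divr_ge0.
  - move=> a; rewrite cnormZr -[leRHS]mulr1.
    by apply: ler_pM => //; exact: cnorm_ge0.
pose T p := TE p ^+ (2 * t).+2 * Z p i j.
have cls_y : cls y = (\sum_a (f (q a) ^+ (2 * t).+2 - f (widen_ord (leqnSn m) a) ^+ (2 * t).+2) * T (q a)) * acst u.
  rewrite clsM //; [|exact: bnd_sum|exact: bnd_cst]; congr (_ * _).
  rewrite cls_sum //; apply: eq_bigr => a _.
  rewrite clsM //; last exact: bndX.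
  rewrite clsM //; [|exact: bndX|exact: bndZ].
  have -> : cls (fun N => (step a)%:C *: zz (q a) i j N) = acst (sc (step a)) * Z (q a) i j.
    rewrite -cls_zz -clsM //; last exact: bnd_cst.
    by congr cls; apply: funext => N; rewrite mulr_algl.
  rewrite !clsX // -/(TE (q a)).
  have -> : acst (sc (step a)) = f (q a) ^+ (2 * t).+2 - f (widen_ord (leqnSn m) a) ^+ (2 * t).+2.
    by rewrite /f -!acstX !scX -acstB -sc_sub.
  set c := _ - _; have cc v : c * v = v * c.
    by rewrite /c /f -!acstX !scX -acstB -sc_sub [RHS]acst_sc_comm.
  have EZ : Z (q a) i j * TE (q a) ^+ t.+1 = TE (q a) ^+ t.+1 * Z (q a) i j.
    by apply: commrX; exact/esym/E_Z.
  have gen (a1 c1 z1 : asymp B) : (forall v, c1 * v = v * c1) -> z1 * a1 = a1 * z1 ->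
      a1 * (c1 * z1) * a1 = c1 * (a1 * a1 * z1).
    by move=> h1 h2; rewrite mulrA -h1 -!mulrA h2.
  by rewrite gen // -exprD /T; do 2!congr (_ * _); congr (_ ^+ _); lia.
have xT : cls x = \sum_p f p ^+ (2 * t).+2 * T p.
  by rewrite xE tower_pow //; apply: eq_bigr => p _; rewrite -mulrA.
have f0 : f ord0 = 0 by rewrite /f ramp0 rmorph0 scale0r acst0.
have fm : f ord_max = 0 by rewrite /f ramp_last rmorph0 scale0r acst0.
have fU p : acst u * f p ^+ (2 * t).+2 = f p ^+ (2 * t).+2 * acst u.
  by apply: commrX; exact/esym/f_comm.
have comm_y : cls x * acst u - acst u * cls x = cls y.
  rewrite cls_y xT; have -> : acst u * (\sum_p f p ^+ (2 * t).+2 * T p) =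
      (\sum_a f (widen_ord (leqnSn m) a) ^+ (2 * t).+2 * T (q a)) * acst u.
    rewrite mulr_sumr big_ord_recr /= fm expr0n /= mul0r mulr0 addr0 mulr_suml.
    by apply: eq_bigr => a _; rewrite mulrA fU -mulrA (@U_shift _ (q a)) // mulrA.
  rewrite big_ord_recl f0 expr0n /= mul0r add0r -mulrBl -sumrB; congr (_ * _).
  by apply: eq_bigr => a _; rewrite mulrBl.
have bxu : abnd (fun N => x N * u - u * x N).
  by apply: bndD; [|apply: bndN]; apply: bndM => //; exact: bnd_cst.
have clE : cls (fun N => x N * u - u * x N) = cls y.
  rewrite -comm_y clsB; [|by apply: bndM => //; exact: bnd_cst|by apply: bndM => //; exact: bnd_cst].
  by rewrite !clsM //; exact: bnd_cst.
have d0 : 0 < del - (2 * t).+2%:R / l%:R by rewrite subr_gt0.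
have [N0 HN] := proj1 (cls_eqP bxu bY) clE _ d0.
exists N0 => N /HN h; rewrite /ncomm.
by have := cnorm_le_dist (x N * u - u * x N) (y N); have := y_norm N; lra.
Qed.

Lemma crossed_tower_comm i j (x : nat -> B) y : abnd x -> y \in F ->
  cls x = oz1 sigma ^+ (2 * t).+1 * sigma i j -> null (fun N => ncomm (x N) (iota y)).
Proof.
move=> bx yF xE; have EY q : TE q * acst (iota y) = acst (iota y) * TE q.
  exact: (towerB_comm B_crossed te).
have FY p z z' : TF p z z' * acst (iota y) = acst (iota y) * TF p z z'.
  exact: (towerF_comm alpha_aut B_crossed hT).
have SY a c : sigma a c * acst (iota y) = acst (iota y) * sigma a c.
  rewrite /tower_oz /glue mulr_sumr mulr_suml; apply: eq_bigr => p _.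
  have AY : amp (TF p) a c * acst (iota y) = acst (iota y) * amp (TF p) a c.
    by rewrite /amp mulr_sumr mulr_suml; apply: eq_bigr.
  by rewrite -mulrA AY !mulrA; congr (_ * _); rewrite -mulrA EY mulrA f_comm -mulrA.
have S1Y : acst (iota y) * oz1 sigma = oz1 sigma * acst (iota y).
  by rewrite /oz1 mulr_sumr mulr_suml; apply: eq_bigr.
have XY : cls x * acst (iota y) = acst (iota y) * cls x.
  have h := commrX (2 * t).+1 S1Y; rewrite /GRing.comm in h.
  by rewrite xE mulrA h -!mulrA SY.
have bxy : abnd (fun N => x N * iota y) by apply: bndM => //; exact: bnd_cst.
have byx : abnd (fun N => iota y * x N) by apply: bndM => //; exact: bnd_cst.
by apply: (proj1 (cls_eqP bxy byx)); rewrite !clsM //; exact: bnd_cst.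
Qed.

Hypothesis lift : forall G : 'I_n.+1 -> 'I_n.+1 -> asymp B, oz G ->
  exists gs : nat -> 'I_n.+1 -> 'I_n.+1 -> B, [/\ forall N, oz (gs N), forall i j, abnd (fun N => gs N i j) &
    forall i j, cls (fun N => oz1 (gs N) * gs N i j) = oz1 G ^+ (2 * t).+1 * G i j].

Lemma crossed_tower_system : exists (gs : nat -> 'I_n.+1 -> 'I_n.+1 -> B) (rr : nat -> B),
  [/\ forall N, oz (gs N), forall N, psd (rr N) /\ cuntz_le (rr N) (iota (b0 + b2 + b1)),
      null (fun N => cnorm (1 - oz1 (gs N) * oz1 (gs N) - rr N)),
      forall i j del, (2 * t).+2%:R / l%:R < del -> exists N0 : nat, forall N, (N0 <= N)%N ->
        ncomm (oz1 (gs N) * gs N i j) u < del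
    & forall i j y, y \in F -> null (fun N => ncomm (oz1 (gs N) * gs N i j) (iota y))].
Proof.
have oz_sigma : oz sigma by exact: oz_tower.
have [gs [ozg bg gE]] := lift oz_sigma.
have [rr [prr rr_le brr rrE]] := crossed_tower_defect.
have bS : abnd (fun N => oz1 (gs N)) by exact: bnd_sum.
have bSg i j : abnd (fun N => oz1 (gs N) * gs N i j) by exact: bndM.
exists gs, rr; split=> //.
- have bSS : abnd (fun N => 1 - oz1 (gs N) * oz1 (gs N)).
    by apply: bndD; [exact: bnd_cst|apply: bndN; exact: bndM].
  apply: (proj1 (cls_eqP bSS brr)); rewrite rrE clsB; [|exact: bnd_cst|exact: bndM].
  congr (1 - _); transitivity (\sum_i cls (fun N => oz1 (gs N) * gs N i i)).
    rewrite -cls_sum //; congr cls; apply: funext => N; exact: mulr_sumr.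
  by rewrite [RHS]exprSr mulr_sumr; apply: eq_bigr => i _.
- by move=> i j del; exact: crossed_tower_shift (gE i j) del.
- by move=> i j y yF; exact: crossed_tower_comm (gE i j).
Qed.

End CrossedTower.

(** The exponent [23 = 2 * 11 + 1] is hidden behind a quantifier; only its being odd is used in the
    proof of the theorem. *)
Lemma oz_lift_odd : exists t : nat, forall (R : realType) (A : cstarAlgType R) n
  (F : 'I_n.+1 -> 'I_n.+1 -> asymp A), oz F ->
  exists g : nat -> 'I_n.+1 -> 'I_n.+1 -> A, [/\ forall N, oz (g N), forall i j, abnd (fun N => g N i j) &
    forall i j, cls (fun N => oz1 (g N) * g N i j) = oz1 F ^+ (2 * t).+1 * F i j].
Proof. by exists 11%N => R A n F; exact: oz_lift. Qed.

(** * Choice of a finite stage and conclusion *)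

Lemma eventually_seq (T : eqType) (s : seq T) (P : T -> nat -> Prop) :
  (forall i, i \in s -> exists N0 : nat, forall n, (N0 <= n)%N -> P i n) ->
  exists N0 : nat, forall n, (N0 <= n)%N -> forall i, i \in s -> P i n.
Proof.
elim: s => [|a s IH] H; first by exists 0%N.
have [|N1 H1] := IH; first by move=> i is_; apply: H; rewrite inE is_ orbT.
have [N2 H2] := H a (mem_head _ _); exists (maxn N1 N2) => n; rewrite geq_max => /andP[n1 n2] i.
by rewrite inE => /orP[/eqP -> |]; [exact: H2|exact: H1].
Qed.

Lemma not_isomorphic_to_C_ext (R : realType) (A B : cstarAlgType R) (iota : A -> B) :
  star_hom iota -> injective iota -> isomorphic_to_C B -> isomorphic_to_C A.
Proof.
move=> ci inj_iota [f [lin [f1 fM] f_star bij]]; exists (fun a => f (iota a)).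
have fK c : f (iota (c *: 1)) = c.
  have fZ x : f (c *: x) = c * f x.
    have f0 : f 0 = 0 by have := lin 1 0 0; rewrite scaler0 addr0 scale1r => /esym; rewrite -[X in _ = X]addr0 => /addrI.
    by have := lin c x 0; rewrite addr0 f0 addr0.
  by rewrite (shZ ci) (sh1 ci) fZ f1 mulr1.
split.
- by move=> c x y; rewrite (shD ci) (shZ ci) lin.
- by split=> [|x y]; rewrite ?(sh1 ci) ?(shM ci).
- by move=> x; rewrite (sh_star ci).
- apply: (@Bijective _ _ _ (fun c : R[i] => c%:A : A)) => [a|c]; last exact: fK.
  by apply: inj_iota; apply: (bij_inj bij); rewrite fK.
Qed.

Lemma cpc_ncomm (R : realType) (A : cstarAlgType R) n (phi : 'M[R[i]]_n -> A) X y (eta : R) :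
  cpc_order_zero phi -> opnorm X <= 1 -> (forall i j, ncomm (phi (delta_mx i j)) y <= eta) ->
  ncomm (phi X) y <= (n * n)%:R * eta.
Proof.
move=> hphi X1 H; have -> : phi X = \sum_i \sum_j X i j *: phi (delta_mx i j).
  rewrite {1}(matrix_sum_delta X) (cpc_sum hphi); apply: eq_bigr => i _.
  by rewrite (cpc_sum hphi); apply: eq_bigr => j _; rewrite (cpcZ hphi).
rewrite /ncomm mulr_suml mulr_sumr -sumrB; apply: le_trans (cnorm_sum _ _ _) _.
apply: (@le_trans _ _ (\sum_(i < n) \sum_(j < n) eta)).
  apply: ler_sum => i _; rewrite mulr_suml mulr_sumr -sumrB; apply: le_trans (cnorm_sum _ _ _) _.
  apply: ler_sum => j _; rewrite -scalerAl -scalerAr -scalerBr cnormZ.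
  have := H i j; rewrite /ncomm; move: (_ - _) => z hz.
  rewrite -[leRHS]mul1r; apply: ler_pM => //; [exact: nrm_ge0|exact: cnorm_ge0|].
  exact: le_trans (nrm_le_opnorm _ _ _) X1.
by rewrite !sumr_const !card_ord -mulrnA mulr_natl.
Qed.

Lemma ncomm_distl (R : realType) (A : cstarAlgType R) (x x' y : A) :
  ncomm x y <= ncomm x' y + 2 * cnorm (x' - x) * cnorm y.
Proof.
rewrite /ncomm; have -> : x * y - y * x = (x' * y - y * x') - ((x' - x) * y - y * (x' - x)) by ncring.
apply: le_trans (cnormB _ _) _; rewrite lerD2l; apply: le_trans (cnormB _ _) _.
have := cnormM (x' - x) y; have := cnormM y (x' - x); lra.
Qed.

Theorem theorem6p7 (R : realType) (A : cstarAlgType R) (alpha : A -> A)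
    (A_simple : simple_cstar A)
    (A_separable : separable_cstar A)
    (A_Zabs : tracially_Z_absorbing A)
    (alpha_aut : star_automorphism alpha)
    (alpha_Rokhlin : generalized_tracial_Rokhlin alpha)
    (alpha_trace : exists m : nat, (0 < m)%N /\
       forall tau : A -> R[i], tracial_state tau ->
         forall a : A, tau (iter m alpha a) = tau a)
    (B : cstarAlgType R) (iota : A -> B) (u : B)
    (B_crossed : crossed_product alpha iota u) :
  tracially_Z_absorbing B.
Proof.
have ci := cp_iota B_crossed.
split.
  case: A_Zabs => nA _; apply: contra_not nA; apply: (not_isomorphic_to_C_ext ci).
  exact: (cp_iota_inj A_simple B_crossed).
move=> F eps a [//|n] eps0 /positiveP pa a0 _.
have [b [pb b_neq0 b_le]] := cp_lower A_simple alpha_aut alpha_Rokhlin B_crossed pa a0.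
have [c [pc c0 c_orth c_le]] := split_positive A_simple alpha_Rokhlin (ltn0Sn 2) pb b_neq0.
have [t lift] := oz_lift_odd.
(* Passing from matrix units to a matrix of norm 1 costs the number of units ([cpc_ncomm]); the
   factor 2 makes the final inequality strict. *)
have eta0 : 0 < eps / (2 * (n.+1 * n.+1)%:R) by rewrite divr_gt0 // mulr_gt0 // ltr0n.
have [FA [del [del0 transfer]]] := cp_comm_ctrl B_crossed F eta0.
have M0 : 0 < (2 * t).+2%:R :> R by rewrite ltr0n.
have del2 : 0 < del / 2 by lra.
(* [(2t + 2) / (l + 1)] bounds the commutator with [u]. Half of [del] is left for the passage from
   the lifted system to [phi]. *)
have [l Hl] := null_lt (@null_inv R) (divr_gt0 del2 M0).
have {}Hl : (2 * t).+2%:R / l.+1%:R < del / 2 by rewrite -ltr_pdivlMl // mulrC.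
pose i0 : 'I_3 := ord0; pose i1 : 'I_3 := inord 1; pose i2 : 'I_3 := inord 2.
have i01 : i0 != i1 by rewrite -val_eqE /= inordK.
have i02 : i0 != i2 by rewrite -val_eqE /= inordK.
have i12 : i1 != i2 by rewrite -val_eqE /= !inordK.
have [M [r rE]] := simple_full A_simple (pc i1) (c0 i1).
pose m := (2 * l.+1 * M)%N.
(* One piece for each of the [m + 1] floors: a single order zero map is used, but a conjugate of its
   remainder appears on every floor, so the remainder is made smaller than a common lower bound of
   the pieces. *)
have [b' [pb' b'0 bb' b'_le]] := split_positive A_simple alpha_Rokhlin (ltn0Sn m) (pc i2) (c0 i2).
have [d [pd d0 db']] := simple_common_lower_fin A_simple (pc i2) (c0 i2) pb' b'0.
(* Besides [FA], the tower and the matrix units have to commute with [c i1] and the [r s], which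
   enter the comparison of the ramps. *)
pose FT := c i1 :: [seq r s | s : 'I_M] ++ FA.
have [e [g hT]] := tmatrix_exists A_Zabs alpha_aut alpha_Rokhlin B_crossed (ord0 : 'I_n.+1) FT
  (ltn0Sn m) (pc i0) (c0 i0) pd d0.
have [|||||gs [rr [ozg rr_psd rr_null Hu HF]]] := crossed_tower_system alpha_aut B_crossed
  (ltn0Sn l) (leqnSn m) hT rE _ _ (pc i0) (pc i1) pb' bb' db' _ (pc i2) b'_le _ _ (lift R B n).
- by move=> s; rewrite inE mem_cat fintype.image_f ?orbT.
- exact: mem_head.
- exact: c_orth.
- exact: c_orth.
- exact: c_orth.
have rr_le N : cuntz_le (rr N) a.
  apply: cuntz_trans (proj2 (rr_psd N)) _; apply: cuntz_trans b_le.
  apply: (sh_cuntz ci); apply: cuntz_trans c_le.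
  apply: cuntz_mono; first by apply: psdD => //; exact: psdD.
  rewrite (bigD1 i0) //= (bigD1 i1) 1?eq_sym //= (bigD1 i2) /=; last by rewrite ![i2 == _]eq_sym i02 i12.
  set s := \sum_(_ < _ | _) _; have -> : c i0 + (c i1 + (c i2 + s)) - (c i0 + c i2 + c i1) = s by ncring.
  exact: psd_sum.
pose K := \sum_(y <- FA) cnorm y + 1.
have sum0 : 0 <= \sum_(y <- FA) cnorm y by apply: sumr_ge0 => y _; exact: cnorm_ge0.
have K0 : 0 < K by rewrite /K; lra.
have KFA y : y \in FA -> cnorm (iota y) <= K.
  move=> yF; apply: le_trans (sh_norm ci _) _; rewrite /K (big_rem y yF) /= -addrA lerDl.
  by apply: addr_ge0 => //; apply: sumr_ge0 => z _; exact: cnorm_ge0.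
have Ku : cnorm u <= K.
  rewrite -(@ler_pXn2r _ 2) ?nnegrE ?cnorm_ge0 ?(ltW K0) // -cnorm_star (cp_su_u B_crossed) cnorm1.
  by rewrite expr_ge1 ?(ltW K0) // /K; lra.
(* [oz_renorm] moves the matrix units by at most [3 eta], which changes a commutator with an element
   of norm at most [K] by at most [6 eta K <= del / 2]; the other bound ensures [eta < 1]. *)
pose eta := Num.min (1 / 2) (del / (12 * K)).
have K12 : 0 < 12 * K by rewrite mulr_gt0.
have eta1 : 0 < eta by rewrite lt_min divr_gt0 // divr_gt0.
have eta2 : eta <= 1 / 2 by rewrite ge_min lexx.
have eta3 : 12 * K * eta <= del by rewrite mulrC -ler_pdivlMr // ge_min lexx orbT.
pose T N (p : 'I_n.+1 * 'I_n.+1) := oz1 (gs N) * gs N p.1 p.2.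
have [N1 H1] : exists N0 : nat, forall N, (N0 <= N)%N -> forall p, ncomm (T N p) u < del / 2.
  by apply: eventually_fin => p; exact: Hu.
have [N2 H2] : exists N0 : nat, forall N, (N0 <= N)%N -> forall y, y \in FA ->
    forall p, ncomm (T N p) (iota y) < del / 2.
  apply: eventually_seq => y yF; apply: eventually_fin => p.
  by apply: HF => //; rewrite inE mem_cat yF !orbT.
have [N3 H3] := rr_null _ eta1.
pose N := maxn N1 (maxn N2 N3).
have {}H1 := H1 N (leq_maxl _ _).
have {}H2 := H2 N (leq_trans (leq_maxl _ _) (leq_maxr _ _)).
have {}H3 := H3 N (leq_trans (leq_maxr _ _) (leq_maxr _ _)).
have eta_itv : 0 < eta < 1 by rewrite eta1 /=; lra.
have [phi [hphi phi_close phi_le]] := oz_renorm (ozg N) (proj1 (rr_psd N)) eta_itv (ltW H3).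
exists phi; split=> //; first exact: cuntz_trans phi_le (rr_le N).
move=> X y X1 yF; change (ncomm (phi X) y < eps).
have arith (h k w v d' : R) : v < d' / 2 -> 12 * k * h <= d' -> w <= 3 * h * k -> v + 2 * w <= d'.
  by move=> *; nra.
have near_phi i j z : cnorm z <= K -> ncomm (T N (i, j)) z < del / 2 -> ncomm (phi (delta_mx i j)) z <= del.
  move=> zK zT; apply: le_trans (ncomm_distl _ (T N (i, j)) _) _; rewrite -mulrA.
  have : cnorm (T N (i, j) - phi (delta_mx i j)) * cnorm z <= 3 * eta * K.
    apply: ler_pM => //; try exact: cnorm_ge0; exact: phi_close.
  move: (cnorm _ * cnorm _) (ncomm _ _) zT eta3 => w v.
  exact: (arith eta K w v del).
have phi_comm i j z : z \in u :: map iota FA -> ncomm (phi (delta_mx i j)) z <= del.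
  rewrite inE => /orP[/eqP ->|/mapP[v vF ->]]; first exact: near_phi (H1 _).
  exact: near_phi (KFA _ vF) (H2 _ vF _).
have half : ncomm (phi X) y <= (n.+1 * n.+1)%:R * (eps / (2 * (n.+1 * n.+1)%:R)).
  apply: (cpc_ncomm hphi); first by rewrite X1.
  move=> i j; apply: transfer => //; first exact: cpc_norm hphi i j.
  by move=> z zF; split; [exact: phi_comm|rewrite (cpc_star hphi i j); exact: phi_comm].
apply: le_lt_trans half _; have n0 : 0 < (n.+1 * n.+1)%:R :> R by rewrite ltr0n.
by move: (_%:R) n0 => q q0; rewrite (_ : q * (eps / (2 * q)) = eps / 2); [lra|field; lra].
Qed.
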